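(* Let $A$ be a commutative Noetherian ring, let $\mathbf u=u_1,\dots,u_m$ be elements of $A$ and let $M,N$ be finitely generated $A$-modules. Then: (1) there exists a first quadrant cohomology spectral sequence $$E_2^{p,q}=\operatorname{Ext}^p_A(N,H^q(\mathbf u,M))\Rightarrow V^{p+q}(\mathbf u,N,M);$$ (2) there exists a first quadrant cohomology spectral sequence $$E_2^{p,q}=\operatorname{Ext}^p_A(H_q(\mathbf u,M),N)\Rightarrow U^{p+q}(\mathbf u,M,N);$$ (3) there exists a first quadrant homology spectral sequence $$E^2_{p,q}=\operatorname{Tor}^A_p(H_q(\mathbf u,M),N)\Rightarrow W_{p+q}(\mathbf u,M,N).$$
   Context: $\mathbb K_\bullet(\mathbf u,M)$ and $\mathbb K^\bullet(\mathbf u,M)$ are the Koszul chain and cochain complexes of $\mathbf u$ with coefficients in $M$, with homology $H_q(\mathbf u,M)$ and cohomology $H^q(\mathbf u,M)$. Let $\mathbf E^\bullet$ be an injective resolution of $\mathbb K^\bullet(\mathbf u,M)$ (a bounded below cochain complex of injective modules with a quasi-isomorphism $\mathbb K^\bullet(\mathbf u,M)\to\mathbf E^\bullet$) and let $\mathbf P_\bullet$ be a projective resolution of $\mathbb K_\bullet(\mathbf u,M)$ (a chain complex of finitely generated projective modules with $P_n=0$ for $n\ll0$ and a quasi-isomorphism $\mathbf P_\bullet\to\mathbb K_\bullet(\mathbf u,M)$). Define $V^i(\mathbf u,N,M)=H^i(\operatorname{Hom}_A(N,\mathbf E^\bullet))$, $U^i(\mathbf u,M,N)=H^i(\operatorname{Hom}_A(\mathbf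 P_\bullet,N))$ and $W_i(\mathbf u,M,N)=H_i(\mathbf P_\bullet\otimes_A N)$; these are independent, up to isomorphism, of the chosen resolutions. *)

(* Defs.v *)
From HB Require Import structures.
From mathcomp Require Import all_boot all_order all_algebra.
From mathcomp Require Import finmap all_classical.
From mathcomp Require Import ring_quotient.

Set Implicit Arguments.
Unset Strict Implicit.
Unset Printing Implicit Defensive.

Import Order.TTheory GRing.Theory Num.Theory Quotient.

Local Open Scope ring_scope.

Section Submodules.
Variables (A : comPzRingType) (V : lmodType A).

Record submod := Submod { smem :> {pred V}; _ : submod_closed smem }.

Fact smem_closed (S : submod) : submod_closed S.
Proof. by case: S. Qed.

HB.instance Definition _ (S : submod) :=
  GRing.isSubmodClosed.Build A V (smem S)
    (GRing.submod_closed_semi (smem_closed S)).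

Record sub_of (S : submod) := SubOf { sub_val : V; _ : sub_val \in smem S }.

HB.instance Definition _ (S : submod) := [isSub for @sub_val S].
HB.instance Definition _ (S : submod) := [Choice of sub_of S by <:].
HB.instance Definition _ (S : submod) :=
  [SubChoice_isSubLmodule of sub_of S by <:].

Definition quo (S : submod) : Type := {quot (smem S)}.

Section Quo.
Variable S : submod.
HB.instance Definition _ := GRing.Zmodule.on (quo S).

Definition quo_pi (x : V) : quo S := \pi_({quot (smem S)})%qT x.
Definition quo_repr (q : quo S) : V := repr (q : {quot (smem S)}).

Lemma quo_reprK q : quo_pi (quo_repr q) = q.
Proof. exact: reprK. Qed.

Lemma quo_piP x y : reflect (quo_pi x = quo_pi y) (x - y \in smem S).
Proof. by rewrite idealrBE; apply: eqP. Qed.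

Lemma quo_piD x y : quo_pi (x + y) = quo_pi x + quo_pi y.
Proof. exact: (raddfD (\pi_({quot (smem S)})%qT)). Qed.

Definition quo_scale (a : A) (q : quo S) : quo S := quo_pi (a *: quo_repr q).

Lemma quo_scale_pi a x : quo_scale a (quo_pi x) = quo_pi (a *: x).
Proof.
by apply/quo_piP; rewrite -scalerBr rpredZ//; apply/quo_piP; rewrite quo_reprK.
Qed.

Fact quo_scaleA a b q : quo_scale a (quo_scale b q) = quo_scale (a * b) q.
Proof. by rewrite -[q]quo_reprK !quo_scale_pi scalerA. Qed.
Fact quo_scale1 : left_id 1 quo_scale.
Proof. by move=> q; rewrite -[q]quo_reprK quo_scale_pi scale1r. Qed.
Fact quo_scaleDr : right_distributive quo_scale +%R.
Proof.
move=> a q r; rewrite -[q]quo_reprK -[r]quo_reprK.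
by rewrite -quo_piD !quo_scale_pi -quo_piD scalerDr.
Qed.
Fact quo_scaleDl q : {morph quo_scale^~ q : a b / a + b}.
Proof.
by move=> a b; rewrite -[q]quo_reprK !quo_scale_pi -quo_piD scalerDl.
Qed.
HB.instance Definition _ := GRing.Zmodule_isLmodule.Build A (quo S)
  quo_scaleA quo_scale1 quo_scaleDr quo_scaleDl.

Fact quo_pi_linear : linear quo_pi.
Proof. by move=> a x y; rewrite quo_piD -quo_scale_pi. Qed.
HB.instance Definition _ := GRing.isLinear.Build A V (quo S) *:%R quo_pi
  quo_pi_linear.
End Quo.

End Submodules.

Section Maps.
Variable A : comPzRingType.
Implicit Types U V W : lmodType A.

Definition isomorphic U V : Prop := exists f : {linear U -> V}, bijective f.

Fact trace_closed V (S T : submod V) :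
  submod_closed [pred x : sub_of S | val x \in smem T].
Proof.
split=> [|a x y]; rewrite !inE ?raddf0 ?rpred0// => xT yT.
by rewrite [val _]linearP rpredD// rpredZ.
Qed.
Definition trace_mod V (S T : submod V) : submod (sub_of S) := Submod (trace_closed S T).

Definition subquo V (S T : submod V) : Type := quo (trace_mod S T).
HB.instance Definition _ V (S T : submod V) := GRing.Lmodule.on (subquo S T).

Fact ker_closed V W (f : {linear V -> W}) : submod_closed [pred x | f x == 0].
Proof.
split=> [|a x y]; rewrite !inE ?raddf0// => /eqP fx /eqP fy.
by rewrite linearP fx fy scaler0 addr0.
Qed.
Definition kernel_mod V W (f : {linear V -> W}) : submod V := Submod (ker_closed f).

Fact im_closed V W (f : {linear V -> W}) :
  submod_closed [pred y | `[< exists x, f x = y >]].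
Proof.
split=> [|a x y]; rewrite !inE; first by exists 0; rewrite raddf0.
move=> [x' <-] [y' <-].
by exists (a *: x' + y'); rewrite linearP.
Qed.
Definition image_mod V W (f : {linear V -> W}) : submod W := Submod (im_closed f).

(* Meaningful when [g \o f = 0]; defined without that proof as
   [ker g / (ker g :&: im f)]. *)
Definition homology U V W (f : {linear U -> V}) (g : {linear V -> W}) : Type :=
  subquo (kernel_mod g) (image_mod f).
HB.instance Definition _ U V W (f : {linear U -> V}) (g : {linear V -> W}) :=
  GRing.Lmodule.on (homology f g).

Fact span_closed V (G : V -> Prop) : submod_closed
  [pred x | `[< forall S : submod V, (forall y, G y -> y \in smem S) ->
                 x \in smem S >]].
Proof.
split=> [|a x y]; rewrite !inE; first by move=> S _; rewrite rpred0.
move=> xG yG S GS.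
by rewrite rpredD ?rpredZ ?xG ?yG.
Qed.
Definition span_mod V (G : V -> Prop) : submod V := Submod (span_closed G).

Lemma span_eq0 V W (f : {linear V -> W}) (G : V -> Prop) :
  (forall y, G y -> f y = 0) -> forall z, z \in smem (span_mod G) -> f z = 0.
Proof.
move=> G0 z; rewrite inE => /(_ (kernel_mod f)) z0.
by apply/eqP; move: z0; rewrite inE; apply=> y /G0 fy; rewrite inE fy.
Qed.

Section SubMap.
Variables (V W : lmodType A) (f : {linear V -> W}).

Definition sub_map (S : submod V) (S' : submod W)
    (fS : forall x, x \in smem S -> f x \in smem S') (x : sub_of S) : sub_of S' :=
  SubOf (fS _ (valP x)).

Definition subquo_map (S T : submod V) (S' T' : submod W)
    (fS : forall x, x \in smem S -> f x \in smem S') (q : subquo S T) :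
    subquo S' T' :=
  quo_pi (trace_mod S' T') (sub_map fS (quo_repr q)).

Definition quo_lift (S : submod V) (f0 : forall x, x \in smem S -> f x = 0)
    (q : quo S) : W := f (quo_repr q).

Lemma quo_lift_pi S f0 x : @quo_lift S f0 (quo_pi S x) = f x.
Proof.
apply/eqP; rewrite -subr_eq0 -linearB; apply/eqP/f0/quo_piP.
by rewrite quo_reprK.
Qed.

Fact quo_lift_linear S f0 : linear (@quo_lift S f0).
Proof.
move=> a q r; rewrite -[q]quo_reprK -[r]quo_reprK -linearP/=.
by rewrite !quo_lift_pi linearP.
Qed.
HB.instance Definition _ S f0 :=
  GRing.isLinear.Build A (quo S) W *:%R (@quo_lift S f0) (quo_lift_linear f0).
End SubMap.

Definition finitely_generated V : Prop :=
  exists (n : nat) (v : 'I_n -> V), forall x,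
    exists c : 'I_n -> A, x = \sum_i c i *: v i.

Definition projective_module (P : lmodType A) : Prop :=
  forall V W (g : {linear V -> W}) (f : {linear P -> W}),
    (forall w, exists v, g v = w) ->
    exists h : {linear P -> V}, forall x, g (h x) = f x.

Definition injective_module (E : lmodType A) : Prop :=
  forall V W (g : {linear V -> W}) (f : {linear V -> E}),
    injective g -> exists h : {linear W -> E}, forall x, h (g x) = f x.

Definition zero_module V : Prop := forall x : V, x = 0.

End Maps.

Definition noetherian (A : comPzRingType) : Prop :=
  forall I : submod A^o, finitely_generated (sub_of I).

Section Hom.
Variable A : comPzRingType.
Implicit Types U V : lmodType A.

Fact homs_closed U V :
  submod_closed [pred f : U -> V | `[< linear f >]].
Proof.
split=> [|a f g]; rewrite !inE.
  by move=> a x y /=; rewrite scaler0 addr0.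
move=>  lf  lg; move=> b x y.
rewrite !addrfctE !scalrfctE lf lg !scalerDr !scalerA mulrC.
by rewrite addrACA.
Qed.
Definition homs U V : submod (U -> V : lmodType A) := Submod (homs_closed U V).
Definition hom U V : Type := sub_of (homs U V).
HB.instance Definition _ U V := GRing.Lmodule.on (hom U V).

Lemma hom_linear U V (h : hom U V) : linear (val h).
Proof. by have := valP h; rewrite inE. Qed.

Lemma hom0 U V (h : hom U V) : val h 0 = 0.
Proof. by have := hom_linear h (-1) 0 0; rewrite scaler0 addr0 scaleN1r addNr. Qed.

Section Pre.
Variables (U' U L : lmodType A) (f : {linear U' -> U}).
Fact hom_pre_subproof (h : hom U L) : val h \o f \in smem (homs U' L).
Proof. by rewrite inE; move=> a x y /=; rewrite linearP hom_linear. Qed.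
Definition hom_pre (h : hom U L) : hom U' L := SubOf (hom_pre_subproof h).
Fact hom_pre_linear : linear hom_pre.
Proof. by move=> a g h; apply: val_inj; apply/funext. Qed.
HB.instance Definition _ :=
  GRing.isLinear.Build A (hom U L) (hom U' L) *:%R hom_pre hom_pre_linear.
End Pre.

Section Post.
Variables (N V V' : lmodType A) (f : {linear V -> V'}).
Fact hom_post_subproof (h : hom N V) : f \o val h \in smem (homs N V').
Proof. by rewrite inE; move=> a x y /=; rewrite hom_linear linearP. Qed.
Definition hom_post (h : hom N V) : hom N V' := SubOf (hom_post_subproof h).
Fact hom_post_linear : linear hom_post.
Proof. by move=> a g h; apply: val_inj; apply/funext=> x; exact: linearP. Qed.
HB.instance Definition _ :=
  GRing.isLinear.Build A (hom N V) (hom N V') *:%R hom_post hom_post_linear.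
End Post.
End Hom.

(* [e = 1] is a cochain complex, [e = -1] a chain complex. The differentials
   are given between any two degrees, and vanish unless the degrees are
   consecutive; this avoids transporting along equations between degrees. *)
Record complex (A : comPzRingType) (e : int) := Complex {
  cx_obj :> int -> lmodType A;
  cx_d : forall i j, {linear cx_obj i -> cx_obj j};
  cx_shape : forall i j, j != i + e -> forall x, cx_d i j x = 0;
  cx_dd : forall i j k x, cx_d j k (cx_d i j x) = 0 }.
Arguments cx_d {A e} c i j.
Arguments cx_shape {A e c i j}.
Arguments cx_dd {A e c}.

Notation cochain_complex A := (complex A 1).
Notation chain_complex A := (complex A (-1)).

Section Complexes.
Variables (A : comPzRingType) (e : int).
Implicit Types X Y : complex A e.

Definition cx_homology X (i : int) : lmodType A :=
  homology (cx_d X (i - e) i) (cx_d X i (i + e)).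

Record chain_map X Y := ChainMap {
  cm_fun :> forall i, {linear X i -> Y i};
  cm_comm : forall i j x, cx_d Y i j (cm_fun i x) = cm_fun j (cx_d X i j x) }.

Fact chain_map_ker X Y (f : chain_map X Y) i j x :
  x \in smem (kernel_mod (cx_d X i j)) -> f i x \in smem (kernel_mod (cx_d Y i j)).
Proof. by rewrite !inE cm_comm => /eqP->; rewrite raddf0. Qed.

Definition H_map X Y (f : chain_map X Y) (i : int) : cx_homology X i -> cx_homology Y i :=
  subquo_map (image_mod (cx_d Y (i - e) i))
    (@chain_map_ker X Y f i (i + e)).

Definition quasi_iso X Y (f : chain_map X Y) : Prop :=
  forall i, bijective (H_map f (i := i)).

End Complexes.

Definition injective_resolution (A : comPzRingType) (K E : cochain_complex A)
    (f : chain_map K E) : Prop :=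
  [/\ exists n0 : int, forall i, i < n0 -> zero_module (E i),
      forall i, injective_module (E i)
    & quasi_iso f].

Definition fg_projective_resolution (A : comPzRingType)
    (K P : chain_complex A) (f : chain_map P K) : Prop :=
  [/\ exists n0 : int, forall i, i < n0 -> zero_module (P i),
      forall i, finitely_generated (P i) /\ projective_module (P i)
    & quasi_iso f].

Section HomComplexes.
Variables (A : comPzRingType) (e : int).

Section Post.
Variables (N : lmodType A) (X : complex A e).
Let d i j : {linear hom N (X i) -> hom N (X j)} := hom_post (N := N) (cx_d X i j).
Fact homR_shape i j : j != i + e -> forall h, d i j h = 0.
Proof.
by move=> ne h; apply: val_inj; apply/funext=> x; exact: (cx_shape ne).
Qed.
Fact homR_dd i j k h : d j k (d i j h) = 0.
Proof. by apply: val_inj; apply/funext=> x; exact: cx_dd. Qed.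
Definition hom_to_complex : complex A e := Complex homR_shape homR_dd.
End Post.

Section Pre.
Variables (X : complex A e) (N : lmodType A).
Let d i j : {linear hom (X i) N -> hom (X j) N} := hom_pre (L := N) (cx_d X j i).
Fact homL_shape i j : j != i - e -> forall h, d i j h = 0.
Proof.
move=> ne h; apply: val_inj; apply/funext=> x /=.
rewrite cx_shape ?hom0//; by apply: contra ne => /eqP->; rewrite addrK.
Qed.
Fact homL_dd i j k h : d j k (d i j h) = 0.
Proof. by apply: val_inj; apply/funext=> x /=; rewrite cx_dd hom0. Qed.
Definition hom_from_complex : complex A (- e) := Complex homL_shape homL_dd.
End Pre.
End HomComplexes.

Section Koszul.
Variables (A : comPzRingType) (m : nat) (u : 'I_m -> A) (M : lmodType A).

(* The basis [e_S] of the [q]-th exterior power of [A^m] is indexed by the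
   [q]-element subsets [S] of ['I_m], so that both its tensor product with [M]
   and the module of its linear maps to [M] consist of functions from these
   subsets to [M]. *)
Definition kosz (q : int) : Type := {S : {set 'I_m} | #|S|%:Z == q} -> M.
HB.instance Definition _ q := GRing.Lmodule.on (kosz q).

Definition kext q (x : kosz q) (S : {set 'I_m}) : M :=
  if insub S is Some s then x s else 0.

Definition ksign (i : 'I_m) (S : {set 'I_m}) : A :=
  (-1) ^+ #|[set j in S | (j < i)%N]|.

(* [e_S |-> \sum_(i in S) ksign i S * u_i * e_(S :\ i)], read on coordinates *)
Definition kosz_chain_d p q (x : kosz p) : kosz q := fun T =>
  \sum_(i | i \notin val T) (ksign i (val T) * u i) *: kext x (i |: val T).

Definition kosz_cochain_d p q (x : kosz p) : kosz q := fun S =>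
  \sum_(i in val S) (ksign i (val S) * u i) *: kext x (val S :\ i).

Lemma kextE q (x : kosz q) (s : {S : {set 'I_m} | #|S|%:Z == q}) :
  kext x (val s) = x s.
Proof. by rewrite /kext valK. Qed.

Lemma kext_out q (x : kosz q) (S : {set 'I_m}) : #|S|%:Z != q -> kext x S = 0.
Proof. by move=> ne; rewrite /kext insubN. Qed.

Lemma kextP q a (x y : kosz q) S :
  kext (a *: x + y) S = a *: kext x S + kext y S.
Proof. by rewrite /kext; case: insubP=> //= _; rewrite scaler0 addr0. Qed.

Fact kosz_chain_linear p q : linear (@kosz_chain_d p q).
Proof.
move=> a x y; apply/funext=> T.
rewrite -[RHS]/(a *: kosz_chain_d x T + kosz_chain_d y T) /kosz_chain_d.
rewrite scaler_sumr -big_split; apply: eq_bigr => i _ /=.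
by rewrite kextP scalerDr !scalerA mulrC.
Qed.
HB.instance Definition _ p q := GRing.isLinear.Build A (kosz p) (kosz q) *:%R
  (@kosz_chain_d p q) (@kosz_chain_linear p q).

Fact kosz_cochain_linear p q : linear (@kosz_cochain_d p q).
Proof.
move=> a x y; apply/funext=> T.
rewrite -[RHS]/(a *: kosz_cochain_d x T + kosz_cochain_d y T) /kosz_cochain_d.
rewrite scaler_sumr -big_split; apply: eq_bigr => i _ /=.
by rewrite kextP scalerDr !scalerA mulrC.
Qed.
HB.instance Definition _ p q := GRing.isLinear.Build A (kosz p) (kosz q) *:%R
  (@kosz_cochain_d p q) (@kosz_cochain_linear p q).

Fact kosz_chain_shape p q : q != p + -1 -> forall x, @kosz_chain_d p q x = 0.
Proof.
move=> ne x; apply/funext=> -[T cT]; rewrite /kosz_chain_d big1//= => i iT.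
rewrite kext_out ?scaler0//; apply: contra ne => /eqP <-.
by rewrite cardsU1 iT -(eqP cT) PoszD addrAC subrr add0r.
Qed.

Fact kosz_cochain_shape p q : q != p + 1 -> forall x, @kosz_cochain_d p q x = 0.
Proof.
move=> ne x; apply/funext=> -[S cS]; rewrite /kosz_cochain_d big1//= => i iS.
rewrite kext_out ?scaler0//; apply: contra ne => /eqP <-.
by rewrite -(eqP cS) (cardsD1 i S) iS addrC PoszD.
Qed.

Lemma ksignU i j (T : {set 'I_m}) : i \notin T ->
  ksign j (i |: T) = (-1) ^+ (i < j)%N * ksign j T.
Proof.
move=> iT; rewrite /ksign -exprD; congr (_ ^+ _).
case: ltnP=> ij.
  rewrite add1n; have -> : [set k in i |: T | (k < j)%N]
                   = i |: [set k in T | (k < j)%N].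
    by apply/setP=> k; rewrite !inE andb_orl; case: eqP=> [->|//]; rewrite ij.
  by rewrite cardsU1 inE (negPf iT).
rewrite add0n; apply: eq_card => k; rewrite !inE andb_orl.
by case: eqP=> [->|//]; rewrite ltnNge ij /= andbF.
Qed.

Lemma alternating_sum (t : 'I_m -> 'I_m -> M) :
  (forall i, t i i = 0) -> (forall i j, i != j -> t i j = - t j i) ->
  \sum_i \sum_j t i j = 0.
Proof.
move=> t0 tN.
have E i : \sum_j t i j =
    \sum_(j < m) (if (i < j)%N then t i j else 0) -
    \sum_(j < m) (if (j < i)%N then t j i else 0).
  rewrite -sumrB; apply: eq_bigr => j _.
  case: ltngtP=> ij; rewrite ?subr0 ?sub0r ?(val_inj ij)//.
  by rewrite tN// neq_ltn ij orbT.
rewrite (eq_bigr _ (fun i _ => E i)) sumrB.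
by rewrite [X in _ - X]exchange_big subrr.
Qed.

Fact kosz_chain_dd p q r x : @kosz_chain_d q r (@kosz_chain_d p q x) = 0.
Proof.
have [rE|ne] := eqVneq r (q + -1); last exact: kosz_chain_shape.
apply/funext=> -[T cT]; rewrite /kosz_chain_d /=.
pose t i j : M := if [&& i \notin T, j \notin T & i != j] then
  ((-1) ^+ (i < j)%N * (ksign i T * ksign j T * u i * u j)) *:
  kext x (i |: (j |: T)) else 0.
rewrite -[RHS](@alternating_sum t); first last.
- move=> i j ne; rewrite /t ne eq_sym ne !andbT andbC; case: ifP=> _; last by rewrite oppr0.
  rewrite finset.setUCA -scaleNr; congr (_ *: _).
  rewrite (mulrC (ksign j T)) -!mulrA (mulrC (u j)) -mulNr; congr (_ * _).
  by case: ltngtP ne => [||/val_inj->]; rewrite ?eqxx// opprK.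
- by move=> i; rewrite /t eqxx !andbF.
rewrite big_mkcond; apply: eq_bigr => i _; case: ifPn => iT; last first.
  by rewrite big1// => j _; rewrite /t (negPf iT).
have cU : #|i |: T|%:Z == q.
  by rewrite cardsU1 iT PoszD (eqP cT) rE addrC addrNK.
rewrite -[i |: T]/(val (exist (fun S : {set 'I_m} => #|S|%:Z == q) _ cU)) kextE /=.
rewrite scaler_sumr big_mkcond; apply: eq_bigr => j _.
rewrite !inE negb_or /t iT /= eq_sym andbC; case: ifP=> // _.
rewrite ksignU// scalerA finset.setUCA; congr (_ *: _).
by rewrite [LHS](AC (2*3) (3*(1*4*2*5)))%AC.
Qed.

Fact kosz_cochain_dd p q r x : @kosz_cochain_d q r (@kosz_cochain_d p q x) = 0.
Proof.
have [rE|ne] := eqVneq r (q + 1); last exact: kosz_cochain_shape.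
apply/funext=> -[S cS]; rewrite /kosz_cochain_d /=.
pose t i j : M := if [&& i \in S, j \in S & i != j] then
  ((-1) ^+ (i < j)%N * (ksign i S * ksign j S * u i * u j)) *:
  kext x (S :\ i :\ j) else 0.
rewrite -[RHS](@alternating_sum t); first last.
- move=> i j ne; rewrite /t ne eq_sym ne !andbT andbC; case: ifP=> _; last by rewrite oppr0.
  rewrite finset.setDDl finset.setUC -finset.setDDl -scaleNr; congr (_ *: _).
  rewrite (mulrC (ksign j S)) -!mulrA (mulrC (u j)) -mulNr; congr (_ * _).
  by case: ltngtP ne => [||/val_inj->]; rewrite ?eqxx// opprK.
- by move=> i; rewrite /t eqxx !andbF.
rewrite big_mkcond; apply: eq_bigr => i _; case: ifPn => iS; last first.
  by rewrite big1// => j _; rewrite /t (negPf iS).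
have cD : #|S :\ i|%:Z == q.
  by move: cS; rewrite rE (cardsD1 i S) iS addnC PoszD (inj_eq (addIr _)).
rewrite -[S :\ i]/(val (exist (fun S : {set 'I_m} => #|S|%:Z == q) _ cD)) kextE /=.
rewrite scaler_sumr big_mkcond; apply: eq_bigr => j _.
rewrite !inE /t iS /= eq_sym andbC; case: ifP=> // _.
rewrite scalerA; congr (_ *: _).
have -> : ksign j S = (-1) ^+ (i < j)%N * ksign j (S :\ i).
  by rewrite -ksignU ?finset.setD1K// !inE eqxx.
by rewrite [RHS](AC (1*(1*2*1*1)) (1*(3*(2*4*5*6))))%AC /= signrMK
  [LHS](AC (2*2) (1*3*2*4))%AC.
Qed.

Definition koszul_chain : chain_complex A :=
  Complex kosz_chain_shape kosz_chain_dd.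
Definition koszul_cochain : cochain_complex A :=
  Complex kosz_cochain_shape kosz_cochain_dd.
End Koszul.

Section Free.
Variable A : comPzRingType.

Section FreeDef.
Variable T : choiceType.
Fact finsupp_closed :
  submod_closed [pred f : T -> A^o | `[< finite_set [set t | f t != 0] >]].
Proof.
split=> [|a f g]; rewrite !inE.
  by apply: (sub_finite_set (B := set0)) => // t /=; rewrite eqxx.
move=> ff fg; apply: (@sub_finite_set _ _
  ([set t | f t != 0] `|` [set t | g t != 0])%classic); last first.
  by rewrite finite_setU.
move=> t /=; rewrite addrfctE scalrfctE; case: (eqVneq (f t) 0) => [->|]; last by left.
by rewrite scaler0 add0r; right.
Qed.
Definition finsupp : submod (T -> A^o : lmodType A) := Submod finsupp_closed.
Definition free_mod : Type := sub_of finsupp.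
HB.instance Definition _ := GRing.Lmodule.on free_mod.

Fact free_basis_subproof (t : T) :
  (fun s => (s == t)%:R : A^o) \in smem finsupp.
Proof.
rewrite inE; apply: (sub_finite_set (B := [set t]%classic)) => // s /=.
by case: (eqVneq s t) => //=; rewrite eqxx.
Qed.
Definition free_basis (t : T) : free_mod := SubOf (free_basis_subproof t).

Section Lift.
Variables (V : lmodType A) (h : T -> V).

Definition free_lift (f : free_mod) : V := \sum_(t \in [set: T]) (val f t : A) *: h t.

Lemma free_liftE (D : set T) (f : free_mod) : finite_set D ->
  (forall t, val f t != 0 -> D t) ->
  free_lift f = \sum_(t <- fset_set D) (val f t : A) *: h t.
Proof.
move=> fD sD; apply: fsbigTE => t; rewrite in_fset_set// notin_setE => Dt.
by case: (eqVneq (val f t) 0) => [->|/sD//]; rewrite scale0r.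
Qed.

Fact free_lift_linear : linear free_lift.
Proof.
move=> a f g; pose D := ([set t | val f t != 0] `|` [set t | val g t != 0])%classic.
have fD : finite_set D.
  by rewrite finite_setU; split; [have := valP f|have := valP g]; rewrite inE.
have Ef := @free_liftE D f fD (fun t => @or_introl _ _).
have Eg := @free_liftE D g fD (fun t => @or_intror _ _).
have Efg : free_lift (a *: f + g) =
    \sum_(t <- fset_set D) (val (a *: f + g) t : A) *: h t.
  apply: free_liftE => // t; rewrite /D /= addrfctE scalrfctE.
  by case: (eqVneq (val f t) 0) => [->|]; [rewrite scaler0 add0r; right|left].
rewrite Efg Ef Eg.
rewrite scaler_sumr -big_split; apply: eq_bigr => t _ /=.
by rewrite scalerA -scalerDl.
Qed.
HB.instance Definition _ :=
  GRing.isLinear.Build A free_mod V *:%R free_lift free_lift_linear.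

Lemma free_lift_basis t : free_lift (free_basis t) = h t.
Proof.
rewrite (@free_liftE [set t]%classic)// ?fset_set1 ?big_seq_fset1 /=.
  by rewrite eqxx scale1r.
by move=> s /=; case: (eqVneq s t) => //=; rewrite eqxx.
Qed.
End Lift.
End FreeDef.

Section Tensor.
Implicit Types X Y : lmodType A.

Definition tensor_rel X Y : submod (free_mod (X * Y)%type) := span_mod (fun z =>
  (exists a x x' y, z = free_basis (a *: x + x', y)
                        - (a *: free_basis (x, y) + free_basis (x', y))) \/
  (exists a x y y', z = free_basis (x, a *: y + y')
                        - (a *: free_basis (x, y) + free_basis (x, y')))).

Definition tensor X Y : Type := quo (tensor_rel X Y).
HB.instance Definition _ X Y := GRing.Lmodule.on (tensor X Y).

Definition tens X Y (x : X) (y : Y) : tensor X Y :=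
  quo_pi (tensor_rel X Y) (free_basis (x, y)).

Lemma tensPl X Y a (x x' : X) (y : Y) :
  tens (a *: x + x') y = a *: tens x y + tens x' y.
Proof.
rewrite /tens -linearP; apply/quo_piP; rewrite inE => S; apply; left.
by exists a, x, x', y.
Qed.

Lemma tensPr X Y a (x : X) (y y' : Y) :
  tens x (a *: y + y') = a *: tens x y + tens x y'.
Proof.
rewrite /tens -linearP; apply/quo_piP; rewrite inE => S; apply; right.
by exists a, x, y, y'.
Qed.

Lemma tens0l X Y (y : Y) : tens (0 : X) y = 0.
Proof.
by have := tensPl (-1) (0 : X) 0 y; rewrite scaler0 addr0 scaleN1r addNr.
Qed.

Section TensorMap.
Variables (X X' Y Y' : lmodType A).
Variables (f : {linear X -> X'}) (g : {linear Y -> Y'}).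
Definition tensor_lift : {linear free_mod (X * Y)%type -> tensor X' Y'} :=
  free_lift (fun p => tens (f p.1) (g p.2)).

Lemma tensor_liftE x y : tensor_lift (free_basis (x, y)) = tens (f x) (g y).
Proof. exact: free_lift_basis. Qed.

Fact tensor_map_subproof z :
  z \in smem (tensor_rel X Y) -> tensor_lift z = 0.
Proof.
move: z; apply: span_eq0 => z [] [a [x [x' [y ->]]]].
  rewrite linearB linearP !tensor_liftE linearP.
  by apply/eqP; rewrite subr_eq0; apply/eqP/tensPl.
rewrite linearB linearP !tensor_liftE linearP.
by apply/eqP; rewrite subr_eq0; apply/eqP/tensPr.
Qed.

Definition tensor_map : {linear tensor X Y -> tensor X' Y'} :=
  quo_lift tensor_map_subproof.

Lemma tensor_mapE x y : tensor_map (tens x y) = tens (f x) (g y).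
Proof. by rewrite -tensor_liftE -(quo_lift_pi tensor_map_subproof). Qed.
End TensorMap.

Lemma tensor_map_sum X X' Y Y' (f : {linear X -> X'}) (g : {linear Y -> Y'}) z :
  exists (s : seq (X * Y)) (c : X * Y -> A),
    tensor_map f g z = \sum_(p <- s) c p *: tens (f p.1) (g p.2).
Proof. by do 2!eexists; reflexivity. Qed.

Lemma tensor_map_eq0 X X' Y Y' (f : {linear X -> X'}) (g : {linear Y -> Y'}) :
  (forall x, f x = 0) -> forall z, tensor_map f g z = 0.
Proof.
move=> f0 z; have [s [c ->]] := tensor_map_sum f g z.
by rewrite big1// => p _; rewrite f0 tens0l scaler0.
Qed.

Lemma tensor_map_comp_eq0 X1 X2 X3 Y1 Y2 Y3
    (f : {linear X1 -> X2}) (f' : {linear X2 -> X3})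
    (g : {linear Y1 -> Y2}) (g' : {linear Y2 -> Y3}) :
  (forall x, f' (f x) = 0) ->
  forall z, tensor_map f' g' (tensor_map f g z) = 0.
Proof.
move=> ff0 z; have [s [c ->]] := tensor_map_sum f g z.
rewrite linear_sum big1// => p _.
by rewrite linearZ tensor_mapE ff0 tens0l; apply: scaler0.
Qed.
End Tensor.
End Free.

Section TensorComplex.
Variables (A : comPzRingType) (e : int) (X : complex A e) (N : lmodType A).
Let d i j : {linear tensor (X i) N -> tensor (X j) N} :=
  tensor_map (cx_d X i j) idfun.
Fact tensor_shape i j : j != i + e -> forall z, d i j z = 0.
Proof. by move=> ne; apply: tensor_map_eq0 => x; exact: cx_shape. Qed.
Fact tensor_dd i j k z : d j k (d i j z) = 0.
Proof. by apply: tensor_map_comp_eq0 => x; exact: cx_dd. Qed.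
Definition tensor_complex : complex A e := Complex tensor_shape tensor_dd.
End TensorComplex.

Section ExtTor.
Variable A : comPzRingType.
Implicit Types X Y L : lmodType A.

(* A functorial free resolution of [X]: [free_res X n] is free on the set
   of elements of the [n]-th syzygy, the kernel of the preceding map. *)
Definition free_eps X : {linear free_mod A X -> X} := free_lift (@idfun X).

Fixpoint syzygy X (n : nat) : lmodType A :=
  if n is n'.+1 then sub_of (kernel_mod (free_eps (syzygy X n'))) else X.

Definition free_res X n : lmodType A := free_mod A (syzygy X n).

Definition free_res_d X n : {linear free_res X n.+1 -> free_res X n} :=
  val \o free_eps (syzygy X n.+1).

(* The right derived functors of [hom _ L], evaluated at [X]. *)
Definition Ext (p : nat) X L : lmodType A :=
  let d n : {linear hom (free_res X n) L -> hom (free_res X n.+1) L} :=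
    hom_pre (L := L) (free_res_d X n) in
  if p is p'.+1 then homology (d p') (d p'.+1)
  else homology (\0 : {linear hom (free_res X 0) L -> hom (free_res X 0) L})
    (d 0%N).

(* The left derived functors of [tensor X _], evaluated at [Y]. *)
Definition Tor (p : nat) X Y : lmodType A :=
  let d n : {linear tensor X (free_res Y n.+1) -> tensor X (free_res Y n)} :=
    tensor_map idfun (free_res_d Y n) in
  if p is p'.+1 then homology (d p'.+1) (d p')
  else homology (d 0%N)
    (\0 : {linear tensor X (free_res Y 0) -> tensor X (free_res Y 0)}).

End ExtTor.

(* [e = 1] is a cohomology spectral sequence, with [d_r] of bidegree
   [(r, 1 - r)]; [e = -1] is a homology spectral sequence, with [d^r] of
   bidegree [(-r, r - 1)]. Pages with [r < 2] are irrelevant. *)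
Record spectral_sequence (A : comPzRingType) (e : int) := SpectralSequence {
  page :> nat -> int -> int -> lmodType A;
  page_d : forall r p q p' q', {linear page r p q -> page r p' q'};
  page_shape : forall r p q p' q',
    (p', q') != (p + e * r%:Z, q - e * (r%:Z - 1)) ->
    forall x, page_d r p q p' q' x = 0;
  page_dd : forall r p q p' q' p'' q'' x,
    page_d r p' q' p'' q'' (page_d r p q p' q' x) = 0;
  page_next : forall r p q, (2 <= r)%N -> isomorphic (page r.+1 p q)
    (homology
      (page_d r (p - e * r%:Z) (q + e * (r%:Z - 1)) p q)
      (page_d r p q (p + e * r%:Z) (q - e * (r%:Z - 1)))) }.

Section Convergence.
Variables (A : comPzRingType) (e : int) (S : spectral_sequence A e).

Definition first_quadrant : Prop := forall r p q,
  (2 <= r)%N -> (p < 0) || (q < 0) -> zero_module (S r p q).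

(* In the first quadrant the differentials of the [r]-th page into and out of
   [(p, q)] vanish as soon as [r > p] and [r > q + 1]. *)
Definition limit_page (p q : nat) : lmodType A := S (maxn p q.+1).+1 p q.

End Convergence.

Definition cohomology_converges (A : comPzRingType) (S : spectral_sequence A 1)
    (V : int -> lmodType A) : Prop :=
  exists F : forall n : int, int -> submod (V n),
  [/\ forall n p, {subset smem (F n (p + 1)) <= smem (F n p)},
      forall n p, p <= 0 -> forall x, x \in smem (F n p),
      forall n p, n < p -> forall x, x \in smem (F n p) -> x = 0
    & forall p q : nat, let n := p%:Z + q%:Z in
        isomorphic (limit_page S p q) (subquo (F n p) (F n (p%:Z + 1)))].

Definition homology_converges (A : comPzRingType)
    (S : spectral_sequence A (-1)) (W : int -> lmodType A) : Prop :=
  exists F : forall n : int, int -> submod (W n),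
  [/\ forall n p, {subset smem (F n (p - 1)) <= smem (F n p)},
      forall n p, n <= p -> forall x, x \in smem (F n p),
      forall n p, p < 0 -> forall x, x \in smem (F n p) -> x = 0
    & forall p q : nat, let n := p%:Z + q%:Z in
        isomorphic (limit_page S p q) (subquo (F n p) (F n (p%:Z - 1)))].

(* Main.v *)
Require Import Defs.
From HB Require Import structures.
From mathcomp Require Import all_boot all_order all_algebra.
From mathcomp Require Import finmap all_classical zify.
(* [hom] is also a constant of mathcomp's [vector]. *)
Import Defs.

Set Implicit Arguments.
Unset Strict Implicit.
Unset Printing Implicit Defensive.

Import Order.TTheory GRing.Theory Num.Theory.

Local Open Scope ring_scope.

(* Each spectral sequence comes from an exact couple that avoids total
   complexes.

   Let [E] be a bounded below complex, with cocycles [Z^q], coboundaries [B^q]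
   and cohomology [H^q], and let [T^p] be a cohomological delta-functor with
   [T^p E^q = 0] for [p > 0]. The long exact sequences of
   [0 -> B^q -> Z^q -> H^q -> 0] and [0 -> Z^(q-1) -> E^(q-1) -> B^q -> 0] splice
   into exact sequences
     [D^(p+1,q-1) -> D^(p,q) -> T^p H^q -> D^(p+2,q-1) -> D^(p+1,q)]
   with [D^(p,q) = coker (T^p E^(q-1) -> T^p Z^q)], and [D^(0,q)] is the
   cohomology of [T^0 E]. Extended by [D^(p,q) = D^(0,p+q)] for [p < 0], they form
   an exact couple whose first page, renumbered as the second one, is [T^p H^q],
   and which converges to the cohomology of [T^0 E].

   (1) is the case [T^p = Ext^p (N, -)]. For (2), with [T^p = Ext^p (-, N)], one
   replaces [Z^q] by the cokernels [Q_q = P_q / B_q]; the long exact sequences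
   come from resolutions chosen by the horseshoe lemma, first for
   [0 -> H_q -> Q_q -> B_(q-1) -> 0], then for [0 -> B_q -> P_q -> Q_q -> 0]. (3) is
   the dual situation with [T_p = Tor_p (-, N)], and
   [D_(p,q) = ker (T_p Q_q -> T_p P_(q-1))]. *)

(** * Linear relations and subquotients *)

(** Injectivity or projectivity of the terms gives [T^p E^q = 0] for [p > 0], so [D^(p,q)] is just
    [T^p Z^q] except in column [p = 0]. There the cokernel identifies [D^(0,q)] with the abutment,
    and left exactness of [T^0] makes [D^(1,q-1) -> D^(0,q)] injective, so that the couple can be
    continued to the left by identities with zero [E]-terms. The Koszul complex supplies [H^q = 0]
    for [q < 0]; the resolution is known to vanish below some bound [n0], possibly negative, and the
    vanishing of [D] in negative rows is deduced from both. In (1) and (3) one resolution of [N] is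
    fixed and the other argument varies, so its projective or free terms give the long exact
    sequences directly; in (2) the varying argument is the one resolved, whence the horseshoe lemma.
    Two formal obstacles shape the proof: maps between subquotients are introduced as linear
    relations between representatives, and degrees that are equal but not convertible, such as
    [q - 1 + 1] and [q], are handled by families of maps between any two indices. *)

Section LinearRelations.
Variable A : comPzRingType.
Implicit Types V W : lmodType A.

Definition linear_rel V W (R : V -> W -> Prop) : Prop :=
  forall a v w v' w', R v w -> R v' w' -> R (a *: v + v') (a *: w + w').

Lemma linear_relB V W (R : V -> W -> Prop) v w v' w' :
  linear_rel R -> R v w -> R v' w' -> R (v - v') (w - w').
Proof.
move=> linR Rvw Rvw'; have := linR (-1) _ _ _ _ Rvw' Rvw.
by rewrite !scaleN1r addrC [- w' + w]addrC.
Qed.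

(** Two values at the same argument differ by a value at [0], so triviality over [0] is
    single-valuedness. Most maps out of subquotients below are obtained here, which reduces their
    well-definedness to a check at zero. *)
Lemma linear_of_rel V W (R : V -> W -> Prop) :
    linear_rel R -> (forall v, exists w, R v w) ->
    (forall w, R 0 w -> w = 0) ->
  exists f : {linear V -> W}, forall v w, R v w <-> f v = w.
Proof.
move=> linR totR R0.
have funR v w w' : R v w -> R v w' -> w = w'.
  move=> Rw Rw'; apply/eqP; rewrite -subr_eq0; apply/eqP/R0.
  by rewrite -(subrr v); apply: linear_relB.
have [f Rf] := choice totR.
have lf : linear f by move=> a x y; apply: (funR (a *: x + y)) => //; exact: linR.
pose F : {linear V -> W} := HB.pack f (GRing.isLinear.Build _ _ _ _ f lf).
by exists F => v w; split=> [|<-]; [exact: funR (Rf v)|exact: Rf].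
Qed.

(** The relation and its converse both define linear maps; having the same graph, these are mutually
    inverse. *)
Lemma iso_of_rel V W (R : V -> W -> Prop) :
    linear_rel R -> (forall v, exists w, R v w) -> (forall w, exists v, R v w) ->
    (forall w, R 0 w -> w = 0) -> (forall v, R v 0 -> v = 0) ->
  isomorphic V W.
Proof.
move=> linR totR totR' R0 R0'.
have [f Rf] := linear_of_rel linR totR R0.
have [] := @linear_of_rel W V (fun w v => R v w) _ totR' R0'.
  by move=> a w v w' v' Rvw; apply: linR.
move=> g Rg; exists f, g => x; first by apply/Rg/Rf.
by apply/Rf/Rg.
Qed.

Lemma isomorphic_sym V W : isomorphic V W -> isomorphic W V.
Proof.
move=> [f [g fK gK]]; apply: (@iso_of_rel _ _ (fun w v => f v = w)).
- by move=> a w v w' v' <- <-; rewrite linearP.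
- by move=> w; exists (g w); rewrite gK.
- by move=> v; exists (f v).
- by move=> v fv; rewrite -(fK v) fv -[in LHS](raddf0 f) fK.
- by move=> w <-; rewrite raddf0.
Qed.

Lemma isomorphic_trans U V W :
  isomorphic U V -> isomorphic V W -> isomorphic U W.
Proof.
by move=> [f bf] [g bg]; exists (g \o f); apply: bij_comp.
Qed.

End LinearRelations.

Section SubmodOf.
Variables (A : comPzRingType) (V : lmodType A) (P : V -> Prop).
Hypotheses (P0 : P 0) (Plin : forall a x y, P x -> P y -> P (a *: x + y)).

Fact submod_of_closed : submod_closed [pred x : V | `[< P x >]].
Proof. by split=> [|a x y]; rewrite !inE //; apply: Plin. Qed.
Definition submod_of : submod V := Submod submod_of_closed.

Lemma submod_ofP x : x \in smem submod_of <-> P x.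
Proof. by rewrite inE. Qed.
End SubmodOf.

Section Membership.
Variables (A : comPzRingType).
Implicit Types V W : lmodType A.

Lemma kernel_modP V W (f : {linear V -> W}) x :
  x \in smem (kernel_mod f) <-> f x = 0.
Proof. by rewrite inE; split=> [/eqP|/eqP]. Qed.

Lemma image_modP V W (f : {linear V -> W}) y :
  y \in smem (image_mod f) <-> exists x, f x = y.
Proof. by rewrite inE. Qed.

End Membership.

Section Representatives.
Variables (A : comPzRingType) (V : lmodType A) (S T : submod V).

(** Classes are compared through elements of [V] itself; the quotient of a subtype behind [subquo]
    stays hidden after this section. *)
Definition rep (x : V) (c : subquo S T) : Prop :=
  exists h : x \in smem S, c = quo_pi (trace_mod S T) (SubOf h).

Lemma rep_linear : linear_rel rep.
Proof.
move=> a x c x' c' [h ->] [h' ->].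
have H : a *: x + x' \in smem S by rewrite rpredD// rpredZ.
by exists H; rewrite -linearP; congr quo_pi; apply: val_inj.
Qed.

Lemma rep_ex c : exists x, rep x c.
Proof.
exists (val (quo_repr c)), (valP (quo_repr c)); rewrite -[LHS]quo_reprK.
by congr quo_pi; apply: val_inj.
Qed.

Lemma rep_tot x : x \in smem S -> exists c, rep x c.
Proof. by move=> h; exists (quo_pi (trace_mod S T) (SubOf h)), h. Qed.

Lemma rep_mem x c : rep x c -> x \in smem S.
Proof. by case. Qed.

Lemma rep_eq x c x' c' : rep x c -> rep x' c' -> (c = c' <-> x - x' \in smem T).
Proof.
move=> [h ->] [h' ->]; split.
  by move/quo_piP; rewrite !inE raddfB.
by move=> xT; apply/quo_piP; rewrite !inE raddfB.
Qed.

Lemma rep0 : rep 0 0.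
Proof.
exists (rpred0 _); rewrite -[LHS](raddf0 (quo_pi (trace_mod S T))).
by congr quo_pi; apply: val_inj.
Qed.

Lemma rep_eq0 x c : rep x c -> (c = 0 <-> x \in smem T).
Proof. by move=> xc; rewrite (rep_eq xc rep0) subr0. Qed.

Lemma rep_fun x c c' : rep x c -> rep x c' -> c = c'.
Proof. by move=> xc xc'; apply/(rep_eq xc xc'); rewrite subrr rpred0. Qed.

Lemma rep0r x : x \in smem S -> x \in smem T -> rep x 0.
Proof. by move=> /rep_tot[c xc] /(rep_eq0 xc) <-. Qed.

End Representatives.

Section Casts.
Variables (A : comPzRingType) (I : eqType) (F : I -> lmodType A).

(* A total form of transport along [x = y], vanishing when [x <> y]. *)
Definition cast_lin (x y : I) : {linear F x -> F y} :=
  match x =P y with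
  | ReflectT e => match e in _ = z return {linear F x -> F z} with erefl => idfun end
  | ReflectF _ => \0
  end.

Lemma cast_lin_id x v : cast_lin x x v = v.
Proof. by rewrite /cast_lin; case: eqP => // e; rewrite eq_axiomK. Qed.

End Casts.

(** * Exact couples *)

(* The maps are given between any two indices, but only those of degrees [s] for
   [eci], [kd] for [eck] and [jd] for [ecj] are relevant. *)
Record exact_couple (A : comPzRingType) (I : zmodType) (s kd jd : I) :=
    ExactCouple {
  ecE : I -> lmodType A;
  ecD : I -> lmodType A;
  eci : forall x y, {linear ecD x -> ecD y};
  eck : forall x y, {linear ecE x -> ecD y};
  ecj : forall x y, {linear ecD x -> ecE y};
  ec_keri : forall x y z, y = x + kd -> z = y + s -> forall d,
    eci y z d = 0 <-> exists e, eck x y e = d;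
  ec_kerj : forall x y z, y = x + s -> z = y + jd -> forall d,
    ecj y z d = 0 <-> exists d', eci x y d' = d;
  ec_kerk : forall x y z, y = x + jd -> z = y + kd -> forall e,
    eck y z e = 0 <-> exists d, ecj x y d = e }.

Section Pages.
Variables (A : comPzRingType) (I : zmodType) (s kd jd : I).
Variable C : exact_couple A s kd jd.
Local Notation D := (ecD C).
Local Notation E := (ecE C).
Local Notation i := (eci C).
Local Notation j := (ecj C).
Local Notation k := (eck C).

(** The power [i^n]. The endpoint is a free parameter, so that any index equal to [x + s *+ n] can
    be used; the final cast makes the map zero for every other [y]. *)
Fixpoint iter_i n x y : {linear D x -> D y} :=
  if n is n'.+1 then iter_i n' (x + s) y \o i x (x + s) else cast_lin D x y.

Lemma iter_i0 x d : iter_i 0 x x d = d.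
Proof. exact: cast_lin_id. Qed.

Lemma iter_iSr n x y z d : y = x + s *+ n -> z = y + s ->
  iter_i n.+1 x z d = i y z (iter_i n x y d).
Proof.
elim: n x y d => [|n IHn] x y d.
  by rewrite mulr0n addr0 => -> -> /=; rewrite !cast_lin_id.
rewrite mulrS addrA => yE zE.
by rewrite -[LHS]/(iter_i n.+1 (x + s) z (i x (x + s) d)) (IHn _ _ _ yE zE).
Qed.

Lemma iter_iD m n x y z d : y = x + s *+ m ->
  iter_i (m + n) x z d = iter_i n y z (iter_i m x y d).
Proof.
elim: m x d => [|m IHm] x d; first by rewrite mulr0n addr0 => ->; rewrite iter_i0.
by rewrite mulrS addrA => yE; exact: IHm.
Qed.

(** Derived couples are not iterated: every page is the subquotient [k^-1 (im i^n) / j (ker i^n)] of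
    the first one. Its differential is [j i^-n k], stated as a relation because [i^n] need not be
    injective. *)
Definition ec_cycle n x (e : E x) : Prop := exists y (d : D y),
  y + s *+ n = x + kd /\ iter_i n y (x + kd) d = k x (x + kd) e.

Definition ec_boundary n z (e : E z) : Prop := exists y (d : D y),
  [/\ y + jd = z, iter_i n y (y + s *+ n) d = 0 & j y z d = e].

Definition diff_rel n x z (e : E x) (e' : E z) : Prop := exists y (d : D y),
  [/\ y + s *+ n = x + kd, y + jd = z,
      iter_i n y (x + kd) d = k x (x + kd) e & j y z d = e'].

Fact cycle0 n x : @ec_cycle n x 0.
Proof. by exists (x + kd - s *+ n), 0; rewrite subrK !raddf0. Qed.

Fact cycle_lin n x a e e' : @ec_cycle n x e -> ec_cycle n e' -> ec_cycle n (a *: e + e').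
Proof.
move=> [y [d [yE de]]] [y' [d' [yE' de']]].
have yy : y' = y by apply: (addIr (s *+ n)); rewrite yE.
by subst y'; exists y, (a *: d + d'); rewrite !linearP de de'.
Qed.

Fact boundary0 n x : @ec_boundary n x 0.
Proof. by exists (x - jd), 0; rewrite subrK !raddf0. Qed.

Fact boundary_lin n x a e e' :
  @ec_boundary n x e -> ec_boundary n e' -> ec_boundary n (a *: e + e').
Proof.
move=> [y [d [yE dz <-]]] [y' [d' [yE' dz' <-]]].
have yy : y' = y by apply: (addIr jd); rewrite yE.
by subst y'; exists y, (a *: d + d'); rewrite !linearP dz dz' scaler0 addr0.
Qed.

Definition ec_cycles n x : submod (E x) := submod_of (@cycle0 n x) (@cycle_lin n x).
Definition ec_boundaries n x : submod (E x) :=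
  submod_of (@boundary0 n x) (@boundary_lin n x).

Lemma diff_rel_linear n x z : linear_rel (@diff_rel n x z).
Proof.
move=> a e f e' f' [y [d [yE yz de <-]]] [y' [d' [yE' _ de' <-]]].
have yy : y' = y by apply: (addIr (s *+ n)); rewrite yE.
by subst y'; exists y, (a *: d + d'); rewrite !linearP de de'.
Qed.

Lemma kj0 x y z d : y = x + jd -> z = y + kd -> k y z (j x y d) = 0.
Proof. by move=> xy yz; apply/(ec_kerk xy yz); exists d. Qed.

Lemma cycle_j n x z (d : D x) : z = x + jd -> ec_cycle n (j x z d).
Proof.
move=> zE; exists (z + kd - s *+ n), 0; rewrite subrK; split=> //.
by rewrite raddf0 kj0.
Qed.

Lemma cycleSn n x (e : E x) : ec_cycle n.+1 e -> ec_cycle n e.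
Proof.
move=> [y [d [yE de]]]; exists (y + s), (i y (y + s) d); split=> //.
by rewrite -yE mulrS addrA.
Qed.

Lemma boundarynS n x (e : E x) : ec_boundary n e -> ec_boundary n.+1 e.
Proof.
move=> [y [d [yE dz de]]]; exists y, d; split=> //.
by rewrite (iter_iSr (y := y + s *+ n)) ?mulrSr ?addrA// dz raddf0.
Qed.

(* The degree of the differential of [ec_page n], which is the page [n + 2] of the
   spectral sequence. *)
Definition page_deg n := kd - s *+ n + jd.

Lemma diff_rel_tot n x z (e : E x) : z = x + page_deg n -> ec_cycle n e ->
  exists2 e' : E z, ec_cycle n e' & diff_rel n e e'.
Proof.
move=> zE [y [d [yE de]]].
have yz : z = y + jd by rewrite zE /page_deg addrA addrA -yE addrK.
by exists (j y z d); [exact: cycle_j | exists y, d; split].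
Qed.

(** A boundary lies in the image of [j], so [k] kills it and the chosen [d] lies in [ker i^n]. *)
Lemma diff_rel_boundary n x z (e : E x) (e' : E z) :
  ec_boundary n e -> diff_rel n e e' -> ec_boundary n e'.
Proof.
move=> [y' [d' [yE' _ de']]] [y [d [yE yz de <-]]].
by exists y, d; split=> //; rewrite yE de -de' kj0.
Qed.

Lemma diff_rel_cycle n x z (e : E x) (e' : E z) :
  diff_rel n e e' -> ec_cycle n e /\ ec_cycle n e'.
Proof.
move=> [y [d [yE yz de <-]]]; split; first by exists y, d.
exact: cycle_j.
Qed.

(** If [k e = i^(n+1) d1], then [d - i d1] is killed by [i^n] and has the same image under [j] as
    [d]. Conversely, if [j d = j d'] with [i^n d' = 0], then [d - d' = i d3] and
    [i^(n+1) d3 = k e]. *)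
Lemma cycleSP n x z (e : E x) (e' : E z) : diff_rel n e e' ->
  ec_cycle n.+1 e <-> ec_boundary n e'.
Proof.
move=> [y [d [yE yz de <-]]]; split=> [[y1 [d1 [yE1 de1]]]|].
  have yy : y1 + s = y by apply: (addIr (s *+ n)); rewrite yE -addrA -mulrS.
  subst y; exists (y1 + s), (d - i y1 (y1 + s) d1); split=> //.
    by rewrite yE raddfB/= de -[iter_i n _ _ (i _ _ _)]/(iter_i n.+1 y1 _ d1) de1 subrr.
  rewrite raddfB/=; suff -> : j (y1 + s) z (i y1 (y1 + s) d1) = 0 by rewrite subr0.
  by apply/(ec_kerj erefl (esym yz)); exists d1.
move=> [y' [d' [yE' dz dj]]].
have yy : y' = y by apply: (addIr jd); rewrite yE'.
subst y'; have yE1 : y = (y - s) + s by rewrite subrK.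
have [|d3 d3E] := iffLR (ec_kerj yE1 (esym yz) (d - d')).
  by rewrite raddfB/= dj subrr.
exists (y - s), d3; split; first by rewrite mulrS addrA subrK.
rewrite -[LHS]/(iter_i n (y - s + s) _ (i _ _ d3)) -yE1 d3E raddfB/= de.
by rewrite -yE dz subr0.
Qed.

(** [i^(n+1) d = 0] means that [i^n d] lies in [ker i = im k]. *)
Lemma boundarySP n x z (e' : E z) : z = x + page_deg n ->
  ec_boundary n.+1 e' <-> exists e : E x, diff_rel n e e'.
Proof.
move=> zE; split=> [[y [d [yz dz <-]]]|[e [y [d [yE yz de <-]]]]].
  have yE : y + s *+ n = x + kd.
    by move: zE; rewrite -yz /page_deg !addrA => /addIr ->; rewrite subrK.
  have := dz; rewrite (iter_iSr (y := x + kd)) ?mulrSr ?addrA ?yE//.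
  by move=> /(ec_keri erefl erefl)[e ke]; exists e, y, d.
exists y, d; split=> //.
rewrite (iter_iSr (y := x + kd)) ?mulrSr ?addrA ?yE// de.
by apply/(ec_keri erefl erefl); exists e.
Qed.

Definition ec_page n x : lmodType A := subquo (ec_cycles n x) (ec_boundaries n x).

Lemma cyclesP n x e : e \in smem (ec_cycles n x) <-> ec_cycle n e.
Proof. exact: submod_ofP. Qed.

Lemma boundariesP n x e : e \in smem (ec_boundaries n x) <-> ec_boundary n e.
Proof. exact: submod_ofP. Qed.

Lemma rep_cycle n x (e : E x) (c : ec_page n x) : rep e c -> ec_cycle n e.
Proof. by move=> /rep_mem/cyclesP. Qed.

Lemma cycle_rep n x (e : E x) : ec_cycle n e -> exists c : ec_page n x, rep e c.
Proof. by move=> /cyclesP; apply: rep_tot. Qed.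

Lemma rep_boundary n x (e : E x) (c : ec_page n x) :
  rep e c -> c = 0 <-> ec_boundary n e.
Proof. by move=> ec; rewrite (rep_eq0 ec) boundariesP. Qed.

Lemma ec_diff_ex n x z : exists f : {linear ec_page n x -> ec_page n z},
  (z <> x + page_deg n -> forall c, f c = 0) /\
  (z = x + page_deg n -> forall e c e' c', rep e c -> rep e' c' ->
     diff_rel n e e' -> f c = c').
Proof.
have [zE|ne] := eqVneq z (x + page_deg n); last first.
  by exists \0; split=> // zE; rewrite zE eqxx in ne.
pose R (c : ec_page n x) (c' : ec_page n z) :=
  exists e e', [/\ rep e c, rep e' c' & diff_rel n e e'].
have [||c' [e [e' [e0 ec' ee']]]|f fR] := @linear_of_rel _ _ _ R.
- move=> a c c' d d' [e [e' [ec ec' ee']]] [f [f' [fd fd' ff']]].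
  exists (a *: e + f), (a *: e' + f').
  by split; [apply: rep_linear|apply: rep_linear|apply: diff_rel_linear].
- move=> c; have [e ec] := rep_ex c.
  have [e' Ze' ee'] := diff_rel_tot zE (rep_cycle ec).
  have [c' ec'] := cycle_rep Ze'.
  by exists c', e, e'.
- apply/(rep_boundary ec'); apply: diff_rel_boundary ee'.
  exact/(rep_boundary e0).
- exists f; split=> // _ e c e' c' ec ec' ee'; apply/fR.
  by exists e, e'.
Qed.

Definition ec_diff n x z : {linear ec_page n x -> ec_page n z} :=
  projT1 (cid (ec_diff_ex n x z)).

Lemma ec_diff0 n x z c : z <> x + page_deg n -> ec_diff n x z c = 0.
Proof. by rewrite /ec_diff; case: cid => f [f0 _] /= /f0. Qed.

Lemma ec_diffE n x z e c e' c' : rep e c -> rep e' c' -> diff_rel n e e' ->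
  ec_diff n x z c = c'.
Proof.
move=> ec ec' ee'; rewrite /ec_diff; case: cid => f [_ fE] /=.
apply: (fE _ _ _ _ _ ec ec' ee'); case: ee' => y [d [yE yz _ _]].
by rewrite -yz /page_deg !addrA -yE addrK.
Qed.

Lemma ec_diff_rep n x z e c : rep e c -> z = x + page_deg n ->
  exists2 e', diff_rel n e e' & rep e' (ec_diff n x z c).
Proof.
move=> ec zE.
have [e' Ze' ee'] := diff_rel_tot zE (rep_cycle ec).
have [c' ec'] := cycle_rep Ze'.
by exists e' => //; rewrite (ec_diffE ec ec' ee').
Qed.

Lemma ec_diff_diff n x y z c : ec_diff n y z (ec_diff n x y c) = 0.
Proof.
have [yE|/eqP ne] := eqVneq y (x + page_deg n); last by rewrite (ec_diff0 _ ne) raddf0.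
have [zE|/eqP ne] := eqVneq z (y + page_deg n); last exact: ec_diff0.
have [e ec] := rep_ex c; have [e' ee' ec'] := ec_diff_rep ec yE.
apply: (ec_diffE ec' (rep0 _ _)); exists (z - jd), 0.
rewrite !raddf0 subrK zE /page_deg !addrA addrK subrK; split=> //.
by case: ee' => y' [d [_ y'y _ <-]]; rewrite (kj0 _ (esym y'y)).
Qed.

(** Classes on the two sides correspond when they have a common representative on the first page.
    The kernel and the image of the differential are read off from [cycleSP] and [boundarySP]. *)
Lemma ec_pageS n x y z : y = x + page_deg n -> z = y + page_deg n ->
  isomorphic (ec_page n.+1 y) (homology (ec_diff n x y) (ec_diff n y z)).
Proof.
move=> yE zE.
pose R (c : ec_page n.+1 y) (h : homology (ec_diff n x y) (ec_diff n y z)) :=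
  exists e c0, [/\ rep e c, @rep _ _ (ec_cycles n y) (ec_boundaries n y) e c0 & rep c0 h].
have ker c0 e : @rep _ _ (ec_cycles n y) (ec_boundaries n y) e c0 ->
    ec_diff n y z c0 = 0 <-> ec_cycle n.+1 e.
  move=> ec0; have [e' ee' ec'] := ec_diff_rep ec0 zE.
  by rewrite (rep_boundary ec') (cycleSP ee').
have im c0 e : @rep _ _ (ec_cycles n y) (ec_boundaries n y) e c0 ->
    (exists c1, ec_diff n x y c1 = c0) <-> ec_boundary n.+1 e.
  move=> ec0; split=> [[c1 c1E]|].
    have [e1 ec1] := rep_ex c1; have [e1' ee1 ec1'] := ec_diff_rep ec1 yE.
    have Be1 : ec_boundary n.+1 e1' by apply/(boundarySP _ yE); exists e1.
    have /boundariesP/boundarynS Be : e - e1' \in smem (ec_boundaries n y).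
      by apply/(rep_eq ec0 ec1').
    by rewrite -[e](subrK e1') -[e - e1']scale1r; apply: boundary_lin.
  move=> /(boundarySP _ yE)[e1 ee1]; have [Ze1 _] := diff_rel_cycle ee1.
  have [c1 ec1] := cycle_rep Ze1.
  by exists c1; apply: ec_diffE ec1 ec0 ee1.
apply: (@iso_of_rel _ _ _ R).
- move=> a c h c' h' [e [c0 [ec ec0 c0h]]] [e' [c0' [ec' ec0' c0h']]].
  by exists (a *: e + e'), (a *: c0 + c0'); split; apply: rep_linear.
- move=> c; have [e ec] := rep_ex c; have Ze := rep_cycle ec.
  have [c0 ec0] := cycle_rep (cycleSn Ze).
  have [|h c0h] := @rep_tot _ _ (kernel_mod (ec_diff n y z)) (image_mod (ec_diff n x y)) c0.
    exact/kernel_modP/(ker _ _ ec0).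
  by exists h, e, c0.
- move=> h; have [c0 c0h] := rep_ex h; have /kernel_modP dc0 := rep_mem c0h.
  have [e ec0] := rep_ex c0.
  have [c ec] := cycle_rep (iffLR (ker _ _ ec0) dc0).
  by exists c, e, c0.
- move=> h [e [c0 [ec ec0 c0h]]]; apply/(rep_eq0 c0h)/image_modP/(im _ _ ec0).
  exact/(rep_boundary ec).
- move=> c [e [c0 [ec ec0 c0h]]]; apply/(rep_boundary ec)/(im _ _ ec0).
  exact/image_modP/(rep_eq0 c0h).
Qed.

Lemma ec_page0 x : isomorphic (ec_page 0 x) (E x).
Proof.
apply: (@iso_of_rel _ _ _ (fun c e => rep e c)).
- by move=> a c e c' e'; apply: rep_linear.
- exact: rep_ex.
- move=> e; apply/cycle_rep; exists (x + kd), (k x (x + kd) e).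
  by rewrite mulr0n addr0 iter_i0.
- move=> e /(fun h => iffLR (rep_boundary h) erefl)[y [d [_ dz <-]]].
  suff -> : d = 0 by rewrite raddf0.
  by move: dz; rewrite mulr0n addr0 iter_i0.
- by move=> c /rep_eq0[_ ->//]; apply: rpred0.
Qed.

Lemma ec_page_zero n x : zero_module (E x) -> zero_module (ec_page n x).
Proof.
move=> E0 c; have [e ec] := rep_ex c.
by apply/(rep_eq0 ec); rewrite (E0 e) rpred0.
Qed.

End Pages.

(** * The spectral sequence of a bigraded exact couple *)

Lemma pair_ext (T U : Type) (x y : T * U) : x.1 = y.1 -> x.2 = y.2 -> x = y.
Proof. by case: x y => [? ?] [? ?] /= -> ->. Qed.

Lemma pairMn (a b : int) n : (a, b) *+ n = (a * n%:Z, b * n%:Z).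
Proof.
elim: n => [|n IHn]; first by rewrite mulr0n !mulr0.
by rewrite mulrS IHn; apply: pair_ext => /=; lia.
Qed.

Lemma fstD (x y : int * int) : (x + y).1 = x.1 + y.1. Proof. by []. Qed.
Lemma sndD (x y : int * int) : (x + y).2 = x.2 + y.2. Proof. by []. Qed.
Lemma fstN (x : int * int) : (- x).1 = - x.1. Proof. by []. Qed.
Lemma sndN (x : int * int) : (- x).2 = - x.2. Proof. by []. Qed.

Ltac pair_lia :=
  apply: pair_ext; rewrite ?(fstD, sndD, fstN, sndN, pairMn) /=; lia.

Section SpectralSequence.
Variables (A : comPzRingType) (e : int) (kd jd : int * int).
Hypothesis deg_kj : kd + jd = (e *+ 2, - e).
Variable C : exact_couple A (- e, e) kd jd.

Let pg (r : nat) (p q : int) : lmodType A := ec_page C (r - 2) (p, q).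

(** For [r < 2] the truncated [r - 2] repeats page 2, whose differential does not have the bidegree
    prescribed for [r]; the zero map satisfies the shape condition instead. *)
Let pg_d (r : nat) (p q p' q' : int) : {linear pg r p q -> pg r p' q'} :=
  if (2 <= r)%N then ec_diff C (r - 2) (p, q) (p', q') else \0.

Lemma page_degE (r : nat) (p q : int) : (2 <= r)%N ->
  (p + e * r%:Z, q - e * (r%:Z - 1)) = (p, q) + page_deg (- e, e) kd jd (r - 2).
Proof.
move=> r2; rewrite /page_deg addrAC deg_kj.
have -> : r%:Z = (r - 2)%:Z + 2 by lia.
by move: (r - 2)%N => n; pair_lia.
Qed.

Fact ec_page_shape r (p q p' q' : int) :
  (p', q') != (p + e * r%:Z, q - e * (r%:Z - 1)) ->
  forall x, @pg_d r p q p' q' x = 0.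
Proof.
rewrite /pg_d; case: leqP => // r2; rewrite page_degE// => /eqP ne x.
exact: ec_diff0.
Qed.

Fact ec_page_dd r p q p' q' p'' q'' x :
  @pg_d r p' q' p'' q'' (@pg_d r p q p' q' x) = 0.
Proof. by rewrite /pg_d; case: leqP => // r2; apply: ec_diff_diff. Qed.

Fact ec_page_next r p q : (2 <= r)%N ->
  isomorphic (pg r.+1 p q)
    (homology (@pg_d r (p - e * r%:Z) (q + e * (r%:Z - 1)) p q)
              (@pg_d r p q (p + e * r%:Z) (q - e * (r%:Z - 1)))).
Proof.
move=> r2; rewrite /pg_d r2 /pg subSn//; apply: ec_pageS.
  by rewrite -page_degE// !(addrK, subrK).
exact: page_degE.
Qed.

Definition ec_spectral_sequence : spectral_sequence A e :=
  SpectralSequence ec_page_shape ec_page_dd ec_page_next.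

End SpectralSequence.

Section Iterations.
Variables (A : comPzRingType) (I : zmodType) (s kd jd : I).
Variable C : exact_couple A s kd jd.

Lemma eci_inj x y z d : zero_module (ecE C x) -> y = x + kd -> z = y + s ->
  eci C y z d = 0 -> d = 0.
Proof. by move=> E0 yE zE /(ec_keri yE zE)[e <-]; rewrite (E0 e) raddf0. Qed.

Lemma eci_surj x y z (d : ecD C y) : zero_module (ecE C z) -> y = x + s ->
  z = y + jd -> exists d', eci C x y d' = d.
Proof. by move=> E0 yE zE; apply/(ec_kerj yE zE). Qed.

Lemma iter_i_inj n y z d :
    (forall m, (m < n)%N -> zero_module (ecE C (y + s *+ m - kd))) ->
  z = y + s *+ n -> iter_i C n y z d = 0 -> d = 0.
Proof.
elim: n y d => [|n IHn] y d E0; first by rewrite mulr0n addr0 => ->; rewrite iter_i0.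
rewrite mulrS addrA => zE /= /IHn id0; apply: (@eci_inj (y - kd)) (id0 _ _) => //.
- by have := E0 0%N isT; rewrite mulr0n addr0.
- by rewrite subrK.
by move=> m mn; rewrite -[y + s + _]addrA -mulrS; apply: E0.
Qed.

Lemma iter_i_surj n y z (d : ecD C z) :
    (forall m, (m < n)%N -> zero_module (ecE C (y + s *+ m.+1 + jd))) ->
  z = y + s *+ n -> exists d', iter_i C n y z d' = d.
Proof.
elim: n y => [|n IHn] y E0.
  by rewrite mulr0n addr0 => zy; subst z; exists d; rewrite iter_i0.
rewrite mulrS addrA => zE.
have [m mn|d1 <-] := IHn (y + s) _ zE; first by rewrite -[y + s + _]addrA -mulrS; apply: E0.
have [|||d2 <-] := @eci_surj y (y + s) (y + s + jd) d1 => //.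
  by have := E0 0%N isT; rewrite mulr1n.
by exists d2.
Qed.

End Iterations.

Lemma ec_first_quadrant (A : comPzRingType) e kd jd (kj : kd + jd = (e *+ 2, - e))
    (C : exact_couple A (- e, e) kd jd) :
  (forall p q : int, (p < 0) || (q < 0) -> zero_module (ecE C (p, q))) ->
  first_quadrant (ec_spectral_sequence kj C).
Proof. by move=> E0 r p q r2 pq; apply/ec_page_zero/E0. Qed.

(** * Convergence in the cohomological case *)

Definition pos_part (p : int) : nat := if p is Posz n then n else 0%N.

Section CohomologyConvergence.
Variable A : comPzRingType.
Variable C : exact_couple A (- 1, 1) (2, -1) (0 : int * int).
Hypothesis deg_kj : (2, -1) + (0 : int * int) = ((1 : int) *+ 2, - (1 : int)).
Local Notation D := (ecD C).
Local Notation E := (ecE C).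
Hypothesis E0 : forall p q : int, (p < 0) || (q < 0) -> zero_module (E (p, q)).
Variable n0 : int.
Hypothesis D0 : forall p q : int, q < n0 -> zero_module (D (p, q)).

(** Into a row [q < 0] the map [i] is onto, since its cokernel embeds in [E^(p,q) = 0]. So every
    element comes from the row below, and after finitely many steps from a row under [n0]. *)
Lemma coh_D0 (p q : int) : q < 0 -> zero_module (D (p, q)).
Proof.
have H k : forall p q : int, q < n0 + k%:Z -> q < 0 -> zero_module (D (p, q)).
  elim: k => [|k IHk] {}p {}q qk q0; first by apply: D0; lia.
  move=> d; have [|||d' <-] := @eci_surj _ _ _ _ _ C (p + 1, q - 1) (p, q) (p, q) d.
  - by apply: E0; rewrite q0 orbT.
  - by pair_lia.
  - by rewrite addr0.
  by rewrite (IHk _ _ _ _ d') ?raddf0//; lia.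
by move=> q0; apply: (H (absz n0)) => //; lia.
Qed.

Let tower (n : int) (a : nat) : int * int := (a%:Z, n - a%:Z).

Let F (n p : int) : submod (D (0, n)) :=
  image_mod (iter_i C (pos_part p) (tower n (pos_part p)) (0, n)).

(** The kernel of [i] on [D^(p,q)] is the image of [E^(p-2,q+1)], which vanishes for [p <= 1]; this
    condition persists, as [i] lowers [p]. *)
Lemma iter_i_low n x (d : D x) z : x.1 <= 1 -> z = x + (-1, 1 : int) *+ n ->
  iter_i C n x z d = 0 -> d = 0.
Proof.
case: x d => p q d /= p1; apply: iter_i_inj => m _.
rewrite pairMn; apply: E0; rewrite /=; lia.
Qed.

(** Both sides amount to [i^(N+1) d = 0]: after [p] steps the column is [0], after [N] steps it is
    [p - N <= 1], and from either one [i] is injective. *)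
Lemma iter_i_kernel (p : nat) (q : int) N d : (p <= N.+1)%N ->
  iter_i C p (p%:Z, q) (0, p%:Z + q) d = 0 <->
  iter_i C N (p%:Z, q) ((p%:Z, q) + (-1, 1 : int) *+ N) d = 0.
Proof.
move=> pN; have dE : iter_i C N.+1 (p%:Z, q) ((p%:Z, q) + (-1, 1 : int) *+ N.+1) d =
    iter_i C (N.+1 - p) (0, p%:Z + q) ((p%:Z, q) + (-1, 1 : int) *+ N.+1)
     (iter_i C p (p%:Z, q) (0, p%:Z + q) d).
  by rewrite -iter_iD ?subnKC//; pair_lia.
have := dE; rewrite (iter_iSr (y := (p%:Z, q) + (-1, 1 : int) *+ N)) ?mulrSr ?addrA//.
move=> dE'; split=> [d0|d0].
  move: dE'; rewrite d0 [RHS]raddf0.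
  move=> id; apply: (@iter_i_low 1 _ _ ((p%:Z, q) + (-1, 1 : int) *+ N.+1)).
  - by rewrite pairMn /=; lia.
  - by rewrite mulr1n mulrSr addrA.
  - by rewrite (iter_iSr (y := (p%:Z, q) + (-1, 1 : int) *+ N)) ?mulr0n ?addr0 ?iter_i0// mulrSr addrA.
move: dE'; rewrite d0 [LHS]raddf0 => /esym; apply: iter_i_low => //=.
by pair_lia.
Qed.

(** On the limit page the cycles are [ker k = im j], because [i^N] starts in a negative row, and the
    boundaries are the image under [j] of the kernel of [i^p : D^(p,q) -> D^(0,n)]. The page is
    therefore [D^(p,q) / (im i + ker i^p)], which [i^p] carries onto [im i^p / im i^(p+1)]. *)
Lemma ec_cohomology_converges :
  cohomology_converges (ec_spectral_sequence deg_kj C) (fun n => D (0, n)).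
Proof.
have F0 n p x : pos_part p = 0%N -> x \in smem (F n p).
  move=> p0; apply/image_modP; rewrite p0 /tower subr0.
  by exists x; rewrite iter_i0.
exists F; split.
- move=> n [a|a] x; last by move=> _; apply: F0.
  move=> /image_modP[d <-]; apply/image_modP; rewrite /= addn1 in d *.
  have -> : tower n a = tower n a.+1 + (-1, 1) by rewrite /tower; pair_lia.
  by exists (eci C _ _ d).
- by move=> n [[|a]|a]// _ x; apply: F0.
- move=> n p np x; move=> /image_modP[d <-].
  suff Dd : zero_module (D (tower n (pos_part p))) by rewrite (Dd d) raddf0.
  by apply: coh_D0; case: p np {d} => /=; lia.
(* [limit_page] is the page [(maxn p q.+1).+1], that is [ec_page N]. Two bounds are used:
   [p <= N + 1] for the boundaries and [q <= N] for the cycles. *)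
move=> p q n; pose N := (maxn p q.+1 - 1)%N.
have Fp x : x \in smem (F n p%:Z) <->
    exists d : D (p%:Z, q%:Z), iter_i C p (p%:Z, q%:Z) (0, n) d = x.
  have t : tower n p = (p%:Z, q%:Z) by rewrite /tower /n; pair_lia.
  by rewrite -t image_modP.
have FSp x : x \in smem (F n (p%:Z + 1)) <-> exists d, iter_i C p (p%:Z, q%:Z) (0, n)
    (eci C (tower n p.+1) (p%:Z, q%:Z) d) = x.
  have t : (p%:Z, q%:Z) = tower n p.+1 + (-1, 1) by rewrite /tower /n; pair_lia.
  by rewrite t image_modP /= addn1.
have jker d : ecj C (p%:Z, q%:Z) (p%:Z, q%:Z) d = 0 <->
    exists d', eci C (tower n p.+1) (p%:Z, q%:Z) d' = d.
  by apply: ec_kerj; [rewrite /tower /n; pair_lia | rewrite addr0].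
apply: (@iso_of_rel _ _ _ (fun (c : ec_page C N (p%:Z, q%:Z)) v => exists d,
  rep (ecj C (p%:Z, q%:Z) (p%:Z, q%:Z) d) c /\ rep (iter_i C p (p%:Z, q%:Z) (0, n) d) v)).
- move=> a c v c' v' [d [dc dv]] [d' [dc' dv']].
  by exists (a *: d + d'); rewrite !linearP; split; apply: rep_linear.
- move=> c; have [e ec] := rep_ex c; have [y [d [yE de]]] := rep_cycle ec.
  have /(ec_kerk (esym (addr0 _)) erefl)[d' d'e] : eck C (p%:Z, q%:Z) ((p%:Z, q%:Z) + (2, -1)) e = 0.
    rewrite -de; suff Dy : zero_module (D y) by rewrite (Dy d) raddf0.
    have -> : y = (p%:Z + 2 + N%:Z, q%:Z - 1 - N%:Z).
      by apply: (addIr ((-1, 1 : int) *+ N)); rewrite yE; pair_lia.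
    by apply: coh_D0; rewrite /N; lia.
  have [|v dv] := @rep_tot _ _ (F n p%:Z) (F n (p%:Z + 1)) (iter_i C p (p%:Z, q%:Z) (0, n) d').
    by apply/Fp; exists d'.
  by exists v, d'; rewrite d'e.
- move=> v; have [x xv] := rep_ex v; have /Fp[d dx] := rep_mem xv.
  have [c dc] := cycle_rep (@cycle_j _ _ _ _ _ C N (p%:Z, q%:Z) (p%:Z, q%:Z) d (esym (addr0 _))).
  by exists c, d; rewrite dx.
- move=> v [d [d0 dv]]; apply/(rep_eq0 dv)/FSp.
  have [y [d2 [yE d20 dd2]]] := iffLR (rep_boundary d0) erefl.
  move: yE; rewrite addr0 => yE; subst y.
  have [|d3 d3E] := iffLR (jker (d - d2)); first by rewrite raddfB/= dd2 subrr.
  exists d3; rewrite d3E raddfB/=.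
  by rewrite (iffRL (@iter_i_kernel p q N d2 _)) ?subr0// /N; lia.
- move=> c [d [dc d0]]; apply/(rep_boundary dc).
  have /FSp[d3 d3E] := iffLR (rep_eq0 d0) erefl.
  exists (p%:Z, q%:Z), (d - eci C _ _ d3); split; first exact: addr0.
    apply/iter_i_kernel; first by rewrite /N; lia.
    by rewrite raddfB/= d3E subrr.
  rewrite raddfB/=.
  by rewrite (iffRL (jker (eci C _ _ d3))) ?subr0//; exists d3.
Qed.

End CohomologyConvergence.

(** * Convergence in the homological case *)

Section HomologyConvergence.
Variable A : comPzRingType.
Variable C : exact_couple A (- (-1), -1) (0 : int * int) (-2, 1).
Hypothesis deg_kj : (0 : int * int) + (-2, 1) = ((-1 : int) *+ 2, - (-1 : int)).
Local Notation D := (ecD C).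
Local Notation E := (ecE C).
Hypothesis E0 : forall p q : int, (p < 0) || (q < 0) -> zero_module (E (p, q)).
Variable n0 : int.
Hypothesis D0 : forall p q : int, q < n0 -> zero_module (D (p, q)).

(** Dually, [i] is injective on the rows [q < 0], its kernel being an image of [E_(p,q) = 0], and it
    leads down to rows under [n0]. *)
Lemma hom_D0 (p q : int) : q < 0 -> zero_module (D (p, q)).
Proof.
have H k : forall p q : int, q < n0 + k%:Z -> q < 0 -> zero_module (D (p, q)).
  elim: k => [|k IHk] {}p {}q qk q0; first by apply: D0; lia.
  move=> d; apply: (@eci_inj _ _ _ _ _ C (p, q) (p, q) (p + 1, q - 1)).
  - by apply: E0; rewrite q0 orbT.
  - by rewrite addr0.
  - by pair_lia.
  by apply: IHk; lia.
by move=> q0; apply: (H (absz n0)) => //; lia.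
Qed.

Let tower (n : int) (a : nat) : int * int := (a%:Z, n - a%:Z).

(** The exponent is [p + 1] because the filtration step [p] must be zero for [p = -1], where the
    truncation gives the kernel of [i^0], the identity. *)
Let F (n p : int) : submod (D (0, n)) :=
  kernel_mod (iter_i C (pos_part (p + 1)) (0, n) (tower n (pos_part (p + 1)))).

(** The cokernel of [i] at [(p,q)] embeds in [E_(p-2,q+1)], which vanishes for [p <= 1], and the
    earlier columns are smaller still. *)
Lemma iter_i_onto n x z (d : D z) : z.1 <= 1 -> z = x + (- (-1), -1 : int) *+ n ->
  exists d', iter_i C n x z d' = d.
Proof.
case: z d => p q d /= p1 zE; apply: iter_i_surj => // m mn.
have -> : x = (p - n%:Z, q + n%:Z).
  by apply: (addIr ((- (-1), -1 : int) *+ n)); rewrite -zE; pair_lia.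
by rewrite pairMn; apply: E0; rewrite /=; lia.
Qed.

(** Both images are that of [i^(N+1)] from [y0], since [i] is onto every column [<= 1]. *)
Lemma iter_i_image (p : nat) (q : int) N x : (p <= N.+1)%N ->
  (exists d, iter_i C p (0, p%:Z + q) (p%:Z, q) d = x) <->
  (exists d, iter_i C N (p%:Z - N%:Z, q + N%:Z) (p%:Z, q) d = x).
Proof.
move=> pN; pose y0 : int * int := (p%:Z - N.+1%:Z, q + N.+1%:Z).
have y0E : (p%:Z - N%:Z, q + N%:Z) = y0 + (- (-1), -1) by rewrite /y0; pair_lia.
have dE d : iter_i C N.+1 y0 (p%:Z, q) d =
    iter_i C p (0, p%:Z + q) (p%:Z, q) (iter_i C (N.+1 - p) y0 (0, p%:Z + q) d).
  by rewrite -iter_iD ?subnK// /y0; pair_lia.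
rewrite y0E; split=> [[d <-]|[d <-]].
  have [//||d' <-] := @iter_i_onto (N.+1 - p) y0 _ d; first by rewrite /y0; pair_lia.
  by rewrite -dE; exists (eci C _ _ d').
have [||d' <-] := @iter_i_onto 1 y0 _ d.
- by rewrite /y0 /=; lia.
- by rewrite mulr1n.
rewrite /= cast_lin_id; rewrite -[X in exists _, _ = X]/(iter_i C N.+1 y0 _ d') dE.
by exists (iter_i C (N.+1 - p) y0 (0, p%:Z + q) d').
Qed.

(** Here the boundaries are [ker k], because [i^N] ends in a negative row, and the cycles are the
    [e] with [k e] in [im i^p]. So [k] identifies the limit page with the intersection of [ker i]
    and [im i^p], to which [i^p] also maps [ker i^(p+1) / ker i^p] isomorphically. *)
Lemma ec_homology_converges :
  homology_converges (ec_spectral_sequence deg_kj C) (fun n => D (0, n)).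
Proof.
have F0 (n p : int) x : p < 0 -> x \in smem (F n p) -> x = 0.
  move=> p0 /kernel_modP; have -> : pos_part (p + 1) = 0%N by case: p p0 => // -[].
  by rewrite /tower subr0 iter_i0.
exists F; split.
- move=> n [a|a] x; last first.
    by move=> xF; rewrite (F0 _ _ _ _ xF) ?rpred0//; lia.
  rewrite /F subrK => /kernel_modP x0; apply/kernel_modP.
  have -> : pos_part (a%:Z + 1) = a.+1 by rewrite /= addn1.
  by rewrite (iter_iSr (y := tower n a)) ?x0 ?raddf0// /tower; pair_lia.
- move=> n p np x; apply/kernel_modP.
  suff Dd : zero_module (D (tower n (pos_part (p + 1)))) by rewrite (Dd (iter_i _ _ _ _ _)).
  by apply: hom_D0; case: p np => [|[|]] /=; lia.
- by move=> n p p0 x; apply: F0.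
move=> p q n; pose N := (maxn p q.+1 - 1)%N.
have Fp x : x \in smem (F n p%:Z) <->
    eci C (p%:Z, q%:Z) (tower n p.+1) (iter_i C p (0, n) (p%:Z, q%:Z) x) = 0.
  have e : pos_part (p%:Z + 1) = p.+1 by rewrite /= addn1.
  rewrite kernel_modP e (iter_iSr (y := (p%:Z, q%:Z)))//;
  by rewrite /tower /n; pair_lia.
have FPp x : x \in smem (F n (p%:Z - 1)) <-> iter_i C p (0, n) (p%:Z, q%:Z) x = 0.
  have t : tower n p = (p%:Z, q%:Z) by rewrite /tower /n; pair_lia.
  by rewrite kernel_modP subrK /= t.
have iker d : eci C (p%:Z, q%:Z) (tower n p.+1) d = 0 <->
    exists e, eck C (p%:Z, q%:Z) (p%:Z, q%:Z) e = d.
  by apply: ec_keri; [rewrite addr0 | rewrite /tower /n; pair_lia].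
have Zcyc (e : E (p%:Z, q%:Z)) : ec_cycle N e <-> exists d, iter_i C p (0, n) (p%:Z, q%:Z) d =
    eck C (p%:Z, q%:Z) (p%:Z, q%:Z) e.
  rewrite (@iter_i_image p q N) => [|]; last by rewrite /N; lia.
  rewrite /ec_cycle addr0; split=> [[y [d [yE <-]]]|[d de]]; last first.
    by eexists; exists d; split=> //; pair_lia.
  have yN : y = (p%:Z - N%:Z, q%:Z + N%:Z).
    by apply: (addIr ((- (-1), -1 : int) *+ N)); rewrite yE; pair_lia.
  by subst y; exists d.
have Bker (e : E (p%:Z, q%:Z)) : ec_boundary N e <-> eck C (p%:Z, q%:Z) (p%:Z, q%:Z) e = 0.
  have pj : (p%:Z, q%:Z) = (p%:Z + 2, q%:Z - 1) + (-2, 1 : int) by pair_lia.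
  rewrite (ec_kerk pj) ?addr0//; split=> [[y [d [yE _ <-]]]|[d de]].
    have y2 : y = (p%:Z + 2, q%:Z - 1) by apply: (addIr (-2, 1 : int)); rewrite yE.
    by subst y; exists d.
  eexists; exists d; split=> //.
  set z := (X in iter_i _ _ _ X _); suff Dz : zero_module (D z) by apply: Dz.
  have -> : z = (p%:Z + 2 + N%:Z, q%:Z - 1 - N%:Z) by rewrite /z; pair_lia.
  by apply: hom_D0; rewrite /N; lia.
apply: (@iso_of_rel _ _ _ (fun (c : ec_page C N (p%:Z, q%:Z)) v => exists e d,
  [/\ rep e c, rep d v &
    eck C (p%:Z, q%:Z) (p%:Z, q%:Z) e = iter_i C p (0, n) (p%:Z, q%:Z) d])).
- move=> a c v c' v' [e [d [ec dv ed]]] [e' [d' [ec' dv' ed']]].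
  exists (a *: e + e'), (a *: d + d').
  by rewrite !linearP ed ed'; split=> //; apply: rep_linear.
- move=> c; have [e ec] := rep_ex c; have /Zcyc[d de] := rep_cycle ec.
  have [|v dv] := @rep_tot _ _ (F n p%:Z) (F n (p%:Z - 1)) d.
    by apply/Fp; rewrite de; apply/iker; exists e.
  by exists v, e, d.
- move=> v; have [d dv] := rep_ex v; have /Fp/iker[e ed] := rep_mem dv.
  have [|c ec] := @cycle_rep _ _ _ _ _ C N _ e; first by apply/Zcyc; exists d.
  by exists c, e, d.
- move=> v [e [d [e0 dv ed]]]; apply/(rep_eq0 dv)/FPp.
  by rewrite -ed; apply/Bker/(rep_boundary e0).
- move=> c [e [d [ec d0 ed]]]; apply/(rep_boundary ec)/Bker.
  by rewrite ed; apply/FPp/(rep_eq0 d0).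
Qed.

End HomologyConvergence.

(** * Exact couples from sequences indexed by naturals *)

Definition zero_mod (A : comPzRingType) : lmodType A :=
  sub_of (kernel_mod (idfun : {linear A^o -> A^o})).

Lemma zero_modP (A : comPzRingType) : zero_module (zero_mod A).
Proof.
by move=> x; apply: val_inj; rewrite [RHS]raddf0; have /kernel_modP := valP x.
Qed.

Lemma cast_lin_inj (A : comPzRingType) (I : eqType) (F : I -> lmodType A) x y v :
  x = y -> cast_lin F x y v = 0 -> v = 0.
Proof. by move=> xy; subst y; rewrite cast_lin_id. Qed.

Lemma cast_lin_surj (A : comPzRingType) (I : eqType) (F : I -> lmodType A) x y w :
  x = y -> exists v, cast_lin F x y v = w.
Proof. by move=> xy; subst y; exists w; rewrite cast_lin_id. Qed.

(** Defined by cases so that it computes on constructors: the term of [ext_D] at [succz (Posz n)]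
    converts to [DD n.+1], which [p + 1] would not give. *)
Definition succz (p : int) : int :=
  match p with Posz n => n.+1%:Z | Negz 0 => 0 | Negz n.+1 => Negz n end.

Lemma succzE p : succz p = p + 1.
Proof. by case: p => [n|[|n]] /=; lia. Qed.

Section Extension.
Variables (A : comPzRingType) (DD EE : nat -> int -> lmodType A).

(* The terms with [p < 0] are copies of those with [p = 0] in the same total
   degree. *)
Definition ext_D (x : int * int) : lmodType A :=
  match x with (Posz n, q) => DD n q | (Negz n, q) => DD 0 (Negz n + q) end.

Definition ext_E (x : int * int) : lmodType A :=
  match x with (Posz n, q) => EE n q | (Negz _, _) => zero_mod A end.

End Extension.

Section CohomologyCouple.
Variables (A : comPzRingType) (DD EE : nat -> int -> lmodType A).
Variables (i : forall n q, {linear DD n.+1 (q - 1) -> DD n q})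
  (j : forall n q, {linear DD n q -> EE n q})
  (k : forall n q, {linear EE n q -> DD n.+2 (q - 1)}).
Hypotheses
  (keri0 : forall q d, i 0 q d = 0 -> d = 0)
  (keri : forall n q d, i n.+1 q d = 0 <-> exists e, k n q e = d)
  (kerj : forall n q d, j n q d = 0 <-> exists d', i n q d' = d)
  (kerk : forall n q e, k n q e = 0 <-> exists d, j n q d = e).
Local Notation D := (ext_D DD).
Local Notation E := (ext_E EE).

(** Indexed by its target, so that the source computes. In a column [p < 0] source and target are
    the same term of column [0] up to an equation between degrees, and the map is the identity along
    it. *)
Let pred_i (x : int * int) : {linear D (succz x.1, x.2 - 1) -> D x} :=
  match x with
  | (Posz n, q) => i n q
  | (Negz 0, q) => cast_lin (DD 0) (q - 1) (Negz 0 + q)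
  | (Negz n.+1, q) => cast_lin (DD 0) (Negz n + (q - 1)) (Negz n.+1 + q)
  end.

Let ci x y : {linear D x -> D y} :=
  pred_i y \o cast_lin D x (succz y.1, y.2 - 1).

Let cj x y : {linear D x -> E y} :=
  match x with
  | (Posz n, q) => cast_lin E (Posz n, q) y \o j n q
  | (Negz _, _) => \0
  end.

Let ck x y : {linear E x -> D y} :=
  match x with
  | (Posz n, q) => cast_lin D (Posz n.+2, q - 1) y \o k n q
  | (Negz _, _) => \0
  end.

Let ciE y d : ci (succz y.1, y.2 - 1) y d = pred_i y d.
Proof. by rewrite /ci /= cast_lin_id. Qed.

Fact coh_keri x y z : y = x + (2, -1) -> z = y + (- 1, 1) -> forall d,
  ci y z d = 0 <-> exists e, ck x y e = d.
Proof.
move=> yE zE; have yz : y = (succz z.1, z.2 - 1).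
  by rewrite succzE zE; pair_lia.
have {zE} zE : z = x + (1, 0) by rewrite zE yE; pair_lia.
clear yE; subst y => d; rewrite ciE.
case: x zE d => -[n|n] q zE.
  have {zE} zn : z = (Posz n.+1, q) by rewrite zE; pair_lia.
  by subst z => d; rewrite /= keri; split=> -[e ed]; exists e;
    rewrite -ed /= cast_lin_id.
move=> d; rewrite /ck /=; split=> [d0|[_ <-]]; last exact: raddf0.
(* The [E]-term is zero here, so [i] has to be injective: into column [0] by [keri0], further left
   because it is a cast. *)
exists 0; apply/esym; case: n zE => [|[|n]] zE.
- have {zE} zn : z = (Posz 0, q) by rewrite zE; pair_lia.
  by subst z; apply: keri0.
- have {zE} zn : z = (Negz 0, q) by rewrite zE; pair_lia.
  by subst z; move: d d0 => /= d; apply: cast_lin_inj; lia.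
- have {zE} zn : z = (Negz n.+1, q) by rewrite zE; pair_lia.
  by subst z; move: d d0 => /= d; apply: cast_lin_inj; lia.
Qed.

Fact coh_kerj x y z : y = x + (- 1, 1) -> z = y + 0 -> forall d,
  cj y z d = 0 <-> exists d', ci x y d' = d.
Proof.
move=> yE; rewrite addr0 => ->.
have xy : x = (succz y.1, y.2 - 1) by rewrite succzE yE; pair_lia.
subst x; case: y {yE} => -[n|n] q d.
  rewrite /= cast_lin_id kerj.
  by split=> -[d' dd]; exists d'; rewrite -dd /= cast_lin_id.
split=> // _; suff [d' d'd] : exists d', pred_i (Negz n, q) d' = d.
  by exists d'; rewrite ciE.
by case: n d => [|n] /= d; apply: cast_lin_surj; lia.
Qed.

Fact coh_kerk x y z : y = x + 0 -> z = y + (2, -1) -> forall e,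
  ck y z e = 0 <-> exists d, cj x y d = e.
Proof.
rewrite addr0 => -> {y} zE; case: x zE => -[n|n] q zE.
  have {zE} zn : z = (Posz n.+2, q - 1) by rewrite zE; pair_lia.
  subst z => e; rewrite /= cast_lin_id kerk.
  by split=> -[d de]; exists d; rewrite -de /= cast_lin_id.
move=> e; split=> // _; exists 0; apply/esym; exact: zero_modP.
Qed.

Definition coh_couple : exact_couple A (- 1, 1) (2, -1) (0 : int * int) :=
  ExactCouple coh_keri coh_kerj coh_kerk.

Variable n0 : int.
Hypotheses (EE0 : forall n q, q < 0 -> zero_module (EE n q))
  (DD0 : forall n q, q < n0 -> zero_module (DD n q)).

Lemma coh_spectral_sequence : exists S : spectral_sequence A 1,
  [/\ first_quadrant S, forall p q : nat, isomorphic (S 2%N p q) (EE p q)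
    & cohomology_converges S (DD 0)].
Proof.
have deg_kj : (2, -1) + (0 : int * int) = ((1 : int) *+ 2, - (1 : int)) by [].
have E0 (p q : int) : (p < 0) || (q < 0) -> zero_module (ecE coh_couple (p, q)).
  by case: p => n /= q0; [apply: EE0 | apply: zero_modP].
exists (ec_spectral_sequence deg_kj coh_couple); split.
- exact: ec_first_quadrant.
- by move=> p q; apply: (@ec_page0 _ _ _ _ _ coh_couple (Posz p, Posz q)).
- apply: (@ec_cohomology_converges _ coh_couple deg_kj E0 n0).
  by move=> [n|n] q q0; apply: DD0 => //; lia.
Qed.

End CohomologyCouple.

Section HomologyCouple.
Variables (A : comPzRingType) (DD EE : nat -> int -> lmodType A).
Variables (i : forall n q, {linear DD n q -> DD n.+1 (q - 1)})
  (k : forall n q, {linear EE n q -> DD n q})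
  (j : forall n q, {linear DD n.+2 (q - 1) -> EE n q}).
Hypotheses
  (imi0 : forall q d, exists d', i 0 q d' = d)
  (keri : forall n q d, i n q d = 0 <-> exists e, k n q e = d)
  (kerj : forall n q d, j n q d = 0 <-> exists d', i n.+1 q d' = d)
  (kerk : forall n q e, k n q e = 0 <-> exists d, j n q d = e).
Local Notation D := (ext_D DD).
Local Notation E := (ext_E EE).

Let succ_i (x : int * int) : {linear D x -> D (succz x.1, x.2 - 1)} :=
  match x with
  | (Posz n, q) => i n q
  | (Negz 0, q) => cast_lin (DD 0) (Negz 0 + q) (q - 1)
  | (Negz n.+1, q) => cast_lin (DD 0) (Negz n.+1 + q) (Negz n + (q - 1))
  end.

Let ci x y : {linear D x -> D y} :=
  cast_lin D (succz x.1, x.2 - 1) y \o succ_i x.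

Let cj x y : {linear D x -> E y} :=
  match y with
  | (Posz n, q) => j n q \o cast_lin D x (Posz n.+2, q - 1)
  | (Negz _, _) => \0
  end.

Let ck x y : {linear E x -> D y} :=
  match x with
  | (Posz n, q) => cast_lin D (Posz n, q) y \o k n q
  | (Negz _, _) => \0
  end.

Let ciE x d : ci x (succz x.1, x.2 - 1) d = succ_i x d.
Proof. by rewrite /ci /= cast_lin_id. Qed.

Fact hom_keri x y z : y = x + 0 -> z = y + (- (-1), -1) -> forall d,
  ci y z d = 0 <-> exists e, ck x y e = d.
Proof.
rewrite addr0 => -> {y} zE; have {zE} xz : z = (succz x.1, x.2 - 1).
  by rewrite succzE zE; pair_lia.
subst z => d; rewrite ciE; case: x d => -[n|n] q d.
  by rewrite keri; split=> -[e ed]; exists e; rewrite -ed /= cast_lin_id.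
rewrite /ck /=; split=> [d0|[_ <-]]; last exact: raddf0.
by exists 0; apply/esym; case: n d d0 => [|n] /= d; apply: cast_lin_inj; lia.
Qed.

Fact hom_kerj x y z : y = x + (- (-1), -1) -> z = y + (-2, 1) -> forall d,
  cj y z d = 0 <-> exists d', ci x y d' = d.
Proof.
move=> yE zE; have yx : y = (succz x.1, x.2 - 1).
  by rewrite succzE yE; pair_lia.
have {yE zE} zE : z = x + (-1, 0) by rewrite zE yE; pair_lia.
subst y; case: z zE => -[n|n] q zE.
  have {zE} xn : x = (Posz n.+1, q).
    by apply: (addIr (-1, 0)); rewrite -zE; pair_lia.
  subst x => d; rewrite /= cast_lin_id kerj.
  by split=> -[d' dd]; exists d'; rewrite -dd /= cast_lin_id.
move=> d; split=> // _; suff [d' d'd] : exists d', succ_i x d' = d.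
  by exists d'; rewrite ciE.
case: n zE => [|[|n]] zE.
- have {zE} xn : x = (Posz 0, q) by apply: (addIr (-1, 0)); rewrite -zE; pair_lia.
  by subst x; apply: imi0.
- have {zE} xn : x = (Negz 0, q) by apply: (addIr (-1, 0)); rewrite -zE; pair_lia.
  by subst x; move: d => /= d; apply: cast_lin_surj; lia.
- have {zE} xn : x = (Negz n.+1, q) by apply: (addIr (-1, 0)); rewrite -zE; pair_lia.
  by subst x; move: d => /= d; apply: cast_lin_surj; lia.
Qed.

Fact hom_kerk x y z : y = x + (-2, 1) -> z = y + 0 -> forall e,
  ck y z e = 0 <-> exists d, cj x y d = e.
Proof.
move=> yE; rewrite addr0 => ->; case: y yE => -[n|n] q yE.
  have {yE} xn : x = (Posz n.+2, q - 1).
    by apply: (addIr (-2, 1)); rewrite -yE; pair_lia.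
  subst x => e; rewrite /= cast_lin_id kerk.
  by split=> -[d de]; exists d; rewrite -de /= cast_lin_id.
move=> e; split=> // _; exists 0; apply/esym; exact: zero_modP.
Qed.

Definition hom_couple : exact_couple A (- (-1), -1) (0 : int * int) (-2, 1) :=
  ExactCouple hom_keri hom_kerj hom_kerk.

Variable n0 : int.
Hypotheses (EE0 : forall n q, q < 0 -> zero_module (EE n q))
  (DD0 : forall n q, q < n0 -> zero_module (DD n q)).

Lemma hom_spectral_sequence : exists S : spectral_sequence A (-1),
  [/\ first_quadrant S, forall p q : nat, isomorphic (S 2%N p q) (EE p q)
    & homology_converges S (DD 0)].
Proof.
have deg_kj : (0 : int * int) + (-2, 1) = ((-1 : int) *+ 2, - (-1 : int)) by [].
have E0 (p q : int) : (p < 0) || (q < 0) -> zero_module (ecE hom_couple (p, q)).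
  by case: p => n /= q0; [apply: EE0 | apply: zero_modP].
exists (ec_spectral_sequence deg_kj hom_couple); split.
- exact: ec_first_quadrant.
- by move=> p q; apply: (@ec_page0 _ _ _ _ _ hom_couple (Posz p, Posz q)).
- apply: (@ec_homology_converges _ hom_couple deg_kj E0 n0).
  by move=> [n|n] q q0; apply: DD0 => //; lia.
Qed.

End HomologyCouple.

(** * Exact couples from delta-functors *)

(* [TZ q a], [TB q a] and [TH q a] stand for [T^a Z^q], [T^a B^q] and [T^a H^q], but
   [TE q a] for [T^a E^(q-1)]. *)
Section CohomologyOfDeltaFunctor.
Variables (A : comPzRingType) (TZ TE TB TH : int -> nat -> lmodType A).
Variables (al : forall q a, {linear TB q a -> TZ q a})
  (be : forall q a, {linear TZ q a -> TH q a})
  (ga : forall q a, {linear TH q a -> TB q a.+1})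
  (pi : forall q a, {linear TE q a -> TB q a})
  (de : forall q a, {linear TB q a -> TZ (q - 1) a.+1}).
Hypotheses
  (ker_al0 : forall q x, al q 0 x = 0 -> x = 0)
  (ker_be : forall q a z, be q a z = 0 <-> exists b, al q a b = z)
  (ker_ga : forall q a h, ga q a h = 0 <-> exists z, be q a z = h)
  (ker_al : forall q a b, al q a.+1 b = 0 <-> exists h, ga q a h = b)
  (ker_de : forall q a b, de q a b = 0 <-> exists e, pi q a e = b)
  (im_de : forall q a z, exists b, de q a b = z)
  (TE0 : forall q a, zero_module (TE q a.+1)).

Let bd a q := image_mod (al q a \o pi q a : {linear TE q a -> TZ q a}).

Definition coh_D (a : nat) (q : int) : lmodType A := quo (bd a q).
Let cl a q : {linear TZ q a -> coh_D a q} := quo_pi (bd a q).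

Let clP a q z : cl a q z = 0 <-> exists e, al q a (pi q a e) = z.
Proof.
rewrite -(image_modP (al q a \o pi q a)) -[z in z \in _]subr0.
split; first by move=> z0; apply/(quo_piP (bd a q)); rewrite raddf0.
by move=> /(quo_piP (bd a q)); rewrite raddf0.
Qed.

Let cl_surj a q d : exists z, cl a q z = d.
Proof. by exists (quo_repr d); apply: quo_reprK. Qed.

Let clS a q z : cl a.+1 q z = 0 -> z = 0.
Proof. by move=> /clP[e <-]; rewrite (TE0 e) !raddf0. Qed.

(** This is [al \o de^-1]. The map [de] is onto, its kernel is [im pi], and [al] sends that kernel
    into the submodule divided out in [coh_D n q]; in degree [n + 1] passing to the class loses
    nothing. *)
Fact coh_i_ex n q : exists i : {linear coh_D n.+1 (q - 1) -> coh_D n q},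
  forall b, i (cl _ _ (de q n b)) = cl _ _ (al q n b).
Proof.
have [|||i iP] := @linear_of_rel _ (coh_D n.+1 (q - 1)) (coh_D n q)
  (fun c c' => exists b, c = cl _ _ (de q n b) /\ c' = cl _ _ (al q n b)).
- move=> a _ _ _ _ [b [-> ->]] [b' [-> ->]].
  by exists (a *: b + b'); rewrite !linearP.
- move=> c; have [z <-] := cl_surj c; have [b <-] := im_de z.
  by exists (cl n q (al q n b)), b.
- move=> _ [b [/esym/clS/ker_de[e <-] ->]].
  by apply/clP; exists e.
by exists i => b; apply/iP; exists b.
Qed.

Fact coh_j_zero n q z : z \in smem (bd n q) -> be q n z = 0.
Proof. by move=> /image_modP[e <-]; apply/ker_be; exists (pi q n e). Qed.

Variable n0 : int.
Hypotheses (TH0 : forall q a, q < 0 -> zero_module (TH q a))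
  (TZ0 : forall q a, q < n0 -> zero_module (TZ q a)).

Lemma delta_cohomology_spectral_sequence : exists S : spectral_sequence A 1,
  [/\ first_quadrant S, forall p q : nat, isomorphic (S 2%N p q) (TH q p)
    & cohomology_converges S (coh_D 0)].
Proof.
pose i n q := projT1 (cid (coh_i_ex n q)).
have iE n q b : i n q (cl _ _ (de q n b)) = cl _ _ (al q n b).
  by rewrite /i; case: cid.
pose j n q : {linear coh_D n q -> TH q n} := quo_lift (@coh_j_zero n q).
have jE n q z : j n q (cl _ _ z) = be q n z by apply: quo_lift_pi.
(* The composite of the two connecting maps [T^n H^q -> T^(n+1) B^q -> T^(n+2) Z^(q-1)]. *)
pose k n q : {linear TH q n -> coh_D n.+2 (q - 1)} :=
  cl n.+2 (q - 1) \o (de q n.+1 \o ga q n).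
have D_ex n q (d : coh_D n.+1 (q - 1)) : exists b, d = cl _ _ (de q n b).
  by have [z <-] := cl_surj d; have [b <-] := im_de z; exists b.
apply: (@coh_spectral_sequence A coh_D (fun n q => TH q n) i j k) n0 _ _.
- move=> q d; have [b ->] := D_ex _ _ d; rewrite iE => /clP[e].
  move/eqP; rewrite -subr_eq0 -raddfB => /eqP/ker_al0/eqP; rewrite subr_eq0.
  by move=> /eqP eb; rewrite (iffRL (ker_de b)) ?raddf0//; exists e.
- move=> n q d; have [b ->] := D_ex _ _ d; rewrite iE; split.
    move=> /clP[e]; rewrite (TE0 e) !raddf0 => /esym/ker_al[h <-].
    by exists h.
  move=> [h /eqP]; rewrite -subr_eq0 /k /= -raddfB => /eqP/clS/eqP.
  rewrite -raddfB => /eqP/ker_de[e]; rewrite (TE0 e) raddf0 => /esym/eqP.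
  rewrite subr_eq0 => /eqP <-.
  by rewrite (iffRL (ker_al (ga q n h))) ?raddf0//; exists h.
- move=> n q d; have [z <-] := cl_surj d; rewrite jE ker_be; split.
    by move=> [b <-]; exists (cl _ _ (de q n b)); rewrite iE.
  move=> [d' dz]; have [b db] := D_ex _ _ d'.
  by apply/ker_be; rewrite -jE -dz db iE jE; apply/ker_be; exists b.
- move=> n q h; rewrite /k /=; split.
    move=> /clS/ker_de[e]; rewrite (TE0 e) raddf0 => /esym/ker_ga[z <-].
    by exists (cl _ _ z); rewrite jE.
  move=> [d <-]; have [z <-] := cl_surj d; rewrite jE.
  by rewrite (iffRL (ker_ga (be q n z))) ?raddf0//; exists z.
- by move=> n q; apply: TH0.
- move=> n q qn0 d; have [z <-] := cl_surj d.
  by rewrite (TZ0 qn0 z) raddf0.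
Qed.

End CohomologyOfDeltaFunctor.

(* [TQ q a] and [TH q a] stand for [T_a Q_q] and [T_a H_q], but [TB q a] and [TP q a]
   for [T_a B_(q-1)] and [T_a P_(q-1)]. *)
Section HomologyOfDeltaFunctor.
Variables (A : comPzRingType) (TQ TP TB TH : int -> nat -> lmodType A).
Variables (al : forall q a, {linear TQ q a -> TB q a})
  (be : forall q a, {linear TH q a -> TQ q a})
  (ga : forall q a, {linear TB q a.+1 -> TH q a})
  (pi : forall q a, {linear TB q a -> TP q a})
  (de : forall q a, {linear TQ (q - 1) a.+1 -> TB q a}).
Hypotheses
  (im_al0 : forall q b, exists z, al q 0 z = b)
  (ker_al : forall q a z, al q a z = 0 <-> exists h, be q a h = z)
  (ker_be : forall q a h, be q a h = 0 <-> exists b, ga q a b = h)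
  (ker_ga : forall q a b, ga q a b = 0 <-> exists z, al q a.+1 z = b)
  (ker_pi : forall q a b, pi q a b = 0 <-> exists z, de q a z = b)
  (ker_de : forall q a z, de q a z = 0 -> z = 0)
  (TP0 : forall q a, zero_module (TP q a.+1)).

Let cy a q := kernel_mod (pi q a \o al q a : {linear TQ q a -> TP q a}).

Definition hom_D (a : nat) (q : int) : lmodType A := sub_of (cy a q).

Let cyP a q z : z \in smem (cy a q) <-> pi q a (al q a z) = 0.
Proof. exact: (kernel_modP (pi q a \o al q a)). Qed.

Let D_ex a q z : pi q a (al q a z) = 0 -> exists d : hom_D a q, val d = z.
Proof. by move=> /cyP zc; exists (SubOf zc). Qed.

Let D_in a q (d : hom_D a q) : pi q a (al q a (val d)) = 0.
Proof. exact/cyP/valP. Qed.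

Let val_hom a q := (val : {linear hom_D a q -> TQ q a}).

(** This is [de^-1 \o al]. On [hom_D] the values of [al] lie in [ker pi = im de]; the preimage is
    unique as [de] is injective, and it belongs to the next [hom_D] because [TP] vanishes in
    positive degree. *)
Fact hom_i_ex n q : exists i : {linear hom_D n q -> hom_D n.+1 (q - 1)},
  forall d, de q n (val (i d)) = al q n (val d).
Proof.
have [|||i iP] := @linear_of_rel _ (hom_D n q) (hom_D n.+1 (q - 1))
  (fun d d' => al q n (val d) = de q n (val d')).
- by move=> a d e d' e' de1 de2; rewrite !linearP de1 de2.
- move=> d; have /ker_pi[z zd] := D_in d.
  have [|d' d'z] := @D_ex n.+1 (q - 1) z; first exact: TP0.
  by exists d'; rewrite d'z.
- move=> d; rewrite !raddf0 => /esym/ker_de d0.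
  by apply: val_inj; rewrite d0 raddf0.
by exists i => d; apply/esym/iP.
Qed.

Fact hom_k_ex n q : exists k : {linear TH q n -> hom_D n q},
  forall h, val (k h) = be q n h.
Proof.
have [|||k kP] := @linear_of_rel _ (TH q n) (hom_D n q)
  (fun h d => val d = be q n h).
- by move=> a h d h' d' hd hd'; rewrite linearP -hd -hd'; apply: (linearP (val_hom n q)).
- move=> h; apply: D_ex; rewrite (iffRL (ker_al (be q n h))) ?raddf0//.
  by exists h.
- by move=> d; rewrite raddf0 => d0; apply: val_inj; rewrite d0 raddf0.
by exists k => h; apply/kP.
Qed.

Variable n0 : int.
Hypotheses (TH0 : forall q a, q < 0 -> zero_module (TH q a))
  (TQ0 : forall q a, q < n0 -> zero_module (TQ q a)).

Lemma delta_homology_spectral_sequence : exists S : spectral_sequence A (-1),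
  [/\ first_quadrant S, forall p q : nat, isomorphic (S 2%N p q) (TH q p)
    & homology_converges S (hom_D 0)].
Proof.
pose i n q := projT1 (cid (hom_i_ex n q)).
have iE n q d : de q n (val (i n q d)) = al q n (val d) by rewrite /i; case: cid.
pose k n q := projT1 (cid (hom_k_ex n q)).
have kE n q h : val (k n q h) = be q n h by rewrite /k; case: cid.
pose j n q : {linear hom_D n.+2 (q - 1) -> TH q n} :=
  ga q n \o (de q n.+1 \o val_hom n.+2 (q - 1)).
apply: (@hom_spectral_sequence A hom_D (fun n q => TH q n) i k j) n0 _ _.
- move=> q d; have [z zd] := im_al0 (de q 0 (val d)).
  have [|d' d'z] := @D_ex 0 q z.
    by rewrite zd; apply/ker_pi; exists (val d).
  exists d'; apply: val_inj; apply/eqP; rewrite -subr_eq0; apply/eqP.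
  by apply: (ker_de (q := q)); rewrite raddfB/= iE d'z zd subrr.
- move=> n q d; split.
    move=> d0; have := iE _ _ d; rewrite d0 !raddf0 => /esym/ker_al[h hd].
    by exists h; apply: val_inj; rewrite kE.
  move=> [h <-]; apply: val_inj; apply: (ker_de (q := q)).
  by rewrite iE kE; apply/ker_al; exists h.
- move=> n q d; rewrite /j /= ker_ga; split=> [[z zd]|[d' <-]].
    have [|d' d'z] := @D_ex n.+1 q z; first exact: TP0.
    exists d'; apply: val_inj; apply/eqP; rewrite -subr_eq0; apply/eqP.
    by apply: (ker_de (q := q)); rewrite raddfB/= iE d'z zd subrr.
  by exists (val d'); rewrite iE.
- move=> n q h; split=> [h0|[d <-]].
    have /ker_be[b <-] : be q n h = 0 by rewrite -kE h0 raddf0.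
    have /ker_pi[z <-] : pi q n.+1 b = 0 by apply: TP0.
    have [|d dz] := @D_ex n.+2 (q - 1) z; first exact: TP0.
    by exists d; rewrite /j /= dz.
  by apply: val_inj; rewrite kE [RHS]raddf0; apply/ker_be; exists (de q n.+1 (val d)).
- by move=> n q; apply: TH0.
- by move=> n q qn0 d; apply: val_inj; apply: TQ0.
Qed.

End HomologyOfDeltaFunctor.

(** * Long exact sequences *)

Section Homology.
Variable A : comPzRingType.

Definition exact_at (U V W : lmodType A) (f : {linear U -> V}) (g : {linear V -> W}) :=
  forall x, g x = 0 <-> exists y, f y = x.

Definition short_exact (U V W : lmodType A) (f : {linear U -> V}) (g : {linear V -> W}) :=
  [/\ forall x, f x = 0 -> x = 0, exact_at f g & forall z, exists y, g y = z].

Section Representatives.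
Variables (U V W : lmodType A) (f : {linear U -> V}) (g : {linear V -> W}).

Definition hrep (x : V) (c : homology f g) : Prop := rep x c.

Lemma hrep_ex c : exists2 x, g x = 0 & hrep x c.
Proof. by have [x xc] := rep_ex c; exists x => //; have /kernel_modP := rep_mem xc. Qed.

Lemma hrep_tot x : g x = 0 -> exists c, hrep x c.
Proof. by move=> gx; apply: rep_tot; apply/kernel_modP. Qed.

Lemma hrep_cycle x c : hrep x c -> g x = 0.
Proof. by move=> /rep_mem/kernel_modP. Qed.

Lemma hrep_eq0 x c : hrep x c -> c = 0 <-> exists u, f u = x.
Proof. by move=> xc; rewrite (rep_eq0 xc) image_modP. Qed.

Lemma hrep_fun x c c' : hrep x c -> hrep x c' -> c = c'.
Proof. exact: rep_fun. Qed.

Lemma hrep_eq x c x' c' : hrep x c -> hrep x' c' -> c = c' <-> exists u, f u = x - x'.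
Proof. by move=> xc xc'; rewrite (rep_eq xc xc') image_modP. Qed.

Lemma hrep_lin : linear_rel hrep.
Proof. exact: rep_linear. Qed.

End Representatives.

Definition induced (U V W : lmodType A) (f : {linear U -> V}) (g : {linear V -> W})
    (U' V' W' : lmodType A) (f' : {linear U' -> V'}) (g' : {linear V' -> W'})
    (v : V -> V') (h : homology f g -> homology f' g') : Prop :=
  forall x c, hrep x c -> hrep (v x) (h c).

Lemma induced_ex (U V W : lmodType A) (f : {linear U -> V}) (g : {linear V -> W})
    (U' V' W' : lmodType A) (f' : {linear U' -> V'}) (g' : {linear V' -> W'})
    (u : {linear U -> U'}) (v : {linear V -> V'}) (w : {linear W -> W'}) :
    (forall x, v (f x) = f' (u x)) -> (forall x, w (g x) = g' (v x)) ->
  exists h : {linear homology f g -> homology f' g'}, induced v h.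
Proof.
move=> vf wg.
have [|||h hP] := @linear_of_rel _ (homology f g) (homology f' g')
  (fun c c' => exists2 x, hrep x c & hrep (v x) c').
- move=> a c c' d d' [x xc xc'] [y yd yd']; exists (a *: x + y); first exact: hrep_lin.
  by rewrite linearP; apply: hrep_lin.
- move=> c; have [x gx xc] := hrep_ex c.
  have [|c' xc'] := @hrep_tot _ _ _ f' g' (v x); first by rewrite -wg gx raddf0.
  by exists c', x.
- move=> c' [x /(fun h => iffLR (hrep_eq0 h) erefl)[y <-] xc'].
  by apply/(hrep_eq0 xc'); exists (u y); rewrite vf.
exists h => x c xc; have [|c' xc'] := @hrep_tot _ _ _ f' g' (v x).
  by rewrite -wg (hrep_cycle xc) raddf0.
by have -> : h c = c' by apply/hP; exists x.
Qed.

Section Snake.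
Variables (U' V' W' X' U V W X U'' V'' W'' : lmodType A).
Variables (f' : {linear U' -> V'}) (g' : {linear V' -> W'}) (h' : {linear W' -> X'}).
Variables (f : {linear U -> V}) (g : {linear V -> W}) (h : {linear W -> X}).
Variables (f'' : {linear U'' -> V''}) (g'' : {linear V'' -> W''}).
Variables (aV : {linear V' -> V}) (aW : {linear W' -> W}) (aX : {linear X' -> X}).
Variables (bU : {linear U -> U''}) (bV : {linear V -> V''}) (bW : {linear W -> W''}).
Hypotheses (gf : forall x, g (f x) = 0) (hg : forall x, h (g x) = 0).
Hypotheses (ga : forall x, g (aV x) = aW (g' x)) (ha : forall x, h (aW x) = aX (h' x)).
Hypotheses (bf : forall x, bV (f x) = f'' (bU x)) (bg : forall x, bW (g x) = g'' (bV x)).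
Hypotheses (surjU : forall x, exists y, bU y = x) (exV : short_exact aV bV)
  (exW : short_exact aW bW) (injX : forall x, aX x = 0 -> x = 0).

(** If the image of a cycle [y] is a boundary [f'' u''], lift [u''] to [u]: then [y - f u]
    represents the same class and comes from the subcomplex. *)
Lemma induced_exact (hA : {linear homology f' g' -> homology f g})
    (hB : {linear homology f g -> homology f'' g''}) :
  induced aV hA -> induced bV hB -> exact_at hA hB.
Proof.
have [injV exaV surjV] := exV; have [injW exaW _] := exW.
move=> iA iB c; split=> [Bc|[c' <-]]; last first.
  have [x gx xc'] := hrep_ex c'; apply/(hrep_eq0 (iB _ _ (iA _ _ xc'))).
  by exists 0; rewrite raddf0; apply/esym/exaV; exists x.
have [y gy yc] := hrep_ex c; have [u'' fu''] := iffLR (hrep_eq0 (iB _ _ yc)) Bc.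
have [u uu''] := surjU u''.
have /exaV[x' x'E] : bV (y - f u) = 0 by rewrite raddfB/= bf uu'' fu'' subrr.
have [|c' xc'] := @hrep_tot _ _ _ f' g' x'.
  by apply: injW; rewrite -ga x'E raddfB/= gy gf subrr.
exists c'; apply/(hrep_eq (iA _ _ xc') yc); exists (- u).
by rewrite x'E addrAC subrr add0r raddfN.
Qed.

(** The usual zigzag: lift along [bV], apply [g], pull back along [aW]. With all choices gathered in
    one relation, independence of them becomes the single check at zero. *)
Lemma connecting_ex (hB : {linear homology f g -> homology f'' g''})
    (hA : {linear homology g' h' -> homology g h}) :
    induced bV hB -> induced aW hA ->
  exists delta : {linear homology f'' g'' -> homology g' h'},
    exact_at hB delta /\ exact_at delta hA.
Proof.
have [injV exaV surjV] := exV; have [injW exaW _] := exW.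
move=> iB iA.
pose R (c'' : homology f'' g'') (c' : homology g' h') := exists y x',
  [/\ hrep (bV y) c'', aW x' = g y & hrep x' c'].
have [|||D DP] := @linear_of_rel _ _ _ R.
- move=> a c d c' d' [y [x [yc xy xd]]] [y' [x' [yc' xy' xd']]].
  exists (a *: y + y'), (a *: x + x').
  by rewrite !linearP xy xy'; split=> //; apply: hrep_lin.
- move=> c''; have [z gz zc] := hrep_ex c''; have [y yz] := surjV z.
  have /exaW[x' x'y] : bW (g y) = 0 by rewrite bg yz gz.
  have [|c' xc'] := @hrep_tot _ _ _ g' h' x'.
    by apply: injX; rewrite -ha x'y hg.
  by exists c', y, x'; rewrite yz.
- move=> c' [y [x' [y0 xy xc']]]; apply/(hrep_eq0 xc').
  have [u'' fu''] := iffLR (hrep_eq0 y0) erefl; have [u uu''] := surjU u''.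
  have /exaV[v v'E] : bV (y - f u) = 0 by rewrite raddfB/= bf uu'' fu'' subrr.
  exists v; apply/eqP; rewrite -subr_eq0; apply/eqP/injW.
  by rewrite raddfB/= -ga v'E raddfB/= gf subr0 xy subrr.
exists D; split=> [c''|c'].
  split=> [/DP[y [x' [yc xy x0]]]|[c <-]]; last first.
    have [y gy yc] := hrep_ex c; apply/DP; exists y, 0; split; first exact: iB.
      by rewrite gy raddf0.
    by apply: rep0.
  have [v vx] := iffLR (hrep_eq0 x0) erefl.
  have [|c cE] := @hrep_tot _ _ _ f g (y - aV v).
    by rewrite raddfB/= ga vx xy subrr.
  exists c; apply: (hrep_fun (x := bV y)) => //; have := iB _ _ cE.
  by rewrite raddfB/= (iffRL (exaV (aV v))) ?subr0//; exists v.
split=> [Ac|[c'' /DP[y [x' [yc xy xc']]]]].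
  have [x' hx xc'] := hrep_ex c'.
  have [y yx] := iffLR (hrep_eq0 (iA _ _ xc')) Ac.
  have [|c'' yc] := @hrep_tot _ _ _ f'' g'' (bV y).
    by rewrite -bg yx; apply/exaW; exists x'.
  by exists c''; apply/DP; exists y, x'.
by apply/(hrep_eq0 (iA _ _ xc')); exists y.
Qed.

End Snake.
End Homology.

Section CochainComplexes.
Variable A : comPzRingType.

Section Cohomology.
Variables (C : nat -> lmodType A) (d : forall n, {linear C n -> C n.+1}).

(** In degree [0] this is the zero endomorphism of [C 0], since [0.-1] is [0]. This is the shape of
    [Ext 0], so that [coh] turns into [Ext] by computation. *)
Definition coh_prev n : {linear C n.-1 -> C n} :=
  match n with 0 => \0 | n'.+1 => d n' end.

Definition coh n : lmodType A := homology (coh_prev n) (d n).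

End Cohomology.

Variables (C' C C'' : nat -> lmodType A).
Variables (d' : forall n, {linear C' n -> C' n.+1}).
Variables (d : forall n, {linear C n -> C n.+1}).
Variables (d'' : forall n, {linear C'' n -> C'' n.+1}).
Variables (f : forall n, {linear C' n -> C n}) (g : forall n, {linear C n -> C'' n}).
(** The maps are data because they become maps of the exact couple. The fields [cles_ind_a] and
    [cles_ind_b] allow the abutment to be computed on representatives; the connecting maps are known
    through exactness. *)
Record coh_les := CohLes {
  cles_a : forall n, {linear coh d' n -> coh d n};
  cles_b : forall n, {linear coh d n -> coh d'' n};
  cles_c : forall n, {linear coh d'' n -> coh d' n.+1};
  cles_ind_a : forall n, induced (f n) (cles_a n);
  cles_ind_b : forall n, induced (g n) (cles_b n);
  cles_inj : forall x, cles_a 0 x = 0 -> x = 0;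
  cles_ab : forall n, exact_at (cles_a n) (cles_b n);
  cles_bc : forall n, exact_at (cles_b n) (cles_c n);
  cles_ca : forall n, exact_at (cles_c n) (cles_a n.+1) }.

Hypotheses (dd : forall n x, d n.+1 (d n x) = 0)
  (df : forall n x, d n (f n x) = f n.+1 (d' n x))
  (dg : forall n x, d'' n (g n x) = g n.+1 (d n x))
  (exfg : forall n, short_exact (f n) (g n)).

Lemma coh_les_ex : coh_les.
Proof.
have surjg n z : exists y, g n y = z by case: (exfg n).
have injf n x : f n x = 0 -> x = 0 by case: (exfg n) => h _ _; apply: h.
have pf n x : f n (coh_prev d' n x) = coh_prev d n (f n.-1 x).
  by case: n x => [|n] x /=; rewrite ?raddf0 ?df.
have pg n x : g n (coh_prev d n x) = coh_prev d'' n (g n.-1 x).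
  by case: n x => [|n] x /=; rewrite ?raddf0 ?dg.
have dp n x : d n (coh_prev d n x) = 0 by case: n x => [|n] x /=; rewrite ?raddf0 ?dd.
have a_ex n : exists a : {linear coh d' n -> coh d n}, induced (f n) a.
  by apply: (induced_ex (u := f n.-1) (w := f n.+1)).
have b_ex n : exists b : {linear coh d n -> coh d'' n}, induced (g n) b.
  by apply: (induced_ex (u := g n.-1) (w := g n.+1)).
pose a n := projT1 (cid (a_ex n)); have aP n : induced (f n) (a n) := projT2 (cid (a_ex n)).
pose b n := projT1 (cid (b_ex n)); have bP n : induced (g n) (b n) := projT2 (cid (b_ex n)).
have c_ex n : exists c : {linear coh d'' n -> coh d' n.+1},
    exact_at (b n) c /\ exact_at c (a n.+1).
  apply: (connecting_ex (bU := g n.-1) (aV := f n) (bW := g n.+1) (aX := f n.+2)) (bP n) (aP n.+1) => //.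
  exact: injf.
pose c n := projT1 (cid (c_ex n)).
apply: (@CohLes a b c aP bP).
- move=> x ax; have [y dy yx] := hrep_ex x; apply/(hrep_eq0 yx).
  have [z] := iffLR (hrep_eq0 (aP _ _ _ yx)) ax.
  by move=> /= /esym/injf ->; exists 0.
- move=> n.
  by apply: (induced_exact (bU := g n.-1) (aW := f n.+1) (bW := g n.+1)) (aP n) (bP n).
- by move=> n; rewrite /c; case: cid => ? [].
- by move=> n; rewrite /c; case: cid => ? [].
Qed.

End CochainComplexes.

Section ChainComplexes.
Variable A : comPzRingType.

Section NatHomology.
Variables (C : nat -> lmodType A) (d : forall n, {linear C n.+1 -> C n}).

Definition hom_next n : {linear C n -> C n.-1} :=
  match n with 0 => \0 | n'.+1 => d n' end.

Definition nhom n : lmodType A := homology (d n) (hom_next n).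

End NatHomology.

Variables (C' C C'' : nat -> lmodType A).
Variables (d' : forall n, {linear C' n.+1 -> C' n}).
Variables (d : forall n, {linear C n.+1 -> C n}).
Variables (d'' : forall n, {linear C'' n.+1 -> C'' n}).
Variables (f : forall n, {linear C' n -> C n}) (g : forall n, {linear C n -> C'' n}).
Record hom_les := HomLes {
  hles_a : forall n, {linear nhom d' n -> nhom d n};
  hles_b : forall n, {linear nhom d n -> nhom d'' n};
  hles_c : forall n, {linear nhom d'' n.+1 -> nhom d' n};
  hles_ind_a : forall n, induced (f n) (hles_a n);
  hles_ind_b : forall n, induced (g n) (hles_b n);
  hles_surj : forall z, exists y, hles_b 0 y = z;
  hles_ab : forall n, exact_at (hles_a n) (hles_b n);
  hles_bc : forall n, exact_at (hles_b n.+1) (hles_c n);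
  hles_ca : forall n, exact_at (hles_c n) (hles_a n) }.

Hypotheses (dd : forall n x, d n (d n.+1 x) = 0)
  (df : forall n x, d n (f n.+1 x) = f n (d' n x))
  (dg : forall n x, d'' n (g n.+1 x) = g n (d n x))
  (exfg : forall n, short_exact (f n) (g n)).

Lemma hom_les_ex : hom_les.
Proof.
have surjg n z : exists y, g n y = z by case: (exfg n).
have injf n x : f n x = 0 -> x = 0 by case: (exfg n) => h _ _; apply: h.
have pf n x : f n.-1 (hom_next d' n x) = hom_next d n (f n x).
  by case: n x => [|n] x /=; rewrite ?raddf0 ?df.
have pg n x : g n.-1 (hom_next d n x) = hom_next d'' n (g n x).
  by case: n x => [|n] x /=; rewrite ?raddf0 ?dg.
have dp n x : hom_next d n (d n x) = 0 by case: n x => [|n] x /=; rewrite ?raddf0 ?dd.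
have a_ex n : exists a : {linear nhom d' n -> nhom d n}, induced (f n) a.
  by apply: (induced_ex (u := f n.+1) (w := f n.-1)).
have b_ex n : exists b : {linear nhom d n -> nhom d'' n}, induced (g n) b.
  by apply: (induced_ex (u := g n.+1) (w := g n.-1)).
pose a n := projT1 (cid (a_ex n)); have aP n : induced (f n) (a n) := projT2 (cid (a_ex n)).
pose b n := projT1 (cid (b_ex n)); have bP n : induced (g n) (b n) := projT2 (cid (b_ex n)).
have c_ex n : exists c : {linear nhom d'' n.+1 -> nhom d' n},
    exact_at (b n.+1) c /\ exact_at c (a n).
  apply: (connecting_ex (bU := g n.+2) (aV := f n.+1) (bW := g n) (aX := f n.-1)) (bP n.+1) (aP n) => //.
  exact: injf.
pose c n := projT1 (cid (c_ex n)).
apply: (@HomLes a b c aP bP).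
- move=> z; have [z1 _ z1z] := hrep_ex z; have [y yz] := surjg 0%N z1.
  have [|t yt] := @hrep_tot _ _ _ _ (d 0) (hom_next d 0) y; first by [].
  by exists t; apply: (hrep_fun _ z1z); rewrite -yz; apply: bP.
- move=> n.
  by apply: (induced_exact (bU := g n.+1) (aW := f n.-1) (bW := g n.-1)) (aP n) (bP n).
- by move=> n; rewrite /c; case: cid => ? [].
- by move=> n; rewrite /c; case: cid => ? [].
Qed.

End ChainComplexes.

(** * Projective resolutions *)

Section LinearMaps.
Variable A : comPzRingType.
Implicit Types U V W : lmodType A.

Lemma factor_ex U V W (g : {linear U -> V}) (f : {linear U -> W}) :
    (forall y, exists x, g x = y) -> (forall x, g x = 0 -> f x = 0) ->
  exists h : {linear V -> W}, forall x, h (g x) = f x.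
Proof.
move=> surj ker.
have [|||h hP] := @linear_of_rel _ V W (fun y z => exists2 x, g x = y & f x = z).
- move=> a _ _ _ _ [x <- <-] [x' <- <-].
  by exists (a *: x + x'); rewrite linearP.
- by move=> y; have [x <-] := surj y; exists (f x), x.
- by move=> _ [x /ker fx <-].
by exists h => x; apply/hP; exists x.
Qed.

Lemma corestrict_ex U V (S : submod V) (f : {linear U -> V}) :
    (forall x, f x \in smem S) ->
  exists h : {linear U -> sub_of S}, forall x, val (h x) = f x.
Proof.
move=> fS.
have [|||h hP] := @linear_of_rel _ U (sub_of S) (fun x y => val y = f x).
- move=> a x y x' y' xy xy'; rewrite linearP -xy -xy'.
  exact: (linearP (val : {linear sub_of S -> V})).
- by move=> x; exists (SubOf (fS x)).
- by move=> y; rewrite raddf0 => y0; apply: val_inj; rewrite y0 raddf0.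
by exists h => x; apply/hP.
Qed.

Definition hom_lin U V (h : hom U V) : {linear U -> V} :=
  HB.pack (val h) (GRing.isLinear.Build A U V *:%R (val h) (hom_linear h)).

Fact lin_hom_subproof U V (f : {linear U -> V}) : (f : U -> V) \in smem (homs U V).
Proof. by rewrite inE => a x y; rewrite linearP. Qed.
Definition lin_hom U V (f : {linear U -> V}) : hom U V := SubOf (lin_hom_subproof f).

Lemma hom_ext U V (h h' : hom U V) : (forall x, val h x = val h' x) -> h = h'.
Proof. by move=> hh; apply: val_inj; apply/funext. Qed.

Lemma hom_linP U V a (h h' : hom U V) x :
  val (a *: h + h') x = a *: val h x + val h' x.
Proof. by []. Qed.

Lemma sub_valP V (S : submod V) a (x y : sub_of S) :
  val (a *: x + y) = a *: val x + val y.
Proof. exact: (linearP (val : {linear sub_of S -> V})). Qed.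

Lemma hom_zeroP U V (h : hom U V) : h = 0 <-> forall x, val h x = 0.
Proof.
split=> [->//|h0]; exact: hom_ext.
Qed.

Lemma hom_post_short_exact P V' V V'' (f : {linear V' -> V}) (g : {linear V -> V''}) :
    projective_module P -> short_exact f g ->
  short_exact (hom_post (N := P) f) (hom_post (N := P) g).
Proof.
move=> projP [injf exfg surjg]; split.
- move=> h /hom_zeroP h0; apply/hom_zeroP => x.
  exact: injf (h0 x).
- move=> h; split=> [/hom_zeroP h0|[h' <-]]; last first.
    by apply/hom_zeroP => x; apply/exfg; exists (val h' x).
  have [|h' h'E] := @corestrict_ex P V (image_mod f) (hom_lin h).
    by move=> x; apply/image_modP/exfg/h0.
  have [|f' f'E] := @corestrict_ex V' V (image_mod f) f.
    by move=> x; apply/image_modP; exists x.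
  have [|k kE] := projP _ _ f' h'.
    move=> w; have /image_modP[x xw] := valP w.
    by exists x; apply: val_inj; rewrite f'E.
  exists (lin_hom k); apply: hom_ext => x.
  by rewrite /= -f'E kE h'E.
- move=> h; have [k kE] := projP _ _ g (hom_lin h) surjg.
  by exists (lin_hom k); apply: hom_ext.
Qed.

Lemma hom_pre_short_exact U' U U'' L (f : {linear U' -> U}) (g : {linear U -> U''}) :
    projective_module U'' -> short_exact f g ->
  short_exact (hom_pre (L := L) g) (hom_pre (L := L) f).
Proof.
move=> projU [injf exfg surjg]; split.
- move=> h /hom_zeroP h0; apply/hom_zeroP => x.
  by have [y <-] := surjg x; apply: h0.
- move=> h; split=> [/hom_zeroP h0|[h' <-]]; last first.
    apply/hom_zeroP => x /=; rewrite (iffRL (exfg (f x))) ?hom0//.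
    by exists x.
  have [|h' h'E] := factor_ex (f := hom_lin h) surjg.
    by move=> x /exfg[y <-]; apply: h0.
  by exists (lin_hom h'); apply: hom_ext => x; apply: h'E.
(* A section [s] of [g] splits the sequence: [x - s (g x)] lies in the image of [f], and applying
   [h] to its preimage extends [h]. *)
- move=> h; have [s sE] := projU _ _ g idfun surjg.
  have [|r rE] := @corestrict_ex U U (image_mod f) (idfun \- (s \o g)).
    by move=> x; apply/image_modP/exfg; rewrite /= raddfB/= sE subrr.
  have [|f' f'E] := @corestrict_ex U' U (image_mod f) f.
    by move=> x; apply/image_modP; exists x.
  have [||k kE] := @factor_ex U' (sub_of (image_mod f)) L f' (hom_lin h).
  - move=> w; have /image_modP[x xw] := valP w.
    by exists x; apply: val_inj; rewrite f'E.
  - move=> x fx; have -> : x = 0; last exact: raddf0.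
    by apply: injf; rewrite -f'E fx raddf0.
  exists (lin_hom (k \o r)); apply: hom_ext => x.
  rewrite -[RHS]/(hom_lin h x) -kE; congr (k _); apply: val_inj.
  have gf : g (f x) = 0 by apply/exfg; exists x.
  by rewrite rE f'E /= gf raddf0 subr0.
Qed.

End LinearMaps.

Section FreeModules.
Variables (A : comPzRingType) (T : choiceType).

Lemma free_lift_id (x : free_mod A T) : free_lift (@free_basis A T) x = x.
Proof.
pose D := [set t | val x t != 0]%classic.
have fD : finite_set D by have := valP x; rewrite inE.
rewrite (free_liftE _ fD)//; apply: val_inj; apply/funext => s.
have -> (r : seq T) :
    val (\sum_(t <- r) (val x t : A) *: (free_basis A t : (free_mod A T : lmodType A))) s =
    \sum_(t <- r) (val x t : A) * (s == t)%:R.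
  by elim: r => [|t r IHr]; rewrite ?big_nil// !big_cons -IHr.
have [Ds|nDs] := eqVneq (val x s) 0.
  rewrite Ds big1// => t _; case: (eqVneq s t) => [<-|]; last by rewrite mulr0.
  by rewrite Ds mul0r.
have sD : s \in fset_set D by rewrite in_fset_set// inE.
rewrite (big_fsetD1 s sD) /= eqxx mulr1 big1_seq ?addr0// => t.
rewrite !inE => /andP[_ /andP[ts _]]; rewrite eq_sym (negPf ts).
by rewrite mulr0.
Qed.

Lemma free_ext (V : lmodType A) (f g : {linear free_mod A T -> V}) :
  (forall t, f (free_basis A t) = g (free_basis A t)) -> forall x, f x = g x.
Proof.
move=> fg x; rewrite -(free_lift_id x) /free_lift.
pose D := [set t | val x t != 0]%classic.
have fD : finite_set D by have := valP x; rewrite inE.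
have := free_liftE (@free_basis A T) fD (f := x) (fun t h => h).
rewrite /free_lift => ->; rewrite !raddf_sum; apply: eq_bigr => t _.
by rewrite [LHS]linearZ_LR [RHS]linearZ_LR fg.
Qed.

Lemma free_projective : projective_module (free_mod A T).
Proof.
move=> V W g f surj.
have [h hE] := choice (fun t => surj (f (free_basis A t))).
exists (free_lift h); apply: (@free_ext _ (g \o free_lift h)) => t.
by rewrite /= free_lift_basis hE.
Qed.

End FreeModules.

(** Kept general because the horseshoe lemma produces resolutions other than the functorial free one
    behind [Ext]. *)
Record resolution (A : comPzRingType) (X : lmodType A) := Resolution {
  rs :> nat -> lmodType A;
  rs_d : forall n, {linear rs n.+1 -> rs n};
  rs_e : {linear rs 0 -> X};
  rs_proj : forall n, projective_module (rs n);
  rs_surj : forall x, exists y, rs_e y = x;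
  rs_exact0 : exact_at (rs_d 0) rs_e;
  rs_exact : forall n, exact_at (rs_d n.+1) (rs_d n) }.
Arguments rs_proj {A X} r n.

Section Resolutions.
Variables (A : comPzRingType) (X : lmodType A).

Lemma rs_ed (R : resolution X) x : rs_e R (rs_d R 0 x) = 0.
Proof. by apply/rs_exact0; exists x. Qed.

Lemma rs_dd (R : resolution X) n x : rs_d R n (rs_d R n.+1 x) = 0.
Proof. by apply/rs_exact; exists x. Qed.

Lemma free_eps_surj (Y : lmodType A) (y : Y) : exists x, free_eps Y x = y.
Proof. by exists (free_basis A y); apply: free_lift_basis. Qed.

Fact free_res_exact0 : exact_at (free_res_d X 0) (free_eps X).
Proof.
move=> x; split=> [/kernel_modP x0|[y <-]].
  have [y yE] := free_eps_surj (SubOf x0 : syzygy X 1).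
  by exists y; rewrite /free_res_d /= yE.
by apply/kernel_modP; apply: valP (free_eps (syzygy X 1) y).
Qed.

Fact free_res_exact n : exact_at (free_res_d X n.+1) (free_res_d X n).
Proof.
move=> x; split=> [x0|[y <-]].
  have /kernel_modP x1 : free_eps (syzygy X n.+1) x = 0.
    by apply: val_inj; rewrite [RHS]raddf0.
  have [y yE] := free_eps_surj (SubOf x1 : syzygy X n.+2).
  by exists y; rewrite /free_res_d /= yE.
rewrite /free_res_d /=; set z := free_eps _ y.
have /kernel_modP : val z \in smem (kernel_mod (free_eps (syzygy X n.+1))) := valP z.
by move=> ->.
Qed.

Definition free_resolution : resolution X :=
  Resolution (fun n => @free_projective A (syzygy X n)) (@free_eps_surj X)
    free_res_exact0 free_res_exact.

End Resolutions.

(** * The covariant Ext spectral sequence *)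

Section Transport.
Variable A : comPzRingType.

Section MapMod.
Variables (V V' : lmodType A) (f : {linear V -> V'}).

Fact map_mod_closed (S : submod V) :
  submod_closed [pred y : V' | `[< exists2 x, x \in smem S & f x = y >]].
Proof.
split=> [|a z z']; rewrite !inE.
  by exists 0; rewrite ?raddf0 ?rpred0.
move=> [x xS <-] [y yS <-].
by exists (a *: x + y); rewrite ?linearP// rpredD// rpredZ.
Qed.
Definition map_mod S : submod V' := Submod (map_mod_closed S).

Lemma map_modP S y : y \in smem (map_mod S) <-> exists2 x, x \in smem S & f x = y.
Proof. by rewrite inE. Qed.

Hypothesis bijf : bijective f.

Lemma mem_map_mod S x : f x \in smem (map_mod S) <-> x \in smem S.
Proof.
split=> [/map_modP[y yS /(bij_inj bijf) <-]//|xS].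
by apply/map_modP; exists x.
Qed.

Lemma subquo_map_iso S T :
  isomorphic (subquo S T) (subquo (map_mod S) (map_mod T)).
Proof.
apply: (@iso_of_rel _ _ _ (fun c c' => exists2 x, rep x c & rep (f x) c')).
- move=> a c d c' d' [x xc xd] [x' xc' xd']; exists (a *: x + x').
    exact: rep_linear.
  by rewrite linearP; apply: rep_linear.
- move=> c; have [x xc] := rep_ex c.
  have [|c' xc'] := @rep_tot _ _ (map_mod S) (map_mod T) (f x).
    exact/mem_map_mod/(rep_mem xc).
  by exists c', x.
- move=> c'; have [y yc'] := rep_ex c'; have /map_modP[x xS xy] := rep_mem yc'.
  by have [c xc] := rep_tot T xS; exists c, x; rewrite ?xy.
- move=> c' [x x0 xc']; apply/(rep_eq0 xc')/mem_map_mod.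
  exact/(rep_eq0 x0).
- move=> c [x xc x0]; apply/(rep_eq0 xc)/mem_map_mod.
  exact/(rep_eq0 x0).
Qed.

End MapMod.

Lemma cohomology_converges_iso (S : spectral_sequence A 1) (V V' : int -> lmodType A) :
    (forall n, isomorphic (V n) (V' n)) ->
  cohomology_converges S V -> cohomology_converges S V'.
Proof.
move=> isoV [F [Fdec Fall F0 Fgr]].
pose f n := projT1 (cid (isoV n)); have bijf n : bijective (f n) := projT2 (cid (isoV n)).
exists (fun n p => map_mod (f n) (F n p)); split.
- move=> n p y /map_modP[x /Fdec xF <-]; exact/mem_map_mod.
- by move=> n p p0 y; have [g _ gK] := bijf n; rewrite -(gK y); apply/mem_map_mod/Fall.
- by move=> n p np y /map_modP[x /F0 -> // <-]; rewrite raddf0.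
- move=> p q n; apply: isomorphic_trans (Fgr p q) _; exact: subquo_map_iso.
Qed.

Lemma homology_converges_iso (S : spectral_sequence A (-1)) (V V' : int -> lmodType A) :
    (forall n, isomorphic (V n) (V' n)) ->
  homology_converges S V -> homology_converges S V'.
Proof.
move=> isoV [F [Fdec Fall F0 Fgr]].
pose f n := projT1 (cid (isoV n)); have bijf n : bijective (f n) := projT2 (cid (isoV n)).
exists (fun n p => map_mod (f n) (F n p)); split.
- move=> n p y /map_modP[x /Fdec xF <-]; exact/mem_map_mod.
- by move=> n p p0 y; have [g _ gK] := bijf n; rewrite -(gK y); apply/mem_map_mod/Fall.
- by move=> n p np y /map_modP[x /F0 -> // <-]; rewrite raddf0.
- move=> p q n; apply: isomorphic_trans (Fgr p q) _; exact: subquo_map_iso.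
Qed.

(** [H_map f] is a bare function defined by chosen representatives. The linear relation [R] on all
    representatives turns out to be its graph, which supplies the linearity. *)
Lemma quasi_iso_homology e (X Y : complex A e) (f : chain_map X Y) i :
  quasi_iso f -> isomorphic (cx_homology X i) (cx_homology Y i).
Proof.
move=> /(_ i) [g HK gK].
pose R (c : cx_homology X i) (c' : cx_homology Y i) := exists2 x, hrep x c & hrep (f i x) c'.
have RH c : R c (H_map f c).
  rewrite /H_map /subquo_map; set x := quo_repr c.
  exists (val x); last by exists (valP (sub_map (@chain_map_ker _ _ _ _ f i (i + e)) x));
    congr quo_pi; apply: val_inj.
  exists (valP x); rewrite -[LHS](quo_reprK c); congr quo_pi.
  exact: val_inj.
have linR : linear_rel R.
  move=> a c c' d d' [x xc xc'] [y yd yd']; exists (a *: x + y).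
    exact: hrep_lin.
  by rewrite linearP; apply: hrep_lin.
have R0 c' : R 0 c' -> c' = 0.
  move=> [x /(fun h => iffLR (hrep_eq0 h) erefl)[y <-] xc'].
  by apply/(hrep_eq0 xc'); exists (f _ y); rewrite cm_comm.
have RE c c' : R c c' -> c' = H_map f c.
  move=> Rc; apply/eqP; rewrite -subr_eq0; apply/eqP/R0.
  by rewrite -(subrr c); apply: linear_relB.
apply: (iso_of_rel linR) => [c|c'|//|c Rc].
- by exists (H_map f c).
- by exists (g c'); rewrite -{2}(gK c').
- by rewrite -(HK c) -(RE _ _ Rc) (RE _ _ (_ : R 0 0)) ?HK//; exists 0;
    [apply: rep0 | rewrite raddf0; apply: rep0].
Qed.

End Transport.

(** * Long exact sequences and hypercohomology for [Ext] out of a fixed module *)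

Section CovariantExt.
Variables (A : comPzRingType) (N : lmodType A) (R : resolution N).

Definition ext_d (X : lmodType A) n : {linear hom (R n) X -> hom (R n.+1) X} :=
  hom_pre (rs_d R n).

Lemma ext_dd X n x : ext_d X n.+1 (ext_d X n x) = 0.
Proof. by apply: hom_ext => y /=; rewrite rs_dd hom0. Qed.

Lemma ext_les (X' X X'' : lmodType A) (f : {linear X' -> X}) (g : {linear X -> X''}) :
    short_exact f g ->
  coh_les (ext_d X') (ext_d X) (ext_d X'') (fun n => hom_post f) (fun n => hom_post g).
Proof.
move=> fg; apply: coh_les_ex => [n x|n x|n x|n].
- exact: ext_dd.
- exact: hom_ext.
- exact: hom_ext.
- by apply: hom_post_short_exact; first exact: rs_proj.
Qed.

Lemma coh_zero (X : lmodType A) n : zero_module X -> zero_module (coh (ext_d X) n).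
Proof.
move=> X0 c; have [x _ xc] := hrep_ex c; apply/(hrep_eq0 xc); exists 0.
by apply: hom_ext => y; rewrite (X0 (val x y)) (X0 (val _ y)).
Qed.

(** A cocycle factors through the image of the differential, a submodule of [R n], and extends from
    there to [R n] by injectivity. *)
Lemma coh_injective (X : lmodType A) n :
  injective_module X -> zero_module (coh (ext_d X) n.+1).
Proof.
move=> injX c; have [x /hom_zeroP dx xc] := hrep_ex c.
have [|d dE] := @corestrict_ex _ _ _ (image_mod (rs_d R n)) (rs_d R n).
  by move=> y; apply/image_modP; exists y.
have [||phi phiE] := @factor_ex _ _ _ _ d (hom_lin x).
- move=> w; have /image_modP[y yw] := valP w.
  by exists y; apply: val_inj; rewrite dE.
- move=> y dy; have /rs_exact[z <-] : rs_d R n y = 0 by rewrite -dE dy raddf0.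
  exact: dx.
have [|psi psiE] := injX _ _ (val : {linear sub_of (image_mod (rs_d R n)) -> R n}) phi.
  exact: val_inj.
apply/(hrep_eq0 xc); exists (lin_hom psi); apply: hom_ext => y.
by rewrite /= -dE psiE phiE.
Qed.

Section HyperExt.
Variables (E : cochain_complex A) (H : int -> lmodType A) (n0 : int).
Hypotheses (isoH : forall q, isomorphic (cx_homology E q) (H q))
  (injE : forall q, injective_module (E q))
  (E0 : forall q, q < n0 -> zero_module (E q))
  (H0 : forall q, q < 0 -> zero_module (H q)).

(** Quantifying over the target degree keeps [q + 1] out of the definition, so that
    [cocycle (q - 1)] works with the differential into [q] without transport from [q - 1 + 1]. *)
Fact cocycle_closed q :
  submod_closed [pred x : E q | `[< forall j, cx_d E q j x = 0 >]].
Proof.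
split=> [|a x y]; rewrite !inE; first by move=> j; rewrite raddf0.
by move=> x0 y0 j; rewrite linearP x0 y0 scaler0 addr0.
Qed.
Definition cocycle q : submod (E q) := Submod (cocycle_closed q).

Lemma cocycleP q j x : j = q + 1 -> x \in smem (cocycle q) <-> cx_d E q j x = 0.
Proof.
move=> jq; split=> [|dx]; rewrite inE; first by apply.
move=> j'; have [->|ne] := eqVneq j' j; first exact: dx.
by apply: cx_shape; rewrite -jq.
Qed.

Let Z q := sub_of (cocycle q).
Let B q := sub_of (image_mod (cx_d E (q - 1) q)).

(** [H] is a family isomorphic to the cohomology, so that Koszul cohomology can take the place of
    that of its resolution. *)
Lemma cocycle_ses q : exists (f : {linear B q -> Z q}) (g : {linear Z q -> H q}),
  (forall b, val (f b) = val b) /\ short_exact f g.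
Proof.
have [|f fE] := @corestrict_ex _ _ _ (cocycle q)
  (val : {linear B q -> E q}).
  move=> b; have /image_modP[x xb] := valP b.
  by rewrite inE => j; rewrite -[RHS](cx_dd (q - 1) q j x) xb.
have [h hbij] := isoH q.
have [|||g gE] := @linear_of_rel _ (Z q) (H q)
  (fun z w => exists2 c, hrep (val z) c & h c = w).
- move=> a z _ z' _ [c zc <-] [c' zc' <-]; exists (a *: c + c'); last by rewrite linearP.
  exact: hrep_lin.
- move=> z; have [|c zc] := @hrep_tot _ _ _ _ (cx_d E (q - 1) q) (cx_d E q (q + 1)) (val z).
    exact/(cocycleP _ erefl)/valP.
  by exists (h c), c.
- move=> _ [c c0 <-]; have -> : c = 0; last exact: raddf0.
  by apply: (hrep_fun c0); apply: rep0.
exists f, g; split=> //; split.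
- by move=> b fb; apply: val_inj; rewrite -fE fb raddf0.
- move=> z; split=> [/gE[c zc]|[b <-]].
    rewrite -[RHS](raddf0 h) => /(bij_inj hbij) c0.
    have [x xz] := iffLR (hrep_eq0 zc) c0.
    have [|b bE] := @corestrict_ex _ _ _ (image_mod (cx_d E (q - 1) q)) (cx_d E (q - 1) q).
      by move=> y; apply/image_modP; exists y.
    by exists (b x); apply: val_inj; rewrite fE /= bE.
  apply/gE; rewrite fE; exists 0; last exact: raddf0.
  apply: rep0r; last exact: valP.
  by rewrite -fE; apply/kernel_modP/(cocycleP _ erefl)/valP.
- move=> w; have [h' _ hK] := hbij.
  have [x dx xc] := hrep_ex (h' w).
  have zx : x \in smem (cocycle q) by apply/(cocycleP _ erefl).
  by exists (SubOf zx); apply/gE; exists (h' w); rewrite ?hK.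
Qed.

Lemma coboundary_ses q : exists g : {linear E (q - 1) -> B q},
  (forall x, val (g x) = cx_d E (q - 1) q x) /\
  short_exact (val : {linear Z (q - 1) -> E (q - 1)}) g.
Proof.
have [|g gE] := @corestrict_ex _ _ _ (image_mod (cx_d E (q - 1) q)) (cx_d E (q - 1) q).
  by move=> y; apply/image_modP; exists y.
have zP x : x \in smem (cocycle (q - 1)) <-> g x = 0.
  rewrite (cocycleP _ (esym (subrK _ _))) -gE.
  by split=> [gx|->]; [apply: val_inj; rewrite gx raddf0 | exact: raddf0].
exists g; split=> //; split.
- by move=> x x0; apply: val_inj; rewrite x0 raddf0.
- move=> x; split=> [/zP xz|[z <-]]; first by exists (SubOf xz).
  exact/zP/valP.
- move=> b; have /image_modP[x xb] := valP b.
  by exists x; apply: val_inj; rewrite gE.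
Qed.

Lemma hyperext_spectral_sequence : exists S : spectral_sequence A 1,
  [/\ first_quadrant S, forall p q : nat, isomorphic (S 2%N p q) (coh (ext_d (H q)) p)
    & cohomology_converges S (cx_homology (hom_to_complex N E))].
Proof.
pose i q := projT1 (cid (cocycle_ses q)).
pose p q := projT1 (cid (projT2 (cid (cocycle_ses q)))).
have [iE ip] : (forall q b, val (i q b) = val b) /\ forall q, short_exact (i q) (p q).
  by split=> q; have [] := projT2 (cid (projT2 (cid (cocycle_ses q)))).
pose g q := projT1 (cid (coboundary_ses q)).
have [gE vg] : (forall q x, val (g q x) = cx_d E (q - 1) q x) /\
    forall q, short_exact (val : {linear Z (q - 1) -> E (q - 1)}) (g q).
  by split=> q; have [] := projT2 (cid (coboundary_ses q)).
pose L1 q := ext_les (ip q); pose L2 q := ext_les (vg q).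
have TE0 q a : zero_module (coh (ext_d (E (q - 1))) a.+1) by apply: coh_injective.
have [|||||||||S [S1 S2 S3]] := @delta_cohomology_spectral_sequence A
  (fun q => coh (ext_d (Z q))) (fun q => coh (ext_d (E (q - 1))))
  (fun q => coh (ext_d (B q))) (fun q => coh (ext_d (H q)))
  (fun q => cles_a (L1 q)) (fun q => cles_b (L1 q)) (fun q => cles_c (L1 q))
  (fun q => cles_b (L2 q)) (fun q => cles_c (L2 q)) _ _ _ _ _ _ _ n0.
- by move=> q x; apply: cles_inj.
- by move=> q a; apply: (cles_ab (L1 q)).
- by move=> q a; apply: (cles_bc (L1 q)).
- by move=> q a; apply: (cles_ca (L1 q)).
- by move=> q a; apply: (cles_bc (L2 q)).
- by move=> q a z; apply/(cles_ca (L2 q)); apply: TE0.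
- exact: TE0.
- by move=> q a q0; apply: coh_zero; apply: H0.
- move=> q a q0; apply: coh_zero => z; apply: val_inj; exact: E0.
exists S; split=> //; apply: cohomology_converges_iso S3 => q {S S1 S2}.
apply: isomorphic_sym.
pose D := image_mod (cles_a (L1 q) 0 \o cles_b (L2 q) 0 : {linear coh (ext_d (E (q - 1))) 0 -> coh (ext_d (Z q)) 0}).
(* Degree [0] cohomology of [hom R X] is [hom N X], so [quo D] is [hom N (Z q)] modulo the maps that
   lift to [E (q - 1)]: the cohomology of [hom_to_complex N E]. A map [phi : N -> E q] is matched
   with [psi : R 0 -> Z q] when [psi] is [phi] after the augmentation. *)
apply: (@iso_of_rel _ _ (quo D) (fun v c => exists phi t psi,
  [/\ hrep phi v, c = quo_pi D t, hrep psi t & forall x, val (val psi x) = val phi (rs_e R x)])).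
- move=> a v c v' c' [phi [t [psi [h1 -> h2 h3]]]] [phi' [t' [psi' [h1' -> h2' h3']]]].
  exists (a *: phi + phi'), (a *: t + t'), (a *: psi + psi'); split.
  + exact: hrep_lin.
  + by rewrite linearP.
  + exact: hrep_lin.
  + by move=> x; rewrite !hom_linP sub_valP h3 h3'.
- move=> v; have [phi /hom_zeroP dphi phiv] := hrep_ex v.
  have [|psi psiE] := @corestrict_ex _ _ _ (cocycle q) (hom_lin phi \o rs_e R).
    by move=> x; apply/(cocycleP _ erefl); apply: dphi.
  have [|t psit] := @hrep_tot _ _ _ _ (coh_prev (ext_d (Z q)) 0) (ext_d (Z q) 0) (lin_hom psi).
    by apply/hom_zeroP => x; apply: val_inj; rewrite /= psiE /= rs_ed hom0.
  by exists (quo_pi D t), phi, t, (lin_hom psi).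
- move=> c; rewrite -(quo_reprK c); set t := quo_repr c.
  have [psi /hom_zeroP dpsi psit] := hrep_ex t.
  have [||phi phiE] := @factor_ex _ _ _ _ (rs_e R)
    ((val : {linear Z q -> E q}) \o hom_lin psi).
  - exact: rs_surj.
  - move=> x /rs_exact0[y <-] /=.
    by have -> : val psi (rs_d R 0 y) = 0 by apply: dpsi.
  have [|v phiv] := @hrep_tot _ _ _ _ (cx_d (hom_to_complex N E) (q - 1) q)
    (cx_d (hom_to_complex N E) q (q + 1)) (lin_hom phi).
    apply/hom_zeroP => y; have [x <-] := rs_surj R y.
    by rewrite /= phiE; apply/(cocycleP _ erefl)/valP.
  by exists v, (lin_hom phi), t, psi; split=> // x; rewrite /= phiE.
- move=> c [phi [t [psi [phi0 -> psit psiE]]]].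
  have [phi1 phi1E] := iffLR (hrep_eq0 phi0) erefl.
  suff tD : t \in smem D by rewrite -[RHS](raddf0 (quo_pi D)); apply/quo_piP; rewrite subr0.
  have [|t0 t0E] := @hrep_tot _ _ _ _ (coh_prev (ext_d (E (q - 1))) 0)
     (ext_d (E (q - 1)) 0) (lin_hom (hom_lin phi1 \o rs_e R)).
    by apply/hom_zeroP => x; rewrite /= rs_ed hom0.
  apply/image_modP; exists t0; apply: (hrep_fun _ psit).
  have -> : psi = hom_post (i q) (hom_post (g q) (lin_hom (hom_lin phi1 \o rs_e R))).
    apply: hom_ext => x; apply: val_inj; rewrite /= iE gE /= psiE -phi1E //.
  exact/(cles_ind_a (L1 q))/(cles_ind_b (L2 q)).
- move=> v [phi [t [psi [phiv t0 psit psiE]]]].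
  have /image_modP[s sE] : t \in smem D.
    by rewrite -[t]subr0; apply/quo_piP; rewrite -t0 raddf0.
  have [chi /hom_zeroP dchi chis] := hrep_ex s.
  have := cles_ind_a (L1 q) (cles_ind_b (L2 q) chis); rewrite -[cles_a _ _ _]/((cles_a (L1 q) 0 \o cles_b (L2 q) 0) s) sE.
  move=> /(hrep_eq psit) /(iffLR)/(_ erefl)[u /= /esym/eqP].
  rewrite subr_eq0 => /eqP psiE'.
  have [||phi1 phi1E] := @factor_ex _ _ _ _ (rs_e R) (hom_lin chi).
  - exact: rs_surj.
  - by move=> x /rs_exact0[y <-]; apply: dchi.
  apply/(hrep_eq0 phiv); exists (lin_hom phi1); apply: hom_ext => y.
  have [x <-] := rs_surj R y.
  by rewrite -psiE psiE' /= iE gE phi1E.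
Qed.

End HyperExt.
End CovariantExt.

(** * The horseshoe lemma *)

Section Boundaries.
Variables (A : comPzRingType) (P : chain_complex A) (H : int -> lmodType A).
Hypothesis isoH : forall q, isomorphic (cx_homology P q) (H q).

Definition cx_boundaries q : submod (P q) := image_mod (cx_d P (q + 1) q).
Definition cx_coker q : lmodType A := quo (cx_boundaries q).

(** The incoming degree appears as [q - -1] in [cx_homology] and as [q + - -1] in
    [hom_from_complex]; the variable [j] absorbs these forms. *)
Lemma cx_boundariesP j q x : j = q + 1 ->
  x \in smem (cx_boundaries q) <-> exists y, cx_d P j q y = x.
Proof. by move=> ->; apply: image_modP. Qed.

Lemma quo_pi0P (V : lmodType A) (S : submod V) x : quo_pi S x = 0 <-> x \in smem S.
Proof.
rewrite -[x in x \in _]subr0; split=> [x0|/quo_piP ->]; last exact: raddf0.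
by apply/quo_piP; rewrite raddf0.
Qed.

Lemma boundaries_ses q : short_exact
  (val : {linear sub_of (cx_boundaries q) -> P q}) (quo_pi (cx_boundaries q)).
Proof.
split=> [x x0|x|y]; first by apply: val_inj; rewrite x0 raddf0.
  rewrite quo_pi0P; split=> [xB|[b <-]]; last exact: valP.
  by exists (SubOf xB).
by exists (quo_repr y); apply: quo_reprK.
Qed.

(** [g] is the differential factored through the cokernel: its image is all of [B_(q-1)] and its
    kernel is cycles modulo boundaries. *)
Lemma coker_ses q : exists (f : {linear H q -> cx_coker q})
    (g : {linear cx_coker q -> sub_of (cx_boundaries (q - 1))}),
  (forall p, val (g (quo_pi _ p)) = cx_d P q (q - 1) p) /\ short_exact f g.
Proof.
have [|d dE] := @corestrict_ex _ _ _ (cx_boundaries (q - 1)) (cx_d P q (q - 1)).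
  by move=> x; apply/(cx_boundariesP _ (esym (subrK _ _))); exists x.
have [||g gE] := @factor_ex _ _ _ _ (quo_pi (cx_boundaries q)) d.
- by case: (boundaries_ses q).
- move=> x /quo_pi0P/image_modP[y <-]; apply: val_inj.
  by rewrite dE cx_dd raddf0.
have [h hbij] := isoH q; have [h' hK h'K] := hbij.
have bd x c : hrep x (c : cx_homology P q) -> c = 0 <-> quo_pi (cx_boundaries q) x = 0.
  move=> xc; rewrite quo_pi0P (cx_boundariesP (j := q - -1)) ?opprK//.
  exact: hrep_eq0.
have [|||f fE] := @linear_of_rel _ (H q) (cx_coker q)
  (fun z w => exists c x, [/\ h c = z, hrep x c & quo_pi _ x = w]).
- move=> a _ _ _ _ [c [x [<- xc <-]]] [c' [x' [<- xc' <-]]].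
  exists (a *: c + c'), (a *: x + x').
  by split; [rewrite linearP | apply: hrep_lin | rewrite linearP].
- move=> z; have [x _ xc] := hrep_ex (h' z).
  by exists (quo_pi _ x), (h' z), x.
- move=> _ [c [x [hc xc <-]]]; apply/(bd _ _ xc).
  by rewrite -(hK c) hc -[in LHS](raddf0 h) hK.
exists f, g; split=> [p|]; first by rewrite gE dE.
split.
- move=> z /fE[c [x [<- xc x0]]].
  by have -> : c = 0; [apply/(bd _ _ xc) | apply: raddf0].
- move=> w; split=> [|[z /fE[c [x [_ xc <-]]]]].
    rewrite -(quo_reprK w) gE => dw.
    have [|c xc] := @hrep_tot _ _ _ _ (cx_d P (q - -1) q) (cx_d P q (q + -1)) (quo_repr w).
      by rewrite -[q + -1]/(q - 1) -dE dw raddf0.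
    by exists (h c); apply/fE; exists c, (quo_repr w).
  by rewrite gE; apply: val_inj; rewrite dE (hrep_cycle xc) raddf0.
- move=> b; have /(cx_boundariesP _ (esym (subrK _ _)))[x xb] := valP b.
  by exists (quo_pi _ x); apply: val_inj; rewrite gE dE.
Qed.

End Boundaries.

Section ProjectiveModules.
Variable A : comPzRingType.
Implicit Types U V W P : lmodType A.

Lemma zero_projective P : zero_module P -> projective_module P.
Proof.
move=> P0 V W g f _; exists \0 => x.
by rewrite (P0 x) !raddf0.
Qed.

Lemma projective_lift P U V (k : {linear U -> V}) (h : {linear P -> V}) :
    projective_module P -> (forall x, exists u, k u = h x) ->
  exists l : {linear P -> U}, forall x, k (l x) = h x.
Proof.
move=> projP kh.
have [|h' h'E] := @corestrict_ex _ _ _ (image_mod k) h.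
  by move=> x; apply/image_modP.
have [|k' k'E] := @corestrict_ex _ _ _ (image_mod k) k.
  by move=> x; apply/image_modP; exists x.
have [|l lE] := projP _ _ k' h'.
  move=> w; have /image_modP[u uw] := valP w.
  by exists u; apply: val_inj; rewrite k'E.
by exists l => x; rewrite -k'E lE h'E.
Qed.

Section LinearFunction.
Variables (U V : lmodType A) (f : U -> V) (lf : linear f).
Definition linear_fun : {linear U -> V} :=
  HB.pack f (GRing.isLinear.Build A U V *:%R f lf).
End LinearFunction.

Lemma prod_projective P P' :
  projective_module P -> projective_module P' -> projective_module (P * P')%type.
Proof.
move=> projP projP' V W g f surj.
have l1 : linear (fun x : P => f (x, 0)).
  by move=> a x y; rewrite -linearP; congr (f _); apply: pair_ext; rewrite //= scaler0 addr0.
have l2 : linear (fun x : P' => f (0, x)).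
  by move=> a x y; rewrite -linearP; congr (f _); apply: pair_ext; rewrite //= scaler0 addr0.
have [h1 h1E] := projP _ _ g (linear_fun l1) surj.
have [h2 h2E] := projP' _ _ g (linear_fun l2) surj.
have l : linear (fun x : P * P' => h1 x.1 + h2 x.2).
  by move=> a x y /=; rewrite !linearP scalerDr addrACA.
exists (linear_fun l) => -[x y] /=; rewrite raddfD/= h1E h2E /= -raddfD/=.
by congr (f _); apply: pair_ext; rewrite /= ?addr0 ?add0r.
Qed.

(** Needed in this dependent form since the type of a twist in the horseshoe lemma varies with its
    degree. *)
Lemma dependent_choice_nat (T : nat -> Type) (R : forall n, T n -> T n.+1 -> Prop) (x0 : T 0) :
  (forall n x, exists y, R n x y) ->
  exists f : forall n, T n, f 0 = x0 /\ forall n, R n (f n) (f n.+1).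
Proof.
move=> step; pose next n x := projT1 (cid (step n x)).
pose f := fix f n : T n := match n with 0 => x0 | n'.+1 => next n' (f n') end.
by exists f; split=> // n; apply: projT2 (cid (step n (f n))).
Qed.

End ProjectiveModules.

(** * Resolving an extension *)

Section Horseshoe.
Variables (A : comPzRingType) (X' X X'' : lmodType A).
Variables (f : {linear X' -> X}) (g : {linear X -> X''}).
Variables (R' : resolution X') (R'' : resolution X'').

Record horseshoe := Horseshoe {
  hs :> resolution X;
  hs_a : forall n, {linear R' n -> hs n};
  hs_b : forall n, {linear hs n -> R'' n};
  hs_da : forall n x, rs_d hs n (hs_a n.+1 x) = hs_a n (rs_d R' n x);
  hs_db : forall n x, rs_d R'' n (hs_b n.+1 x) = hs_b n (rs_d hs n x);
  hs_ea : forall x, rs_e hs (hs_a 0 x) = f (rs_e R' x);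
  hs_eb : forall x, rs_e R'' (hs_b 0 x) = g (rs_e hs x);
  hs_exact : forall n, short_exact (hs_a n) (hs_b n) }.

Hypothesis exfg : short_exact f g.

Let twist n := {linear R'' n.+1 -> R' n}.

(* The off-diagonal components [theta n] of the differential on
   [R' n * R'' n] are obtained by lifting. *)
Lemma twist_ex : exists (lambda : {linear R'' 0 -> X}) (theta : forall n, twist n),
  [/\ forall x, g (lambda x) = rs_e R'' x,
      forall x, f (rs_e R' (theta 0 x)) = - lambda (rs_d R'' 0 x)
    & forall n x, rs_d R' n (theta n.+1 x) = - theta n (rs_d R'' n.+1 x)].
Proof.
have [injf exf surjg] := exfg.
have [lambda lambdaE] := rs_proj R'' 0 _ _ g (rs_e R'') surjg.
have [x|theta0 theta0E] := @projective_lift _ _ _ _ (f \o rs_e R')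
    (\- (lambda \o rs_d R'' 0)) (rs_proj R'' 1).
  have /exf[x' x'E] : g (- lambda (rs_d R'' 0 x)) = 0.
    by rewrite raddfN/= lambdaE rs_ed oppr0.
  by have [y yx'] := rs_surj R' x'; exists y; rewrite /= yx' x'E.
have {}theta0E x : f (rs_e R' (theta0 x)) = - lambda (rs_d R'' 0 x) := theta0E x.
(* The condition for [th] to have a successor. It is carried in a subtype so that every choice can
   be continued. *)
pose good n (th : twist n) := forall x, exists y, rs_d R' n y = - th (rs_d R'' n.+1 x).
have good0 : good 0%N theta0.
  move=> x; apply/rs_exact0; apply: injf.
  by rewrite raddfN/= raddfN/= theta0E /= rs_dd !raddf0 ?oppr0.
have step n (th : {th | good n th}) : exists th' : {th | good n.+1 th},
    forall x, rs_d R' n (sval th' x) = - sval th (rs_d R'' n.+1 x).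
  case: th => th thP; have [x|th' th'E] := @projective_lift _ _ _ _ (rs_d R' n)
    (\- (th \o rs_d R'' n.+1)) (rs_proj R'' n.+2); first exact: thP.
  have thP' : good n.+1 th'.
    by move=> x; apply/rs_exact; rewrite raddfN/= th'E /= rs_dd !raddf0 ?oppr0.
  by exists (exist _ th' thP').
have [theta [theta00 thetaS]] := dependent_choice_nat (exist _ theta0 good0) step.
exists lambda, (fun n => sval (theta n)); split=> // x.
by rewrite theta00 /= theta0E.
Qed.

(** The differential [(x, y) |-> (d x + theta y, d y)] is triangular, and the identities of
    [twist_ex] say that it squares to zero and is compatible with the augmentation. For exactness
    the second coordinate is lifted first, and [theta] of that lift is subtracted before the first
    one is lifted. *)
Lemma horseshoe_ex : horseshoe.
Proof.
have [injf exf surjg] := exfg.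
pose lambda := projT1 (cid twist_ex).
pose theta := projT1 (cid (projT2 (cid twist_ex))).
have [lE t0E tE] := projT2 (cid (projT2 (cid twist_ex))).
rewrite -/lambda -/theta in lE t0E tE.
pose C n : lmodType A := (R' n * R'' n)%type.
have ld n : linear (fun x : C n.+1 => (rs_d R' n x.1 + theta n x.2, rs_d R'' n x.2) : C n).
  move=> a x y /=; apply: pair_ext; rewrite /= !linearP//.
  by rewrite scalerDr addrACA.
have le : linear (fun x : C 0 => f (rs_e R' x.1) + lambda x.2).
  by move=> a x y /=; rewrite !linearP scalerDr addrACA.
pose d n := linear_fun (ld n); pose ep := linear_fun le.
have ex0 : exact_at (d 0) ep.
  move=> [a b]; split=> [/= ab0|[[a1 b1] <-] /=]; last first.
    by rewrite !raddfD/= rs_ed raddf0 add0r t0E addNr.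
  have /rs_exact0[b1 b1b] : rs_e R'' b = 0.
    have := congr1 g ab0; rewrite raddfD/= lE raddf0.
    by rewrite (iffRL (exf (f _))) ?add0r//; exists (rs_e R' a).
  have /rs_exact0[a1 a1E] : rs_e R' (a - theta 0 b1) = 0.
    by apply: injf; rewrite !raddfB/= t0E opprK b1b.
  by exists (a1, b1); apply: pair_ext; rewrite //= a1E subrK.
have ex n : exact_at (d n.+1) (d n).
  move=> [a b]; split=> [/= ab0|[[a1 b1] <-] /=]; last first.
    apply: pair_ext; rewrite /= ?rs_dd//.
    by rewrite raddfD/= rs_dd add0r tE addNr.
  have /= a0 := congr1 fst ab0; have /= /rs_exact[b1 b1b] := congr1 snd ab0.
  have /rs_exact[a1 a1E] : rs_d R' n (a - theta n.+1 b1) = 0.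
    by rewrite raddfB/= tE opprK b1b.
  by exists (a1, b1); apply: pair_ext; rewrite //= a1E subrK.
have surj x : exists y, ep y = x.
  have [b bE] := rs_surj R'' (g x).
  have /exf[x' x'E] : g (x - lambda b) = 0 by rewrite raddfB/= lE bE subrr.
  have [a aE] := rs_surj R' x'.
  by exists (a, b); rewrite /= aE x'E subrK.
have proj n : projective_module (C n) by apply: prod_projective; apply: rs_proj.
have la n : linear (fun x : R' n => (x, 0) : C n).
  by move=> a x y; apply: pair_ext; rewrite //= scaler0 addr0.
have lb n : linear (fun x : C n => x.2) by [].
apply: (@Horseshoe (Resolution proj surj ex0 ex) (fun n => linear_fun (la n))
  (fun n => linear_fun (lb n))).
- by move=> n x /=; rewrite !raddf0 addr0.
- by [].
- by move=> x /=; rewrite raddf0 addr0.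
- move=> [a b] /=; rewrite raddfD/= lE.
  by rewrite (iffRL (exf (f _))) ?add0r//; exists (rs_e R' a).
- move=> n; split=> [x /(congr1 fst)//|[a b]|b]; last by exists (0, b).
  by split=> [/= ->|[a' <-]]; [exists a|].
Qed.

End Horseshoe.

(** * The contravariant Ext spectral sequence *)

Section ContravariantExt.
Variables (A : comPzRingType) (N : lmodType A).

Definition cext_d (X : lmodType A) (R : resolution X) n :
    {linear hom (R n) N -> hom (R n.+1) N} :=
  hom_pre (rs_d R n).

Lemma cext_dd (X : lmodType A) (R : resolution X) n x :
  cext_d R n.+1 (cext_d R n x) = 0.
Proof. by apply: hom_ext => y /=; rewrite rs_dd hom0. Qed.

Lemma cext_les (X' X X'' : lmodType A) (f : {linear X' -> X}) (g : {linear X -> X''})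
    (R' : resolution X') (R'' : resolution X'') (R : horseshoe f g R' R'') :
  coh_les (cext_d R'') (cext_d R) (cext_d R')
    (fun n => hom_pre (hs_b R n)) (fun n => hom_pre (hs_a R n)).
Proof.
apply: coh_les_ex => [n x|n x|n x|n].
- exact: cext_dd.
- by apply: hom_ext => y /=; rewrite hs_db.
- by apply: hom_ext => y /=; rewrite hs_da.
- by apply: hom_pre_short_exact; [exact: rs_proj | exact: hs_exact].
Qed.

(** [s] is part of a contraction of the augmented resolution. It starts from a section of the
    augmentation; then [x - s (d x)] is a cycle, hence lifts one degree up. *)
Lemma projective_split (X : lmodType A) (R : resolution X) n : projective_module X ->
  exists s : {linear R n -> R n.+1}, forall x,
    rs_d R n (s (rs_d R n x)) = rs_d R n x.
Proof.
move=> projX; elim: n => [|n [s sE]].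
  have [t tE] := projX _ _ (rs_e R) idfun (@rs_surj _ _ R).
  have [x|s sE] := @projective_lift _ _ _ _ (rs_d R 0) (idfun \- (t \o rs_e R))
    (rs_proj R 0).
    by apply/rs_exact0; rewrite /= raddfB/= tE subrr.
  by exists s => x; rewrite sE /= rs_ed raddf0 subr0.
have [x|s' s'E] := @projective_lift _ _ _ _ (rs_d R n.+1) (idfun \- (s \o rs_d R n))
  (rs_proj R n.+1).
  by apply/rs_exact; rewrite /= raddfB/= sE subrr.
by exists s' => x; rewrite s'E /= rs_dd raddf0 subr0.
Qed.

(** A cocycle [h] is the coboundary of [h \o s]: the difference [s (d x) - x] is a cycle, hence a
    boundary, and [h] vanishes on it. *)
Lemma cext_projective (X : lmodType A) (R : resolution X) n : projective_module X ->
  zero_module (coh (cext_d R) n.+1).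
Proof.
move=> projX c; have [h /hom_zeroP dh hc] := hrep_ex c.
have [s sE] := projective_split R n projX.
apply/(hrep_eq0 hc); exists (lin_hom (hom_lin h \o s)); apply: hom_ext => x /=.
have /rs_exact[y yE] : rs_d R n (s (rs_d R n x) - x) = 0 by rewrite raddfB/= sE subrr.
apply/eqP; rewrite -subr_eq0; apply/eqP.
rewrite -[LHS]/(hom_lin h (s (rs_d R n x)) - hom_lin h x) -raddfB -yE.
exact: dh.
Qed.

Lemma cext_zero (X : lmodType A) (R : resolution X) n : zero_module X ->
  zero_module (coh (cext_d R) n).
Proof.
move=> X0; case: n => [|n]; last exact/cext_projective/zero_projective.
move=> c; have [h /hom_zeroP dh hc] := hrep_ex c.
apply/(hrep_eq0 hc); exists 0; apply/esym/hom_zeroP => x.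
have /rs_exact0[y <-] : rs_e R x = 0 by apply: X0.
exact: dh.
Qed.

Section HyperExt.
Variables (P : chain_complex A) (H : int -> lmodType A) (n0 : int).
Variable RH : forall q, resolution (H q).
Hypotheses (isoH : forall q, isomorphic (cx_homology P q) (H q))
  (projP : forall q, projective_module (P q))
  (P0 : forall q, q < n0 -> zero_module (P q))
  (H0 : forall q, q < 0 -> zero_module (H q)).

Let Bd q := cx_boundaries P q.
Let B q := sub_of (Bd q).
Let Q q := cx_coker P q.

(** The incoming differential of [hom_from_complex] starts in degree [q - - -1]; with that degree
    abstracted to [j], the equation with [q - 1] can be eliminated. *)
Lemma hom_boundaryP q j phi : j = q - 1 ->
  (exists u : hom (P j) N, hom_pre (cx_d P q j) u = phi) ->
  exists u : hom (P (q - 1)) N, hom_pre (cx_d P q (q - 1)) u = phi.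
Proof. by move=> ->. Qed.

Lemma contravariant_hyperext_spectral_sequence : exists S : spectral_sequence A 1,
  [/\ first_quadrant S, forall p q : nat, isomorphic (S 2%N p q) (coh (cext_d (RH q)) p)
    & cohomology_converges S (cx_homology (hom_from_complex P N))].
Proof.
have [f [g fgP]] : exists (f : forall q, {linear H q -> Q q})
    (g : forall q, {linear Q q -> B (q - 1)}),
    forall q, (forall p, val (g q (quo_pi _ p)) = cx_d P q (q - 1) p) /\
      short_exact (f q) (g q).
  exists (fun q => projT1 (cid (coker_ses isoH q))).
  exists (fun q => projT1 (cid (projT2 (cid (coker_ses isoH q))))) => q.
  exact: projT2 (cid (projT2 (cid (coker_ses isoH q)))).
have gE q p : val (g q (quo_pi _ p)) = cx_d P q (q - 1) p by have [] := fgP q.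
have fg q : short_exact (f q) (g q) by have [] := fgP q.
(* Fixing the resolutions of all [B q] before those of [Q q] and [P q] gives each module one
   resolution common to both families of sequences, so that the maps of [L1] and [L2] compose. *)
have RB q : resolution (B q) := free_resolution (B q).
have RQ q := horseshoe_ex (RH q) (RB (q - 1)) (fg q).
have RP q := horseshoe_ex (RB q) (RQ q) (boundaries_ses P q).
have L1 q := cext_les (RQ q); have L2 q := cext_les (RP (q - 1)).
have TP0 q a : zero_module (coh (cext_d (RP (q - 1))) a.+1) by apply: cext_projective.
have [|||||||||S [S1 S2 S3]] := @delta_cohomology_spectral_sequence A
  (fun q => coh (cext_d (RQ q))) (fun q => coh (cext_d (RP (q - 1))))
  (fun q => coh (cext_d (RB (q - 1)))) (fun q => coh (cext_d (RH q)))
  (fun q => cles_a (L1 q)) (fun q => cles_b (L1 q)) (fun q => cles_c (L1 q))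
  (fun q => cles_b (L2 q)) (fun q => cles_c (L2 q)) _ _ _ _ _ _ _ n0.
- by move=> q x; apply: cles_inj.
- by move=> q a; apply: (cles_ab (L1 q)).
- by move=> q a; apply: (cles_bc (L1 q)).
- by move=> q a; apply: (cles_ca (L1 q)).
- by move=> q a; apply: (cles_bc (L2 q)).
- by move=> q a z; apply/(cles_ca (L2 q)); apply: TP0.
- exact: TP0.
- by move=> q a q0; apply: cext_zero; apply: H0.
- move=> q a q0; apply: cext_zero => z.
  by rewrite -(quo_reprK z) (P0 q0 (quo_repr z)) raddf0.
exists S; split=> //; apply: cohomology_converges_iso S3 => q {S S1 S2}.
apply: isomorphic_sym.
pose D := image_mod (cles_a (L1 q) 0 \o cles_b (L2 q) 0 :
  {linear coh (cext_d (RP (q - 1))) 0 -> coh (cext_d (RQ q)) 0}).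
have inducedD chi s : hrep chi s -> hrep (hom_pre (hs_b (RQ q) 0) (hom_pre (hs_a (RP (q - 1)) 0) chi))
   (cles_a (L1 q) 0 (cles_b (L2 q) 0 s)).
  by move=> chis; apply/(cles_ind_a (L1 q))/(cles_ind_b (L2 q)).
have epsE x p : rs_e (RQ q) x = quo_pi _ p ->
    rs_e (RP (q - 1)) (hs_a (RP (q - 1)) 0 (hs_b (RQ q) 0 x)) = cx_d P q (q - 1) p.
  by move=> xp; rewrite hs_ea hs_eb xp -gE.
(* [quo D] is [hom (Q q) N] modulo the maps induced from [P (q - 1)]. A cocycle [phi] on [P q] and a
   cocycle [psi] on the resolution of [Q q] are matched when they induce the same map on [Q q]. *)
apply: (@iso_of_rel _ _ (quo D) (fun v c => exists phi t psi,
  [/\ hrep phi v, c = quo_pi D t, hrep psi t &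
    forall x p, rs_e (RQ q) x = quo_pi _ p -> val psi x = val phi p])).
- move=> a v c v' c' [phi [t [psi [h1 -> h2 h3]]]] [phi' [t' [psi' [h1' -> h2' h3']]]].
  exists (a *: phi + phi'), (a *: t + t'), (a *: psi + psi'); split.
  + exact: hrep_lin.
  + by rewrite linearP.
  + exact: hrep_lin.
  + by move=> x p xp; rewrite !hom_linP (h3 _ _ xp) (h3' _ _ xp).
- move=> v; have [phi dphi phiv] := hrep_ex v.
  have [||phi' phi'E] := @factor_ex _ _ _ _ (quo_pi (Bd q)) (hom_lin phi).
  - by case: (boundaries_ses P q).
  - move=> x /quo_pi0P/(cx_boundariesP (j := q + - -1))[|y <-]; first by rewrite opprK.
    exact: (iffLR (hom_zeroP _) dphi y).
  have [|t psit] := @hrep_tot _ _ _ _ (coh_prev (cext_d (RQ q)) 0) (cext_d (RQ q) 0)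
      (lin_hom (phi' \o rs_e (RQ q))).
    by apply: hom_ext => x; rewrite /= rs_ed raddf0.
  exists (quo_pi D t), phi, t, (lin_hom (phi' \o rs_e (RQ q))); split=> // x p xp.
  by rewrite /= xp phi'E.
- move=> c; rewrite -(quo_reprK c); set t := quo_repr c.
  have [psi /hom_zeroP dpsi psit] := hrep_ex t.
  have [||phi phiE] := @factor_ex _ _ _ _ (rs_e (RQ q)) (hom_lin psi).
  - exact: rs_surj.
  - by move=> x /rs_exact0[y <-]; apply: dpsi.
  have [|v phiv] := @hrep_tot _ _ _ _ (cx_d (hom_from_complex P N) (q - - -1) q)
    (cx_d (hom_from_complex P N) q (q + - -1)) (lin_hom (phi \o quo_pi (Bd q))).
    apply: hom_ext => y /=; set z := cx_d P _ q y.
    have -> : quo_pi (Bd q) z = 0.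
      apply/quo_pi0P/(cx_boundariesP (j := q + - -1)); first by rewrite opprK.
      by exists y.
    exact: raddf0.
  exists v, (lin_hom (phi \o quo_pi (Bd q))), t, psi; split=> // x p xp.
  by rewrite /= -xp phiE.
- move=> c [phi [t [psi [phi0 -> psit psiE]]]].
  have [|phi1 phi1E] := hom_boundaryP _ (iffLR (hrep_eq0 phi0) erefl).
    by rewrite opprK.
  apply/quo_pi0P/image_modP.
  have [|s sE] := @hrep_tot _ _ _ _ (coh_prev (cext_d (RP (q - 1))) 0)
     (cext_d (RP (q - 1)) 0) (lin_hom (hom_lin phi1 \o rs_e (RP (q - 1)))).
    by apply: hom_ext => x; rewrite /= rs_ed hom0.
  exists s; apply: (hrep_fun (inducedD _ _ sE)).
  suff -> : hom_pre (hs_b (RQ q) 0) (hom_pre (hs_a (RP (q - 1)) 0)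
      (lin_hom (hom_lin phi1 \o rs_e (RP (q - 1))))) = psi by [].
  apply: hom_ext => x; rewrite (psiE x (quo_repr (rs_e (RQ q) x))) ?quo_reprK//.
  by rewrite -phi1E /= (epsE _ (quo_repr (rs_e (RQ q) x))) ?quo_reprK.
- move=> v [phi [t [psi [phiv /esym/quo_pi0P/image_modP[s sE] psit psiE]]]].
  have [chi /hom_zeroP dchi chis] := hrep_ex s.
  have := inducedD _ _ chis; rewrite -[cles_a _ _ _]/((cles_a (L1 q) 0 \o cles_b (L2 q) 0) s) sE.
  move=> /(hrep_eq psit) /(iffLR)/(_ erefl)[u /= /esym/eqP].
  rewrite subr_eq0 => /eqP psiE'.
  have [||phi1 phi1E] := @factor_ex _ _ _ _ (rs_e (RP (q - 1))) (hom_lin chi).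
  - exact: rs_surj.
  - by move=> x /rs_exact0[y <-]; apply: dchi.
  have phid : hom_pre (cx_d P q (q - 1)) (lin_hom phi1) = phi.
    apply: hom_ext => p; have [x xp] := rs_surj (RQ q) (quo_pi (Bd q) p).
    by rewrite -(psiE _ _ xp) psiE' /= -(epsE _ _ xp) phi1E.
  apply/(hrep_eq0 phiv).
  have qE : q - 1 = q - - -1 by rewrite opprK.
  by move: (lin_hom phi1) phid; rewrite qE => w wE; exists w.
Qed.

End HyperExt.
End ContravariantExt.

(** * Tensor products *)

Section FreeModulesOn.
Variable A : comPzRingType.

(** Basis, coordinates and extensionality suffice for the tensor computations, and [free_mod] stays
    folded in them. *)
Record free_on (F : lmodType A) := FreeOn {
  fo_index : choiceType;
  fo_basis : fo_index -> F;
  fo_coord : fo_index -> {linear F -> A^o};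
  fo_coordE : forall s t, fo_coord s (fo_basis t) = (s == t)%:R;
  fo_ext : forall (V : lmodType A) (f g : {linear F -> V}),
    (forall t, f (fo_basis t) = g (fo_basis t)) -> forall x, f x = g x }.

Fact eval_linear (T : choiceType) (V : lmodType A) (t : T) :
  linear (fun u : (T -> V : lmodType A) => u t).
Proof. by []. Qed.

Definition free_mod_free_on (T : choiceType) : free_on (free_mod A T) :=
  @FreeOn (free_mod A T) T (@free_basis A T)
    (fun t => linear_fun (@eval_linear T A^o t) \o
      (val : {linear free_mod A T -> (T -> A^o : lmodType A)}))
    (fun s t => erefl) (@free_ext A T).

End FreeModulesOn.
Arguments fo_index {A F} f : rename.
Arguments fo_basis {A F} f t : rename.
Arguments fo_coord {A F} f t : rename.

(* The tensor products of [Defs] through their universal property only: their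
   concrete construction slows down conversion considerably. *)
Record tensor_product (A : comPzRingType) := TensorProduct {
  tp :> lmodType A -> lmodType A -> lmodType A;
  tp_tens : forall X Y : lmodType A, X -> Y -> tp X Y;
  tp_map : forall X X' Y Y' : lmodType A,
    {linear X -> X'} -> {linear Y -> Y'} -> {linear tp X Y -> tp X' Y'};
  tp_tensPl : forall (X Y : lmodType A) a (x x' : X) (y : Y),
    tp_tens (a *: x + x') y = a *: tp_tens x y + tp_tens x' y;
  tp_tensPr : forall (X Y : lmodType A) a (x : X) (y y' : Y),
    tp_tens x (a *: y + y') = a *: tp_tens x y + tp_tens x y';
  tp_mapE : forall (X X' Y Y' : lmodType A) (f : {linear X -> X'})
    (g : {linear Y -> Y'}) x y, tp_map f g (tp_tens x y) = tp_tens (f x) (g y);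
  tp_ext : forall (X Y V : lmodType A) (f g : {linear tp X Y -> V}),
    (forall x y, f (tp_tens x y) = g (tp_tens x y)) -> forall z, f z = g z;
  tp_lift : forall (X Y V : lmodType A) (b : X -> Y -> V),
    (forall y, linear (b^~ y)) -> (forall x, linear (b x)) ->
    exists h : {linear tp X Y -> V}, forall x y, h (tp_tens x y) = b x y }.

Section StandardTensor.
Variable A : comPzRingType.
Implicit Types X Y V : lmodType A.

Lemma tensor_ext X Y V (f g : {linear tensor X Y -> V}) :
  (forall x y, f (tens x y) = g (tens x y)) -> forall z, f z = g z.
Proof.
move=> fg z; rewrite -(quo_reprK z).
apply: (free_ext (f := f \o quo_pi (tensor_rel X Y)) (g := g \o quo_pi (tensor_rel X Y))).
by case=> x y; apply: fg.
Qed.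

Lemma tensor_lift_ex X Y V (b : X -> Y -> V) :
    (forall y, linear (b^~ y)) -> (forall x, linear (b x)) ->
  exists h : {linear tensor X Y -> V}, forall x y, h (tens x y) = b x y.
Proof.
move=> bl br; pose F : {linear free_mod A (X * Y)%type -> V} := free_lift (fun p => b p.1 p.2).
have FE x y : F (free_basis A (x, y)) = b x y by apply: free_lift_basis.
have [||h hE] := @factor_ex _ _ _ _ (quo_pi (tensor_rel X Y)) F.
- by move=> z; exists (quo_repr z); apply: quo_reprK.
- move=> z /quo_pi0P; move: z; apply: span_eq0 => z [] [a [x [x' [y ->]]]].
    by rewrite linearB linearP !FE bl subrr.
  by rewrite linearB linearP !FE br subrr.
by exists h => x y; rewrite -FE -hE.
Qed.

Definition standard_tensor : tensor_product A :=
  TensorProduct (@tensPl A) (@tensPr A) (@tensor_mapE A) tensor_ext tensor_lift_ex.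

End StandardTensor.

Section TensorTheory.
Variables (A : comPzRingType) (tp : tensor_product A).
Implicit Types U V X Y Z : lmodType A.
Local Notation tens := (tp_tens tp).
Local Notation tmap := (tp_map tp).

Lemma tp_map_square X Y X1 Y1 X2 Y2 X' Y'
    (f1 : {linear X -> X1}) (g1 : {linear Y -> Y1})
    (f1' : {linear X1 -> X'}) (g1' : {linear Y1 -> Y'})
    (f2 : {linear X -> X2}) (g2 : {linear Y -> Y2})
    (f2' : {linear X2 -> X'}) (g2' : {linear Y2 -> Y'}) :
    (forall x, f1' (f1 x) = f2' (f2 x)) -> (forall y, g1' (g1 y) = g2' (g2 y)) ->
  forall z, tmap f1' g1' (tmap f1 g1 z) = tmap f2' g2' (tmap f2 g2 z).
Proof.
move=> ff gg z.
apply: (tp_ext (f := tmap f1' g1' \o tmap f1 g1)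
               (g := tmap f2' g2' \o tmap f2 g2)) => x y /=.
by rewrite !tp_mapE ff gg.
Qed.

Lemma tp_map_comp X Y X1 Y1 X' Y'
    (f : {linear X -> X1}) (g : {linear Y -> Y1})
    (f' : {linear X1 -> X'}) (g' : {linear Y1 -> Y'})
    (f2 : {linear X -> X'}) (g2 : {linear Y -> Y'}) :
    (forall x, f' (f x) = f2 x) -> (forall y, g' (g y) = g2 y) ->
  forall z, tmap f' g' (tmap f g z) = tmap f2 g2 z.
Proof.
move=> ff gg z; apply: (tp_ext (f := tmap f' g' \o tmap f g)) => x y /=.
by rewrite !tp_mapE ff gg.
Qed.

Lemma tp_map_id X Y (f : {linear X -> X}) (g : {linear Y -> Y}) :
  (forall x, f x = x) -> (forall y, g y = y) -> forall z, tmap f g z = z.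
Proof.
move=> fx gy z; apply: (tp_ext (g := idfun)) => x y.
by rewrite tp_mapE fx gy.
Qed.

Lemma tp_tens0l X Y (y : Y) : tens (0 : X) y = 0.
Proof. by have := tp_tensPl tp (-1) (0 : X) 0 y; rewrite scaler0 addr0 scaleN1r addNr. Qed.

Lemma tp_tens0r X Y (x : X) : tens x (0 : Y) = 0.
Proof. by have := tp_tensPr tp (-1) x (0 : Y) 0; rewrite scaler0 addr0 scaleN1r addNr. Qed.

Lemma tp_map0l X X' Y Y' (f : {linear X -> X'}) (g : {linear Y -> Y'}) :
  (forall x, f x = 0) -> forall z, tmap f g z = 0.
Proof.
move=> f0 z; apply: (tp_ext (g := \0)) => x y.
by rewrite tp_mapE f0 tp_tens0l.
Qed.

Lemma tp_map0r X X' Y Y' (f : {linear X -> X'}) (g : {linear Y -> Y'}) :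
  (forall y, g y = 0) -> forall z, tmap f g z = 0.
Proof.
move=> g0 z; apply: (tp_ext (g := \0)) => x y.
by rewrite tp_mapE g0 tp_tens0r.
Qed.

Lemma tp_zero X Y : zero_module X -> zero_module (tp X Y).
Proof.
move=> X0 z; apply: (tp_ext (f := idfun) (g := \0)) => x y /=.
by rewrite (X0 x) tp_tens0l.
Qed.

Lemma tp_swap X Y : exists s : {linear tp X Y -> tp Y X},
  forall x y, s (tens x y) = tens y x.
Proof.
by apply: tp_lift => [y|x] a z z'; [apply: tp_tensPr | apply: tp_tensPl].
Qed.

Section FreeFactor.
Variables (F : lmodType A) (freeF : free_on F).
Local Notation T := (fo_index freeF).
Local Notation e := (fo_basis freeF).
Local Notation co := (fo_coord freeF).

Lemma tp_free_ext X V (f g : {linear tp X F -> V}) :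
  (forall x t, f (tens x (e t)) = g (tens x (e t))) -> forall z, f z = g z.
Proof.
move=> fg; apply: tp_ext => x y.
have lx : linear (tens x : F -> tp X F) by move=> a u v; apply: tp_tensPr.
exact: (fo_ext (f := f \o linear_fun lx) (g := g \o linear_fun lx) (fg x)).
Qed.

Lemma tp_coord_ex X (t : T) : exists c : {linear tp X F -> X},
  forall x y, c (tens x y) = (co t y : A) *: x.
Proof.
apply: tp_lift => [y|x] a u v; first by rewrite scalerDr !scalerA mulrC.
by rewrite linearP scalerDl scalerA.
Qed.

Definition tp_coord X t : {linear tp X F -> X} := projT1 (cid (tp_coord_ex X t)).

Lemma tp_coordE X t (x : X) y : tp_coord X t (tens x y) = (co t y : A) *: x.
Proof. exact: projT2 (cid (tp_coord_ex X t)) x y. Qed.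

Lemma tp_coord_map X Y (f : {linear X -> Y}) t z :
  tp_coord Y t (tmap f idfun z) = f (tp_coord X t z).
Proof.
apply: (tp_ext (f := tp_coord Y t \o tmap f idfun)
  (g := f \o tp_coord X t)) => x y /=.
by rewrite tp_mapE !tp_coordE linearZ_LR.
Qed.

(** Asking for the expansion over every finite set containing [D] makes the property stable under
    sums. The elements having it form a submodule, and the projection modulo it vanishes on the
    generators [tens x (e t)], hence everywhere. *)
Lemma tp_free_expand X (z : tp X F) : exists D : {fset T},
  z = \sum_(t <- D) tens (tp_coord X t z) (e t).
Proof.
pose P (z : tp X F) := exists D : {fset T}, forall D' : {fset T},
  (D `<=` D')%fset -> z = \sum_(t <- D') tens (tp_coord X t z) (e t).
have P0 : P 0.
  exists fset0 => D _; rewrite big1// => t _.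
  by rewrite raddf0 tp_tens0l.
have Plin a u v : P u -> P v -> P (a *: u + v).
  move=> [D uD] [D' vD']; exists (D `|` D')%fset => D'' sD.
  transitivity (a *: (\sum_(t <- D'') tens (tp_coord X t u) (e t)) +
                \sum_(t <- D'') tens (tp_coord X t v) (e t)).
    congr (_ *: _ + _).
      by apply: uD; apply: fsubset_trans (fsubsetUl _ _) sD.
    by apply: vD'; apply: fsubset_trans (fsubsetUr _ _) sD.
  rewrite scaler_sumr -big_split /=; apply: eq_bigr => t _.
  by rewrite linearP tp_tensPl.
suff : P z by case=> D zD; exists D; apply: zD.
have : quo_pi (submod_of P0 Plin) z = 0.
  apply: (tp_free_ext (f := quo_pi (submod_of P0 Plin)) (g := \0)) => x t /=.
  apply/quo_pi0P/submod_ofP; exists [fset t]%fset => D tD.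
  have tD' : t \in D by rewrite -fsub1set.
  rewrite (big_fsetD1 t tD') /= big1_seq => [|s].
    by rewrite addr0 tp_coordE fo_coordE eqxx scale1r.
  rewrite !inE => /andP[_ /andP[st _]].
  by rewrite tp_coordE fo_coordE (negPf st) scale0r tp_tens0l.
by move=> /quo_pi0P/submod_ofP.
Qed.

(** Coordinates commute with the induced maps, so each coordinate of [z] lifts through [f], and
    finitely many lifts rebuild a preimage. *)
Lemma tp_free_exact X' X X'' (f : {linear X' -> X}) (g : {linear X -> X''}) :
  exact_at f g ->
  exact_at (tmap f (idfun : {linear F -> F})) (tmap g (idfun : {linear F -> F})).
Proof.
move=> fg z; split=> [gz|[y <-]]; last first.
  rewrite (tp_map_comp (f2 := \0) (g2 := idfun))//; first exact: tp_map0l.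
  by move=> x; apply/fg; exists x.
have /choice[x' x'E] t : exists x', f x' = tp_coord X t z.
  by apply/fg; rewrite -tp_coord_map gz raddf0.
have [D {1}->] := tp_free_expand z.
exists (\sum_(t <- D) tens (x' t) (e t)).
by rewrite linear_sum; apply: eq_bigr => t _; rewrite tp_mapE x'E.
Qed.

Lemma tp_free_short_exact X' X X'' (f : {linear X' -> X}) (g : {linear X -> X''}) :
  short_exact f g -> short_exact (tmap f (idfun : {linear F -> F}))
    (tmap g (idfun : {linear F -> F})).
Proof.
move=> [injf fg surjg]; split.
- move=> z fz; have [|y <-] := iffLR (@tp_free_exact X' _ _ \0 f _ z) fz.
    by move=> x; split=> [/injf ->|[y <-]]; [exists 0 | apply: raddf0].
  exact: tp_map0l.
- exact: tp_free_exact.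
- move=> w; apply/(@tp_free_exact _ _ X'' g \0); last exact: tp_map0l.
  by move=> x; split=> // _; apply: surjg.
Qed.

End FreeFactor.

(** [P] is a retract of a free module: [z] is moved there by [s], lifted by [tp_free_exact] after
    exchanging the factors, and the lift is moved back by [p]. *)
Lemma tp_projective_exact P Y' Y Y'' (f : {linear Y' -> Y}) (g : {linear Y -> Y''}) :
    projective_module P -> exact_at f g ->
  exact_at (tmap (idfun : {linear P -> P}) f) (tmap (idfun : {linear P -> P}) g).
Proof.
move=> projP fg z.
split=> [gz|[y <-]]; last first.
  rewrite (tp_map_comp (f2 := idfun) (g2 := \0))//; first exact: tp_map0r.
  by move=> x; apply/fg; exists x.
have [F [freeF [p [s sE]]]] : exists F (freeF : free_on F)
    (p : {linear F -> P}) (s : {linear P -> F}), forall x, p (s x) = x.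
  have [s sE] := projP _ _ (free_eps P) idfun (@free_eps_surj _ P).
  by exists (free_mod A P), (free_mod_free_on A P), (free_eps P), s.
have [sw swE] := tp_swap F Y; have [sw' sw'E] := tp_swap Y' F.
have [sw'' sw''E] := tp_swap F Y''; have [swi swiE] := tp_swap Y F.
have swK w : swi (sw w) = w.
  by apply: (tp_ext (f := swi \o sw) (g := idfun)) => u v /=; rewrite swE swiE.
have swg w : tmap g (idfun : {linear F -> F}) (sw w) =
    sw'' (tmap (idfun : {linear F -> F}) g w).
  apply: (tp_ext (f := tmap g (idfun : {linear F -> F}) \o sw)
    (g := sw'' \o tmap (idfun : {linear F -> F}) g)) => u v /=.
  by rewrite swE !tp_mapE sw''E.
have swf w : swi (tmap f (idfun : {linear F -> F}) w) =
    tmap (idfun : {linear F -> F}) f (sw' w).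
  apply: (tp_ext (f := swi \o tmap f (idfun : {linear F -> F}))
    (g := tmap (idfun : {linear F -> F}) f \o sw')) => u v /=.
  by rewrite sw'E !tp_mapE swiE.
have [|w wE] := iffLR (tp_free_exact freeF fg (sw (tmap s idfun z))).
  rewrite swg (tp_map_square (f2 := idfun) (g2 := g) (f2' := s) (g2' := idfun))//.
  by rewrite gz !raddf0.
exists (tmap p idfun (sw' w)).
rewrite (tp_map_square (f2 := idfun) (g2 := f) (f2' := p) (g2' := idfun))//.
rewrite -swf wE swK (tp_map_comp (f2 := idfun) (g2 := idfun))//.
exact: tp_map_id.
Qed.

End TensorTheory.

(** * The Tor spectral sequence *)

Section HyperTor.
Variables (A : comPzRingType) (t : tensor_product A) (N : lmodType A).
Variables (R : resolution N) (freeR : forall n, free_on (R n)).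
Local Notation tmap := (tp_map t).

Definition tor_d (X : lmodType A) n : {linear t X (R n.+1) -> t X (R n)} :=
  tmap idfun (rs_d R n).

Lemma tmap_comm (X Y U V : lmodType A) (f : {linear X -> Y}) (g : {linear U -> V}) z :
  tmap idfun g (tmap f idfun z) = tmap f idfun (tmap idfun g z).
Proof. by apply: tp_map_square. Qed.

Lemma tor_dd X n x : tor_d X n (tor_d X n.+1 x) = 0.
Proof.
rewrite /tor_d (tp_map_comp (f2 := idfun) (g2 := \0))//; first exact: tp_map0r.
exact: rs_dd.
Qed.

Lemma tor_les (X' X X'' : lmodType A) (f : {linear X' -> X}) (g : {linear X -> X''}) :
    short_exact f g ->
  hom_les (tor_d X') (tor_d X) (tor_d X'')
    (fun n => tmap f (idfun : {linear R n -> R n}))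
    (fun n => tmap g (idfun : {linear R n -> R n})).
Proof.
move=> fg; apply: hom_les_ex => [n x|n x|n x|n].
- exact: tor_dd.
- exact: tmap_comm.
- exact: tmap_comm.
- exact: tp_free_short_exact (freeR n) _ _ _ _ _ fg.
Qed.

(** The resolved factor is [N]; tensoring with the projective module on the other side keeps its
    resolution exact. *)
Lemma tor_projective (X : lmodType A) n : projective_module X ->
  zero_module (nhom (tor_d X) n.+1).
Proof.
move=> projX c; have [x dx xc] := hrep_ex c.
apply/(hrep_eq0 xc).
exact: (iffLR (tp_projective_exact projX (@rs_exact _ _ R n) _) dx).
Qed.

Lemma tor_zero (X : lmodType A) n : zero_module X -> zero_module (nhom (tor_d X) n).
Proof.
move=> X0 c; have [x _ xc] := hrep_ex c; apply/(hrep_eq0 xc); exists 0.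
by rewrite raddf0 (tp_zero X0 x).
Qed.

Section Complex.
Variables (P : chain_complex A) (H : int -> lmodType A) (n0 : int).
Hypotheses (isoH : forall q, isomorphic (cx_homology P q) (H q))
  (projP : forall q, projective_module (P q))
  (P0 : forall q, q < n0 -> zero_module (P q))
  (H0 : forall q, q < 0 -> zero_module (H q)).

Let Bd q := cx_boundaries P q.
Let B q := sub_of (Bd q).
Let Q q := cx_coker P q.
(** For [t := standard_tensor A] these convert to the differentials of [tensor_complex P N], which
    itself involves the concrete tensor product. *)
Let td i j : {linear t (P i) N -> t (P j) N} := tmap (cx_d P i j) idfun.

Lemma hypertor_spectral_sequence : exists S : spectral_sequence A (-1),
  [/\ first_quadrant S, forall p q : nat, isomorphic (S 2%N p q) (nhom (tor_d (H q)) p)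
    & homology_converges S (fun q => homology (td (q - -1) q) (td q (q + -1)))].
Proof.
have [f [g fgP]] : exists (f : forall q, {linear H q -> Q q})
    (g : forall q, {linear Q q -> B (q - 1)}),
    forall q, (forall p, val (g q (quo_pi _ p)) = cx_d P q (q - 1) p) /\
      short_exact (f q) (g q).
  exists (fun q => projT1 (cid (coker_ses isoH q))).
  exists (fun q => projT1 (cid (projT2 (cid (coker_ses isoH q))))) => q.
  exact: projT2 (cid (projT2 (cid (coker_ses isoH q)))).
have gE q p : val (g q (quo_pi _ p)) = cx_d P q (q - 1) p by have [] := fgP q.
have L1 q : hom_les (tor_d (H q)) (tor_d (Q q)) (tor_d (B (q - 1)))
    (fun n => tmap (f q) idfun) (fun n => tmap (g q) idfun).
  by apply: tor_les; have [] := fgP q.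
have L2 q := tor_les (boundaries_ses P (q - 1)).
have TP0 q a : zero_module (nhom (tor_d (P (q - 1))) a.+1) by apply: tor_projective.
have [|||||||||S [S1 S2 S3]] := @delta_homology_spectral_sequence A
  (fun q => nhom (tor_d (Q q))) (fun q => nhom (tor_d (P (q - 1))))
  (fun q => nhom (tor_d (B (q - 1)))) (fun q => nhom (tor_d (H q)))
  (fun q => hles_b (L1 q)) (fun q => hles_a (L1 q)) (fun q => hles_c (L1 q))
  (fun q => hles_a (L2 q)) (fun q => hles_c (L2 q)) _ _ _ _ _ _ _ n0.
- by move=> q b; apply: hles_surj.
- by move=> q a; apply: (hles_ab (L1 q)).
- by move=> q a; apply: (hles_ca (L1 q)).
- by move=> q a; apply: (hles_bc (L1 q)).
- by move=> q a; apply: (hles_ca (L2 q)).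
- move=> q a z /(hles_bc (L2 q))[y <-].
  by rewrite (TP0 q a y) raddf0.
- exact: TP0.
- by move=> q a q0; apply: tor_zero; apply: H0.
- move=> q a q0; apply: tor_zero => z.
  by rewrite -(quo_reprK z) (P0 q0 (quo_repr z)) raddf0.
exists S; split=> //; apply: homology_converges_iso S3 => q {S S1 S2}.
apply: isomorphic_sym.
pose K := kernel_mod (hles_a (L2 q) 0 \o hles_b (L1 q) 0 :
  {linear nhom (tor_d (Q q)) 0 -> nhom (tor_d (P (q - 1))) 0}).
pose pr (Y : lmodType A) : {linear t (P q) Y -> t (Q q) Y} := tmap (quo_pi (Bd q)) idfun.
pose ep (X : lmodType A) : {linear t X (R 0) -> t X N} := tmap idfun (rs_e R).
pose dn (Y : lmodType A) : {linear t (P q) Y -> t (P (q - 1)) Y} :=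
  tmap (cx_d P q (q - 1)) idfun.
pose up (Y : lmodType A) : {linear t (P (q - -1)) Y -> t (P q) Y} :=
  tmap (cx_d P (q - -1) q) idfun.
have exQ : exact_at (cx_d P (q - -1) q) (quo_pi (Bd q)).
  by move=> x; rewrite quo_pi0P (cx_boundariesP (j := q - -1)) ?opprK.
have prE n : exact_at (up (R n)) (pr (R n)) by apply: (tp_free_exact (freeR n)).
have prS n z : exists y, pr (R n) y = z.
  have [_ _] := tp_free_short_exact t (freeR n) (boundaries_ses P q); exact.
have epE i : exact_at (tor_d (P i) 0) (ep (P i)).
  exact: tp_projective_exact (@rs_exact0 _ _ R).
have epS i z : exists y, ep (P i) y = z.
  apply/(@tp_projective_exact _ t (P i) _ _ N (rs_e R) \0) => //; last exact: tp_map0r.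
  by move=> x; split=> // _; apply: rs_surj.
(* Membership in [K], seen on the double complex of [P] and [R]: the differential of [y] along [P]
   must be a boundary along [R]. *)
have KP c y : hrep (pr (R 0) y) c -> c \in smem K <->
    exists v, tor_d (P (q - 1)) 0 v = dn (R 0) y.
  move=> yc; rewrite kernel_modP /=.
  have := hles_ind_a (L2 q) (hles_ind_b (L1 q) yc) => /hrep_eq0 ->.
  suff -> : tmap (val : {linear B (q - 1) -> P (q - 1)}) idfun
     (tmap (g q) idfun (pr (R 0) y)) = dn (R 0) y by [].
  rewrite /pr /dn (tp_map_comp (f := quo_pi (Bd q)) (f2 := g q \o quo_pi (Bd q)) (g2 := idfun))//.
  by apply: tp_map_comp => // x; apply: gE.
have hN : forall y, hom_next (tor_d (Q q)) 0 y = 0 by [].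
(* Both sides are images of [t (P q) (R 0)]: augmenting [R] leads to [t (P q) N], and dividing by
   the boundaries of [P] leads to [t (Q q) (R 0)]. Classes correspond when one [y] yields
   representatives of both. *)
apply: (@iso_of_rel _ _ (sub_of K) (fun w c => exists y,
  hrep (ep (P q) y) w /\ hrep (pr (R 0) y) (val c))).
- move=> a w c w' c' [y [yw yc]] [y' [yw' yc']]; exists (a *: y + y').
  by rewrite !linearP; split; apply: hrep_lin.
- move=> w; have [z dz zw] := hrep_ex w; have [y yz] := epS q z.
  have [c0 c0P] := hrep_tot (tor_d (Q q) 0) (hN (pr (R 0) y)).
  have cK : c0 \in smem K.
    apply/(KP _ _ c0P)/epE; rewrite /ep /dn tmap_comm -/(ep (P q)) yz.
    exact: dz.
  by exists (SubOf cK), y; rewrite yz.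
- move=> c; have [u _ uc] := hrep_ex (val c); have [y yu] := prS 0%N u.
  rewrite -yu in uc.
  have [|w yw] := @hrep_tot _ _ _ _ (td (q - -1) q) (td q (q + -1)) (ep (P q) y).
    have /(KP _ _ uc)[v vE] := valP c.
    by rewrite /td -tmap_comm -[tmap (cx_d P q _) idfun y]/(dn (R 0) y) -vE; apply/epE; exists v.
  by exists w, y.
- move=> c [y [/(fun h => iffLR (hrep_eq0 h) erefl)[z' z'E] yc]].
  apply: val_inj; rewrite [RHS]raddf0; apply/(hrep_eq0 yc).
  have [y' y'z] := epS _ z'.
  have /epE[v vE] : ep (P q) (y - up (R 0) y') = 0.
    by rewrite raddfB/= -z'E -y'z /ep tmap_comm subrr.
  exists (pr (R 1) v); rewrite /tor_d /pr tmap_comm -/(tor_d (P q) 0) vE raddfB/=.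
  have pu0 : pr (R 0) (up (R 0) y') = 0 by apply/prE; exists y'.
  by rewrite -[X in _ - X]/(pr (R 0) (up (R 0) y')) pu0 subr0.
- move=> w [y [yw /(fun h => iffLR (hrep_eq0 h) erefl)[u uE]]].
  apply/(hrep_eq0 yw); have [v vu] := prS 1%N u.
  have /prE[y' y'E] : pr (R 0) (y - tor_d (P q) 0 v) = 0.
    by rewrite raddfB/= -uE -vu /pr /tor_d tmap_comm subrr.
  exists (ep _ y'); rewrite /td /ep -tmap_comm -/(up (R 0)) y'E.
  have et0 : ep (P q) (tor_d (P q) 0 v) = 0 by apply/epE; exists v.
  by rewrite -/(ep (P q)) raddfB/= et0 subr0.
Qed.

End Complex.
End HyperTor.

(** * The Koszul complex *)

Lemma cx_homology_zero (A : comPzRingType) e (X : complex A e) q :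
  zero_module (X q) -> zero_module (cx_homology X q).
Proof.
move=> X0 c; have [x _ xc] := hrep_ex c; apply/(hrep_eq0 xc); exists 0.
by rewrite (X0 x) raddf0.
Qed.

Lemma kosz_neg (A : comPzRingType) m (M : lmodType A) q :
  q < 0 -> zero_module (kosz m M q).
Proof. by move=> q0 x; apply/funext => -[S Sq]; exfalso; move/eqP: Sq; lia. Qed.

Lemma coh_ext_d (A : comPzRingType) (N X : lmodType A) p :
  coh (ext_d (free_resolution N) X) p = Ext p N X.
Proof. by case: p. Qed.

Lemma coh_cext_d (A : comPzRingType) (X N : lmodType A) p :
  coh (cext_d N (free_resolution X)) p = Ext p X N.
Proof. by case: p. Qed.

Lemma nhom_tor_d (A : comPzRingType) (X N : lmodType A) p :
  nhom (tor_d (standard_tensor A) (free_resolution N) X) p = Tor p X N.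
Proof. by case: p. Qed.

Theorem theorem1p17 (A : comPzRingType) (noethA : noetherian A)
    (m : nat) (u : 'I_m -> A) (M N : lmodType A)
    (fgM : finitely_generated M) (fgN : finitely_generated N) :
  [/\ forall (E : cochain_complex A)
        (f : chain_map (koszul_cochain u M) E),
      injective_resolution f ->
      exists S : spectral_sequence A 1,
        [/\ first_quadrant S,
            forall p q : nat,
              isomorphic (S 2%N p q) (Ext p N (cx_homology (koszul_cochain u M) q))
          & cohomology_converges S (cx_homology (hom_to_complex N E))],
      forall (P : chain_complex A)
        (f : chain_map P (koszul_chain u M)),
      fg_projective_resolution f ->
      exists S : spectral_sequence A 1,
        [/\ first_quadrant S,
            forall p q : nat,
              isomorphic (S 2%N p q) (Ext p (cx_homology (koszul_chain u M) q) N)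
          & cohomology_converges S (cx_homology (hom_from_complex P N))]
    & forall (P : chain_complex A)
        (f : chain_map P (koszul_chain u M)),
      fg_projective_resolution f ->
      exists S : spectral_sequence A (-1),
        [/\ first_quadrant S,
            forall p q : nat,
              isomorphic (S 2%N p q) (Tor p (cx_homology (koszul_chain u M) q) N)
          & homology_converges S (cx_homology (tensor_complex P N))]].
Proof.
split.
- move=> E f [[n0 E0] injE qf].
  have [||S [S1 S2 S3]] := @hyperext_spectral_sequence A N (free_resolution N) E
    (cx_homology (koszul_cochain u M)) n0 _ injE E0.
  + by move=> q; apply/isomorphic_sym/(quasi_iso_homology _ qf).
  + by move=> q q0; apply/cx_homology_zero/kosz_neg.
  exists S; split=> // p q; rewrite -coh_ext_d; apply: S2.
- move=> P f [[n0 P0] projP qf].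
  have [|q|q|S [S1 S2 S3]] := @contravariant_hyperext_spectral_sequence A N P
    (cx_homology (koszul_chain u M)) n0 (fun q => free_resolution _) _ _ P0.
  + by move=> q; apply: quasi_iso_homology qf.
  + by have [] := projP q.
  + by move=> q0; apply/cx_homology_zero/kosz_neg.
  exists S; split=> // p q; rewrite -coh_cext_d; apply: S2.
- move=> P f [[n0 P0] projP qf].
  (* The concrete tensor product and free resolution are substituted only here, where the
     conclusions become [Tor] and [tensor_complex] by computation. *)
  have [|q|q|S [S1 S2 S3]] := @hypertor_spectral_sequence A (standard_tensor A) N
    (free_resolution N) (fun n => free_mod_free_on A (syzygy N n)) P
    (cx_homology (koszul_chain u M)) n0 _ _ P0.
  + by move=> q; apply: quasi_iso_homology qf.
  + by have [] := projP q.
  + by move=> q0; apply/cx_homology_zero/kosz_neg.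
  exists S; split=> // p q; rewrite -nhom_tor_d; apply: S2.
Qed.
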